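(* To every expanding polynomial $T$ normalized on $[-1,1]$, with $d=\deg T$, every integer $0\le\epsilon\le d-1$ and every Jacobi matrix $\tilde J$ on $l^2(\mathbb Z)$ with spectrum contained in $[-1,1]$ one can associate a Jacobi matrix $J=J(\epsilon,\tilde J)=J(\epsilon,\tilde J;T)$ on $l^2(\mathbb Z)$, with spectrum contained in $T^{-1}([-1,1])$, which solves the Renormalization Equation $$V_\epsilon^*(z-J)^{-1}V_\epsilon=(T(z)-\tilde J)^{-1}\,T'(z)/d ,\qquad z\in\mathbb C\setminus T^{-1}([-1,1]),$$ where $V_\epsilon:l^2(\mathbb Z)\to l^2(\mathbb Z)$ is the isometry $V_\epsilon|k\rangle=|\epsilon+dk\rangle$, in such a way that moreover the following holds. There is an absolute constant $c<1$ (in particular independent of $T$) such that, whenever the critical values $t_i$ of $T$ satisfy $\min_i|t_i|\ge 10$, $$\|J(\epsilon,\tilde J_1;T)-J(\epsilon,\tilde J_2;T)\|\le c\,\|\tilde J_1-\tilde J_2\|$$ for all $0\le\epsilon\le d-1$ and all Jacobi matrices $\tilde J_1,\tilde J_2$ on $l^2(\mathbb Z)$ with spectrum contained in $[-1,1]$ (operator norm).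
   Context: $\{|k\rangle\}_{k\in\mathbb Z}$ is the standard orthonormal basis of $l^2(\mathbb Z)$. A Jacobi matrix is a bounded self-adjoint operator $J$ on $l^2(\mathbb Z)$ of the form $J|k\rangle=p_k|k-1\rangle+q_k|k\rangle+p_{k+1}|k+1\rangle$ with $p_k\ge 0$, $q_k\in\mathbb R$. An expanding polynomial normalized on $[-1,1]$ is a real polynomial $T$ of degree $d\ge2$ with positive leading coefficient, all of whose critical points $c_1<\dots<c_{d-1}$ are real and simple, whose critical values $t_i=T(c_i)$ satisfy $|t_i|>1$, and for which the full preimage satisfies $T^{-1}([-1,1])\subset[-1,1]$ (the paper writes $T^{-1}:[-1,1]\to[-1,1]$). *)

(* Defs.v *)
From HB Require Import structures.
From mathcomp Require Import all_boot all_order all_algebra.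
From mathcomp Require Import all_classical all_reals.
From mathcomp Require Import ereal esum numfun complex ring.

Set Implicit Arguments.
Unset Strict Implicit.
Unset Printing Implicit Defensive.

Import Order.TTheory GRing.Theory Num.Theory.
Import Normc.

Local Open Scope classical_set_scope.
Local Open Scope ring_scope.
Local Open Scope complex_scope.

Section HilbertSpace.
Variable R : realType.

Definition l2_set : set (int -> R[i]^o) :=
  [set u | summable setT (fun k => (normc (u k) ^+ 2)%:E)].

Definition l2_pred : {pred int -> R[i]^o} := mem l2_set.

Lemma summable_ge0_le (f g : int -> R) :
  (forall k, 0 <= f k <= g k) ->
  summable setT (fun k => (g k)%:E) -> summable setT (fun k => (f k)%:E).
Proof.
move=> fg; apply: le_lt_trans; apply: le_esum => k _ /=.
case/andP: (fg k) => f0 fgk; rewrite lee_fin !ger0_norm//.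
exact: le_trans fgk.
Qed.

Lemma summable_mulrn (f : int -> R) n :
  summable setT (fun k => (f k)%:E) -> summable setT (fun k => (f k *+ n)%:E).
Proof.
move=> sf; elim: n => [|n IHn].
  by rewrite /summable esum1 ?ltry// => k _; rewrite mulr0n /= normr0.
have -> : (fun k => (f k *+ n.+1)%:E) =
          (fun k => (f k)%:E) \+ (fun k => (f k *+ n)%:E) :> (int -> \bar R).
  by apply/funext => k; rewrite mulrS EFinD.
exact: summableD.
Qed.

Lemma l2_submod_closed : submod_closed l2_pred.
Proof.
split.
  rewrite inE /l2_set /mkset /summable esum1 ?ltry// => k _.
  by rewrite -[X in normc X]/(0 : R[i]) normc0 expr0n /= normr0.
move=> a u v; rewrite !inE /l2_set /mkset => su sv.
have n0 (z : R[i]) : 0 <= normc z by case: z => x y; exact: sqrtr_ge0.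
pose n := Num.bound (normc a ^+ 2 *+ 2).
pose A k : R := normc (u k) ^+ 2 *+ n.
pose B k : R := normc (v k) ^+ 2 *+ 2.
apply: (@summable_ge0_le _ (fun k => A k + B k)).
  move=> k; rewrite sqr_ge0 /A /B /=.
  have -> : (a *: u + v) k = a * u k + v k by [].
  have := le_normcD (a * u k) (v k); rewrite normcM => h.
  set x := normc a; set y := normc (u k); set z := normc (v k).
  apply: (@le_trans _ _ ((x * y + z) ^+ 2)).
    by apply: lerXn2r => //; rewrite nnegrE ?addr_ge0 ?mulr_ge0 ?n0.
  apply: (@le_trans _ _ (x ^+ 2 *+ 2 * y ^+ 2 + z ^+ 2 *+ 2)).
    rewrite -subr_ge0.
    have -> : x ^+ 2 *+ 2 * y ^+ 2 + z ^+ 2 *+ 2 - (x * y + z) ^+ 2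
            = (x * y - z) ^+ 2 by ring.
    exact: sqr_ge0.
  rewrite lerD2r -[leRHS]mulr_natl ler_wpM2r ?sqr_ge0//.
  by apply/ltW/archi_boundP; rewrite mulrn_wge0 ?sqr_ge0.
have -> : (fun k => (A k + B k)%:E) =
          (fun k => (A k)%:E) \+ (fun k => (B k)%:E) :> (int -> \bar R).
  by apply/funext => k; rewrite EFinD.
by apply: summableD; exact: summable_mulrn.
Qed.

HB.instance Definition _ :=
  GRing.isSubmodClosed.Build _ _ l2_pred l2_submod_closed.

Record l2 : Type := L2 { l2_val : int -> R[i]^o; _ : l2_val \in l2_pred }.

HB.instance Definition _ := [isSub for l2_val].
HB.instance Definition _ := [Choice of l2 by <:].
HB.instance Definition _ := [SubChoice_isSubLmodule of l2 by <:].

End HilbertSpace.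

Coercion l2_val : l2 >-> Funclass.

Section Basis.
Variable R : realType.

Lemma ket_subproof (k : int) :
  (fun j : int => (j == k)%:R : R[i]^o) \in @l2_pred R.
Proof.
rewrite inE /l2_set /mkset /summable (esumID [set k]) ?setTI//.
rewrite esum_set1 ?abse_ge0// [X in (_ + X)%E]esum1 ?adde0 ?ltry//.
move=> j /eqP/negbTE jk; rewrite jk.
by rewrite -[X in normc X]/(0 : R[i]) normc0 expr0n /= normr0.
Qed.

Definition ket (k : int) : l2 R := L2 (ket_subproof k).

Lemma interlace_subproof (d eps : nat) (u : l2 R) :
  (fun j : int => if (d %| j - eps%:Z)%Z then u ((j - eps%:Z) %/ d)%Z else 0)
  \in @l2_pred R.
Proof.
pose D : set int := [set j | (d %| j - eps%:Z)%Z].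
pose e (j : int) := ((j - eps%:Z) %/ d)%Z.
have einj : set_inj D e.
  move=> i j; rewrite !inE /D /= => di dj eij.
  by apply: (addIr (- eps%:Z)); rewrite -(divzK di) -(divzK dj) -/(e i) eij.
have := valP u; rewrite !inE /l2_set /= /summable; apply: le_lt_trans.
apply: (@le_trans _ _ (\esum_(j in D) `|(normc (u (e j)) ^+ 2)%:E|%E)).
  rewrite [leRHS]esum_mkcond; apply: le_esum => j _.
  have -> : (j \in D) = (d %| j - eps%:Z)%Z by apply/idP/idP; rewrite inE.
  case: ifP => // _.
  by rewrite -[X in normc X]/(0 : R[i]) normc0 expr0n /= normr0.
rewrite -(esum_image D e (fun k => `|(normc (u k) ^+ 2)%:E|%E))//.
rewrite esum_mkcond; apply: le_esum => k _.
by case: ifP.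
Qed.

(* The isometry |k> |-> |eps + d k>, see [interlace_ket] *)
Definition interlace (d eps : nat) (u : l2 R) : l2 R :=
  L2 (interlace_subproof d eps u).

Lemma interlace_ket (d eps : nat) (k : int) : (0 < d)%N ->
  interlace d eps (ket k) = ket (eps%:Z + d%:Z * k).
Proof.
move=> d0; apply/val_inj/funext => j /=.
have [dj|ndj] := ifPn.
  congr (nat_of_bool _)%:R.
  have dn0 : d%:Z != 0 by rewrite eqz_nat -lt0n.
  rewrite -(inj_eq (mulIf dn0)) divzK// mulrC.
  by rewrite subr_eq addrC.
case: eqP ndj => // ->; rewrite addrAC subrr add0r dvdz_mulr //.
Qed.

End Basis.

Section Operators.
Variable R : realType.
Implicit Types (A B : l2 R -> l2 R) (u v : l2 R) (z : R[i]) (T : {poly R}).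

(* Sum of an absolutely summable real family over the integers *)
Definition sumZ (f : int -> R) : R :=
  fine (\esum_(k in setT) (f^\+ k)%:E) - fine (\esum_(k in setT) (f^\- k)%:E).

Definition dotp u v : R[i] :=
  sumZ (fun k => complex.Re ((u k)^* * v k)) +i*
  sumZ (fun k => complex.Im ((u k)^* * v k)).

Definition l2norm u : R :=
  Num.sqrt (fine (\esum_(k in setT) (normc (u k) ^+ 2)%:E)).

Definition bounded_op A :=
  linear A /\ exists M : R, forall u, l2norm (A u) <= M * l2norm u.

(* Meaningful for bounded operators only, since [sup] is total *)
Definition opnorm A : R := sup [set l2norm (A u) | u in [set u | l2norm u <= 1]].

Definition is_adjoint A B := forall u v, dotp (A u) v = dotp u (B v).

(* The junk value 0 is never reached when [A] is bounded *)
Definition adjoint A : l2 R -> l2 R :=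
  xget (fun=> 0) [set B | bounded_op B /\ is_adjoint A B].

Definition is_inverse A B := [/\ bounded_op B, cancel A B & cancel B A].

Definition scal_sub z A : l2 R -> l2 R := fun u => z *: u - A u.

Definition spectrum A : set R[i] :=
  [set z | ~ exists B, is_inverse (scal_sub z A) B].

(* The junk value 0 is reached exactly on the spectrum of [A] *)
Definition resolvent z A : l2 R -> l2 R :=
  xget (fun=> 0) [set B | is_inverse (scal_sub z A) B].

Definition jacobi A :=
  [/\ bounded_op A, is_adjoint A A &
   exists p q : int -> R, forall k, 0 <= p k /\
     A (ket R k) = (p k)%:C *: ket R (k - 1) + (q k)%:C *: ket R k
                   + (p (k + 1))%:C *: ket R (k + 1)].

Definition cpoly T : {poly R[i]} := map_poly (real_complex R) T.

Definition degree T : nat := (size T).-1.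

Definition segment : set R[i] := [set x%:C | x in [set x : R | -1 <= x <= 1]].

Definition preimage_segment T : set R[i] := [set z | segment (cpoly T).[z]].

Definition expanding T :=
  [/\ (2 <= degree T)%N /\ 0 < lead_coef T,
      forall z, root (cpoly T^`()) z -> exists x : R, z = x%:C,
      forall x, root T^`() x -> mup x T^`() = 1%N,
      forall x, root T^`() x -> 1 < `|T.[x]| &
      preimage_segment T `<=` segment].

Definition renormalization_equation T (eps : nat) (Jt J : l2 R -> l2 R) :=
  let V := interlace (degree T) eps in
  forall z, ~ preimage_segment T z -> forall u,
    adjoint V (resolvent z J (V u)) =
    ((cpoly T^`()).[z] / (degree T)%:R) *: resolvent (cpoly T).[z] Jt u.

End Operators.

(* Main.v *)
Require Import Defs.
From mathcomp Require Import all_boot all_order all_algebra.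
From mathcomp Require Import all_classical all_reals.
From mathcomp Require Import ereal esum numfun complex ring lra zify.
Import Order.TTheory GRing.Theory Num.Theory.
Import Normc.

(** Notation: d = deg T, c_i are the n = d - 1 critical points, t_i = T(c_i),
a the leading coefficient and tau = prod_i (X - c_i), so T' = d a tau.

Cutting J at the sites eps + d k leaves a finite Jacobi block of size n
between any two consecutive cuts, and V^* (z - J)^-1 V is the inverse of the
Schur complement obtained by eliminating the blocks.  Partial fractions
([T_interp], [one_interp], [T_critwt]) give, with positive weights w_i,
  d (T(z) - s) / T'(z) = z - q - sum_i w_i sgn(t_i) (t_i - s) / (z - c_i).
With Jt in place of s this says that the equation holds as soon as every
block has the eigenvalues c_1, ..., c_n and, for each i separately, the
couplings of the eigenvectors of eigenvalue c_i to the cut sites form a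
bidiagonal operator L_i with L_i^* L_i = w_i sgn(t_i) (t_i - Jt).  The right
side is positive definite, because |t_i| > 1 and the spectrum of Jt lies in
[-1, 1] ([numerical_range]); so L_i is a Cholesky factor on the whole line.
Its pivots are the continued fractions of the left half-lines ([cflim]).
This choice of factor makes L_i invertible ([bidiag_inverse]), which keeps
the points c_i out of the spectrum of J.

The squares of the entries of L_i attached to one block form a measure on the
critical points, and the recurrence coefficients of its orthogonal
polynomials are the entries of the block.  Only the coupling to the left cut
has been used so far; the one to the right cut comes out right because the
last orthogonal polynomial is known explicitly ([opmx_last]).  In the
eigenbasis of the blocks J is an arrow operator,
  J V = q V + sum_i F_i L_i,   J F_i = c_i F_i + V L_i^*,
and its resolvent is explicit, both away from the c_i ([regular_inverse]) and
at c_i ([critical_inverse]).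

For the contraction let |t_i| >= 10.  Then all pivots are at least 9, and
entries of Jt that move by at most delta move the pivots by at most
5/4 delta, so the weights by a relative amount rho = 5/36 delta.  Squared
norms of monic orthogonal polynomials are minima, hence move by a relative
amount rho as well; this bounds the change of the off-diagonal entries of J by
3/2 rho and of the diagonal ones by 17/6 rho, whatever the number of points,
since the entries and the critical points are at most 1 in absolute value.
The norm of the difference, a tridiagonal matrix, is therefore at most
(17/6 + 2 * 3/2) * 5/36 delta = 175/216 delta. *)

Set Implicit Arguments.
Unset Strict Implicit.
Unset Printing Implicit Defensive.

Local Open Scope classical_set_scope.
Local Open Scope ring_scope.

(** * Lagrange interpolation and orthogonal polynomials on finitely many points *)

(** A nonnegative quadratic in t has nonpositive discriminant; the
Cauchy-Schwarz inequalities below are all instances of this. *)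
Lemma discriminant_le (R : realFieldType) (a b c : R) : 0 <= c ->
  (forall t, 0 <= a + 2 * t * b + t ^+ 2 * c) -> b ^+ 2 <= a * c.
Proof.
rewrite le_eqVlt => /predU1P[<-|c0] H.
  have [->|b0] := eqVneq b 0; first by rewrite expr0n mulr0.
  have := H (- (a + 1) / (2 * b)).
  have -> : a + 2 * (- (a + 1) / (2 * b)) * b + (- (a + 1) / (2 * b)) ^+ 2 * 0 = -1.
    by field; rewrite b0.
  by rewrite oppr_ge0 ler10.
have := H (- b / c).
have -> : a + 2 * (- b / c) * b + (- b / c) ^+ 2 * c = (a * c - b ^+ 2) / c.
  by field; rewrite gt_eqF.
by rewrite pmulr_lge0 ?invr_gt0// subr_ge0.
Qed.

Section Lagrange.
Variables (R : fieldType) (n : nat) (c : 'I_n -> R).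
Hypothesis cinj : injective c.
Implicit Type f : {poly R}.

Lemma poly_eq0_points f : (size f <= n)%N -> (forall i, f.[c i] = 0) -> f = 0.
Proof.
move=> sf f0; apply/eqP; apply: contraTT sf => fn0; rewrite -ltnNge.
have := @max_poly_roots _ f [seq c i | i <- enum 'I_n] fn0.
rewrite size_map size_enum_ord; apply.
  by apply/allP => _ /mapP[i _ ->]; rewrite /root f0.
by rewrite map_inj_uniq ?enum_uniq.
Qed.

Definition lagrange_basis i : {poly R} := \prod_(j | j != i) ('X - (c j)%:P).
Definition dlag i : R := \prod_(j | j != i) (c i - c j).

Lemma lagrange_basis_monic i : lagrange_basis i \is monic.
Proof. by apply: monic_prod => j _; exact: monicXsubC. Qed.

Lemma size_lagrange_basis i : size (lagrange_basis i) = n.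
Proof.
rewrite /lagrange_basis size_prod; last by move=> j _; rewrite polyXsubC_eq0.
rewrite (eq_bigr (fun=> 2%N)) => [|j _]; last by rewrite size_XsubC.
rewrite sum_nat_const.
have -> : #|(fun j : 'I_n => j != i)| = n.-1.
  by have := cardC1 i; rewrite card_ord => <-; apply: eq_card => j; rewrite !inE.
have := ltn_ord i; lia.
Qed.

Lemma horner_lagrange_basis i z : (lagrange_basis i).[z] = \prod_(j | j != i) (z - c j).
Proof. by rewrite horner_prod; apply: eq_bigr => j _; rewrite hornerXsubC. Qed.

Lemma horner_lagrange_basis_eq i : (lagrange_basis i).[c i] = dlag i.
Proof. exact: horner_lagrange_basis. Qed.

Lemma horner_lagrange_basis_neq i j : i != j -> (lagrange_basis i).[c j] = 0.
Proof.
by move=> ij; rewrite horner_lagrange_basis (bigD1 j) 1?eq_sym//= subrr mul0r.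
Qed.

Lemma dlag_neq0 i : dlag i != 0.
Proof.
apply/prodf_neq0 => j ji; rewrite subr_eq0.
by apply: contra ji => /eqP/cinj ->.
Qed.

Lemma lagrange_interp f : (size f <= n)%N -> f = \sum_i (f.[c i] / dlag i) *: lagrange_basis i.
Proof.
move=> sf; apply/eqP; rewrite -subr_eq0; apply/eqP/poly_eq0_points.
  rewrite (leq_trans (size_polyD _ _))// geq_max sf size_polyN.
  apply: (leq_trans (size_sum _ _ _)).
  apply/bigmax_leqP => i _.
  by rewrite (leq_trans (size_scale_leq _ _))// size_lagrange_basis.
move=> i; rewrite hornerD hornerN horner_sum (bigD1 i)//= big1 ?addr0.
  by rewrite hornerZ horner_lagrange_basis_eq divfK ?dlag_neq0// subrr.
by move=> j ji; rewrite hornerZ horner_lagrange_basis_neq ?mulr0.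
Qed.

(** The functional f |-> sum_i f(c_i) / dlag c i thus kills every polynomial of
degree below n - 1, which identifies the last orthogonal polynomial up to a
factor. *)
Lemma lagrange_coef f : (size f <= n)%N -> \sum_i f.[c i] / dlag i = f`_n.-1.
Proof.
move=> sf; rewrite [in RHS](lagrange_interp sf) coef_sum; apply: eq_bigr => i _.
rewrite coefZ.
have := lagrange_basis_monic i; rewrite monicE lead_coefE size_lagrange_basis => /eqP ->.
by rewrite mulr1.
Qed.

End Lagrange.

Section OrthogonalPolynomials.
Variables (R : rcfType) (n : nat) (c : 'I_n -> R).
Hypothesis cinj : injective c.
Implicit Type (x : 'I_n -> R) (f g : {poly R}).

Definition ip x f g : R := \sum_i x i * (f.[c i] * g.[c i]).

Lemma ipC x f g : ip x f g = ip x g f.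
Proof. by apply: eq_bigr => i _; rewrite (mulrC f.[_]). Qed.

Lemma ipDl x f g h : ip x (f + g) h = ip x f h + ip x g h.
Proof. by rewrite -big_split; apply: eq_bigr => i _; rewrite hornerD mulrDl mulrDr. Qed.

Lemma ipZl x a f h : ip x (a *: f) h = a * ip x f h.
Proof. by rewrite /ip mulr_sumr; apply: eq_bigr => i _; rewrite hornerZ; ring. Qed.

Lemma ipNl x f h : ip x (- f) h = - ip x f h.
Proof. by rewrite -scaleN1r ipZl mulN1r. Qed.

Lemma ipDr x f g h : ip x h (f + g) = ip x h f + ip x h g.
Proof. by rewrite ipC ipDl !(ipC x h). Qed.

Lemma ipZr x a f h : ip x h (a *: f) = a * ip x h f.
Proof. by rewrite ipC ipZl (ipC x h). Qed.

Lemma ipX x f g : ip x ('X * f) g = ip x f ('X * g).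
Proof. by apply: eq_bigr => i _; rewrite !hornerM hornerX; ring. Qed.

Lemma ip0l x f : ip x 0 f = 0.
Proof. by rewrite /ip big1// => i _; rewrite horner0 mul0r mulr0. Qed.

(** The Stieltjes procedure, carrying the last two polynomials.  The initial 0
stands for the polynomial of index -1; the quotient by its norm is a division
by 0, multiplied by the polynomial 0. *)
Fixpoint monic_ops x j : {poly R} * {poly R} :=
  if j is j'.+1 then
    let: (f, g) := monic_ops x j' in
    (('X * f - (ip x ('X * f) f / ip x f f) *: f) - (ip x f f / ip x g g) *: g, f)
  else (1, 0).

Definition monic_op x j := (monic_ops x j).1.
Definition nrm x j := ip x (monic_op x j) (monic_op x j).
Definition diagcoef x j := ip x ('X * monic_op x j) (monic_op x j) / nrm x j.

Lemma monic_op0 x : monic_op x 0 = 1. Proof. by []. Qed.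

Lemma monic_op1 x : monic_op x 1 = 'X * monic_op x 0 - diagcoef x 0 *: monic_op x 0.
Proof. by rewrite /monic_op /= scaler0 subr0. Qed.

Lemma monic_opSS x j : monic_op x j.+2 =
  'X * monic_op x j.+1 - diagcoef x j.+1 *: monic_op x j.+1 - (nrm x j.+1 / nrm x j) *: monic_op x j.
Proof. by rewrite /diagcoef /nrm /monic_op /=; case: (monic_ops x j). Qed.

Lemma monic_op_monic_size x j : monic_op x j \is monic /\ size (monic_op x j) = j.+1.
Proof.
have H (f g : {poly R}) m : f \is monic -> size f = m.+1 -> (size g <= m.+1)%N ->
    'X * f - g \is monic /\ size ('X * f - g) = m.+2.
  move=> mf sf sg.
  have sX : size ('X * f) = m.+2.
    by rewrite mulrC size_mulX ?sf// -size_poly_gt0 sf.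
  have lt : (size (- g) < size ('X * f)%R)%N by rewrite size_polyN sX.
  by split; [rewrite monicE lead_coefDl// lead_coefM lead_coefX mul1r -monicE
            | rewrite size_polyDl].
suff [] : (monic_op x j \is monic /\ size (monic_op x j) = j.+1) /\
          (monic_op x j.+1 \is monic /\ size (monic_op x j.+1) = j.+2) by [].
elim: j => [|j [[m1 s1] [m2 s2]]].
  have h0 : monic_op x 0 \is monic /\ size (monic_op x 0) = 1%N.
    by rewrite monic_op0 monic1 size_poly1.
  split => //; rewrite monic_op1; apply: H; rewrite ?h0.1 ?h0.2//.
  by rewrite (leq_trans (size_scale_leq _ _))// h0.2.
split => //; rewrite monic_opSS -addrA -opprD; apply: H => //.
rewrite (leq_trans (size_polyD _ _))// geq_max.
by rewrite !(leq_trans (size_scale_leq _ _)) ?s1 ?s2//.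
Qed.

Lemma monic_op_monic x j : monic_op x j \is monic.
Proof. exact: (monic_op_monic_size x j).1. Qed.

Lemma size_monic_op x j : size (monic_op x j) = j.+1.
Proof. exact: (monic_op_monic_size x j).2. Qed.

Lemma monic_op_coef x j : (monic_op x j)`_j = 1.
Proof. by have := monic_op_monic x j; rewrite monicE lead_coefE size_monic_op => /eqP. Qed.

Section Weight.
Variable x : 'I_n -> R.
Hypothesis x0 : forall i, 0 < x i.

Lemma ip_ge0 f : 0 <= ip x f f.
Proof. by apply: sumr_ge0 => i _; rewrite mulr_ge0 ?(ltW (x0 i))// -expr2 sqr_ge0. Qed.

Lemma ip_eq0 f : ip x f f = 0 -> forall i, f.[c i] = 0.
Proof.
move=> /eqP; rewrite psumr_eq0 => [/allP H i|i _]; last first.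
  by rewrite mulr_ge0 ?(ltW (x0 i))// -expr2 sqr_ge0.
have := H i; rewrite mem_index_enum => /(_ isT) /=.
by rewrite mulf_eq0 gt_eqF//= mulf_eq0 orbb => /eqP.
Qed.

Lemma nrm_gt0 j : (j < n)%N -> 0 < nrm x j.
Proof.
move=> jn; rewrite lt_def ip_ge0 andbT; apply/eqP => /ip_eq0 H.
have := poly_eq0_points cinj _ H; rewrite size_monic_op => /(_ jn) h.
by have := size_monic_op x j; rewrite h size_poly0.
Qed.

(** Multiplication by X is symmetric for the inner product, so X pi_j meets only
pi_(j-1), pi_j and pi_(j+1); the coefficients of the recurrence cancel the
first two. *)
Lemma monic_op_orth j : (j <= n)%N -> forall l, (l < j)%N -> ip x (monic_op x j) (monic_op x l) = 0.
Proof.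
elim/ltn_ind: j => -[|j] IH jn l lj //.
have nz m : (m <= j)%N -> nrm x m != 0 by move=> mj; rewrite gt_eqF// nrm_gt0//; lia.
have qE m : (m <= j)%N -> ip x ('X * monic_op x m) (monic_op x m) = diagcoef x m * nrm x m.
  by move=> mj; rewrite /diagcoef divfK// nz.
case: j => [|j] in IH jn lj nz qE *.
  case: l lj => // _; rewrite monic_op1 ipDl ipNl ipZl qE// subrr//.
have IHj : forall l, (l < j.+1)%N -> ip x (monic_op x j.+1) (monic_op x l) = 0.
  by move=> m mj; apply: IH => //; lia.
have IHj' : forall l, (l < j)%N -> ip x (monic_op x j) (monic_op x l) = 0.
  by move=> m mj; apply: IH => //; lia.
rewrite monic_opSS !(ipDl, ipNl, ipZl).
have [->|lj1] := eqVneq l j.+1.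
  by rewrite qE// subrr ipC IHj// mulr0 subr0.
have {}lj : (l < j.+1)%N by lia.
rewrite (IHj l lj) mulr0 subr0 ipX.
have EX : ip x (monic_op x j.+1) ('X * monic_op x l) = ip x (monic_op x j.+1) (monic_op x l.+1).
  case: l lj {lj1} => [|l] lj.
    rewrite monic_op1 ipDr -scaleN1r !ipZr IHj//; ring.
  rewrite monic_opSS !ipDr -!scaleN1r !ipZr !IHj; try lia.
  ring.
rewrite EX.
have [->|lj2] := eqVneq l j.
  by rewrite -/(nrm x j) divfK ?subrr// nz//.
rewrite IHj ?IHj'; try lia.
by rewrite mulr0 subr0.
Qed.

Lemma monic_op_orth_poly j f : (j <= n)%N -> (size f <= j)%N -> ip x (monic_op x j) f = 0.
Proof.
move=> jn; move: {2}(size f) (leqnn (size f)) => m; elim: m f => [|m IHm] f fm fj.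
  by move: fm; rewrite leqn0 size_poly_eq0 => /eqP ->; rewrite ipC ip0l.
have [fm'|fm'] := leqP (size f) m; first exact: IHm.
have sf : size f = m.+1 by lia.
rewrite -(subrK (f`_m *: monic_op x m) f) ipDr ipZr monic_op_orth ?mulr0 ?addr0; try lia.
have sg : (size (f - f`_m *: monic_op x m)%R <= m)%N.
  apply/leq_sizeP => i; rewrite leq_eqVlt => /predU1P[<-|mi].
    by rewrite coefB coefZ monic_op_coef mulr1 subrr.
  have -> : (f - f`_m *: monic_op x m)`_i = f`_i - f`_m * (monic_op x m)`_i.
    by rewrite coefB coefZ.
  have -> : f`_i = 0 by rewrite nth_default ?sf.
  by rewrite [(monic_op x m)`_i]nth_default ?size_monic_op// mulr0 subr0.
by apply: IHm => //; apply: leq_trans sg _; rewrite ltnW// -sf.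
Qed.

(** A monic polynomial of degree j is pi_j plus a polynomial of lower degree,
which is orthogonal to pi_j. *)
Lemma nrm_min j f : (j <= n)%N -> f \is monic -> size f = j.+1 -> nrm x j <= ip x f f.
Proof.
move=> jn mf sf.
have sg : (size (f - monic_op x j)%R <= j)%N.
  apply/leq_sizeP => i; rewrite leq_eqVlt => /predU1P[<-|ji].
    have := mf; rewrite monicE lead_coefE sf => /eqP h.
    by rewrite coefB monic_op_coef h subrr.
  by rewrite coefB !nth_default ?subr0 ?size_monic_op ?sf.
rewrite -(subrK (monic_op x j) f); move: (f - _) sg => g sg.
rewrite ipDl !ipDr (ipC x g (monic_op x j)) monic_op_orth_poly// addr0 add0r.
by rewrite -/(nrm x j) lerDr ip_ge0.
Qed.

(** Compare pi_(j+1) with the monic polynomial X pi_j, and use |c i| <= 1. *)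
Lemma nrm_le j : (forall i, `|c i| <= 1) -> (j < n)%N -> nrm x j.+1 <= nrm x j.
Proof.
move=> c1 jn.
have mX : 'X * monic_op x j \is monic by rewrite monicMl ?monicX ?monic_op_monic.
have sX : size ('X * monic_op x j) = j.+2.
  by rewrite mulrC size_mulX ?size_monic_op// monic_neq0// monic_op_monic.
apply: le_trans (nrm_min jn mX sX) _.
apply: ler_sum => i _; rewrite !hornerM hornerX ler_pM2l// mulrACA -!expr2.
rewrite ler_piMl ?sqr_ge0// -(expr1n R 2) -real_normK ?num_real//.
by rewrite lerXn2r ?nnegrE.
Qed.

Lemma diagcoef_le1 j : (forall i, `|c i| <= 1) -> (j < n)%N -> `|diagcoef x j| <= 1.
Proof.
move=> c1 jn; have N0 := nrm_gt0 jn.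
rewrite /diagcoef normrM normfV (ger0_norm (ltW N0)) ler_pdivrMr// mul1r.
apply: le_trans (ler_norm_sum _ _ _) _; apply: ler_sum => i _.
rewrite hornerM hornerX -mulrA normrM (ger0_norm (ltW (x0 i))) ler_pM2l//.
by rewrite -expr2 normrM [`|_ ^+ 2|]ger0_norm ?sqr_ge0// ler_piMl ?sqr_ge0.
Qed.

(** Normalized orthogonal polynomials at the points, times square roots of the
weights: the orthogonal matrix that diagonalizes the Jacobi block. *)
Definition opmx j i := (monic_op x j).[c i] * Num.sqrt (x i) / Num.sqrt (nrm x j).
Definition offcoef j := Num.sqrt (nrm x j / nrm x j.-1).

Let sx i : Num.sqrt (x i) * Num.sqrt (x i) = x i.
Proof. by rewrite -expr2 sqr_sqrtr// ltW. Qed.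

Let sx0 i : 0 < Num.sqrt (x i).
Proof. by rewrite sqrtr_gt0. Qed.

Let sn j : (j < n)%N -> Num.sqrt (nrm x j) * Num.sqrt (nrm x j) = nrm x j.
Proof. by move=> jn; rewrite -expr2 sqr_sqrtr// ltW// nrm_gt0. Qed.

Let sn0 j : (j < n)%N -> 0 < Num.sqrt (nrm x j).
Proof. by move=> jn; rewrite sqrtr_gt0 nrm_gt0. Qed.

Lemma opmx_row j l : (j < n)%N -> (l < n)%N -> \sum_i opmx j i * opmx l i = (j == l)%:R.
Proof.
move=> jn ln.
have -> : \sum_i opmx j i * opmx l i =
    ip x (monic_op x j) (monic_op x l) / (Num.sqrt (nrm x j) * Num.sqrt (nrm x l)).
  rewrite /ip mulr_suml; apply: eq_bigr => i _; rewrite /opmx.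
  have := sx i; set s := Num.sqrt (x i) => <-.
  by field; rewrite !gt_eqF// sn0.
have [<-|jl] := eqVneq j l; first by rewrite sn// divff// gt_eqF// nrm_gt0.
have [jl'|lj|/eqP] := ltngtP j l; last by rewrite (negbTE jl).
  by rewrite ipC monic_op_orth ?mul0r// ltnW.
by rewrite monic_op_orth ?mul0r// ltnW.
Qed.

(** A square matrix with orthonormal rows has orthonormal columns. *)
Lemma opmx_col i l : \sum_(j < n) opmx j i * opmx j l = (i == l)%:R.
Proof.
pose U : 'M[R]_n := \matrix_(j, i) opmx j i.
have UU : U *m U^T = 1%:M.
  apply/matrixP => j k; rewrite !mxE -val_eqE -(opmx_row (ltn_ord j) (ltn_ord k)).
  by apply: eq_bigr => m _; rewrite !mxE.
have /matrixP/(_ i l) := mulmx1C UU; rewrite !mxE => <-.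
by apply: eq_bigr => m _; rewrite !mxE.
Qed.

Lemma opmx_expand (v : 'I_n -> R) i : v i = \sum_(j < n) opmx j i * \sum_l opmx j l * v l.
Proof.
under eq_bigr do rewrite mulr_sumr.
rewrite exchange_big /= (bigD1 i)//= [X in _ + X]big1 ?addr0.
  under eq_bigr do rewrite mulrA.
  by rewrite -mulr_suml opmx_col eqxx mul1r.
move=> l li; under eq_bigr do rewrite mulrA.
by rewrite -mulr_suml opmx_col eq_sym (negbTE li) mul0r.
Qed.

(** pi_n is orthogonal to n independent functions on a set of n points. *)
Lemma monic_op_n i : (monic_op x n).[c i] = 0.
Proof.
have H : (monic_op x n).[c i] * Num.sqrt (x i) = 0.
  rewrite (opmx_expand (fun i => (monic_op x n).[c i] * Num.sqrt (x i))) big1// => j _.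
  have -> : \sum_l opmx j l * ((monic_op x n).[c l] * Num.sqrt (x l)) =
      ip x (monic_op x n) (monic_op x j) / Num.sqrt (nrm x j).
    rewrite /ip mulr_suml; apply: eq_bigr => l _; rewrite /opmx.
    have := sx l; set s := Num.sqrt (x l) => <-.
    by field; rewrite gt_eqF// sn0.
  by rewrite monic_op_orth// mul0r mulr0.
by move/eqP: H; rewrite mulf_eq0 (gt_eqF (sx0 i)) orbF => /eqP.
Qed.

Lemma opmx_n i : opmx n i = 0.
Proof. by rewrite /opmx monic_op_n !mul0r. Qed.

Lemma offcoef_le1 j : (forall i, `|c i| <= 1) -> (0 < j < n)%N -> 0 <= offcoef j <= 1.
Proof.
case: j => // j c1 /= jn; rewrite sqrtr_ge0/= -sqrtr1 ler_sqrt// ler_pdivrMr ?mul1r.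
  exact: nrm_le (ltnW jn).
exact: nrm_gt0 (ltnW jn).
Qed.

Let offcoefE j : (j < n)%N -> offcoef j.+1 = Num.sqrt (nrm x j.+1) / Num.sqrt (nrm x j).
Proof. by move=> jn; rewrite /offcoef sqrtrM ?sqrtrV ?ip_ge0. Qed.

Lemma sqrt_opmx j i : (j <= n)%N ->
  Num.sqrt (nrm x j) * opmx j i = (monic_op x j).[c i] * Num.sqrt (x i).
Proof.
rewrite leq_eqVlt => /predU1P[->|jn]; first by rewrite opmx_n monic_op_n mulr0 mul0r.
by rewrite /opmx; field; rewrite gt_eqF// sn0.
Qed.

Lemma opmx_rec0 i : (0 < n)%N -> c i * opmx 0 i = diagcoef x 0 * opmx 0 i + offcoef 1 * opmx 1 i.
Proof.
move=> n0; rewrite offcoefE// [X in _ + X]mulrAC sqrt_opmx// monic_op1.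
rewrite hornerD hornerN hornerM hornerX hornerZ /opmx; field.
by rewrite gt_eqF// sn0.
Qed.

Lemma opmx_rec j i : (j.+1 < n)%N -> c i * opmx j.+1 i =
  offcoef j.+1 * opmx j i + diagcoef x j.+1 * opmx j.+1 i + offcoef j.+2 * opmx j.+2 i.
Proof.
move=> jn; have jn' := ltnW jn.
rewrite !offcoefE// [X in _ + X]mulrAC sqrt_opmx// monic_opSS.
rewrite !(hornerD, hornerN, hornerM, hornerX, hornerZ) /opmx.
have h := sn0 jn; have h' := sn0 jn'.
have := sn jn; set s := Num.sqrt (nrm x j.+1) in h * => <-.
have := sn jn'; set s' := Num.sqrt (nrm x j) in h' * => <-.
by field; rewrite !gt_eqF.
Qed.

Lemma opmx_first i : (0 < n)%N -> Num.sqrt (nrm x 0) * opmx 0 i = Num.sqrt (x i).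
Proof. by move=> n0; rewrite sqrt_opmx// monic_op0 hornerC mul1r. Qed.

Lemma nrm0E : nrm x 0 = \sum_i x i.
Proof. by apply: eq_bigr => i _; rewrite monic_op0 hornerC !mulr1. Qed.

(** By [lagrange_coef] the vector 1 / (dlag c i * sqrt (x i)) is orthogonal to
all rows but the last, hence proportional to it; the factor is read off from
the leading coefficient. *)
Lemma opmx_last i : (0 < n)%N ->
  opmx n.-1 i * Num.sqrt (x i) = Num.sqrt (nrm x n.-1) / dlag c i.
Proof.
move=> n0; have nn : (n.-1 < n)%N by rewrite prednK.
have dn0 := dlag_neq0 cinj.
have H : (dlag c i * Num.sqrt (x i))^-1 = opmx n.-1 i / Num.sqrt (nrm x n.-1).
  rewrite (opmx_expand (fun i => (dlag c i * Num.sqrt (x i))^-1)).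
  have E (j : 'I_n) : \sum_l opmx j l * (dlag c l * Num.sqrt (x l))^-1 =
      (monic_op x j)`_n.-1 / Num.sqrt (nrm x j).
    rewrite -(lagrange_coef cinj) ?size_monic_op// mulr_suml; apply: eq_bigr => l _.
    by rewrite /opmx; field; rewrite dn0 !gt_eqF ?sn0.
  rewrite (bigD1 (Ordinal nn))//= (E (Ordinal nn)) monic_op_coef div1r.
  rewrite [X in _ + X]big1 ?addr0// => j jn.
  rewrite E nth_default ?mul0r ?mulr0// size_monic_op.
  have := ltn_ord j; have : (j : nat) != n.-1 by rewrite -[n.-1]/(val (Ordinal nn)) val_eqE.
  lia.
have -> : opmx n.-1 i = (dlag c i * Num.sqrt (x i))^-1 * Num.sqrt (nrm x n.-1).
  by rewrite H divfK// gt_eqF// sn0.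
by field; rewrite dn0 gt_eqF// sx0.
Qed.

(** The last row, made explicit by [opmx_last], has norm 1. *)
Lemma nrm_lastV : (0 < n)%N -> (nrm x n.-1)^-1 = \sum_i (dlag c i ^+ 2 * x i)^-1.
Proof.
move=> n0; have nn : (n.-1 < n)%N by rewrite prednK.
have dn0 := dlag_neq0 cinj.
have E1 : \sum_i opmx n.-1 i * opmx n.-1 i = 1 by rewrite opmx_row// eqxx.
rewrite -[LHS]mul1r -[X in X * _]E1 mulr_suml; apply: eq_bigr => i _.
have E : opmx n.-1 i = Num.sqrt (nrm x n.-1) / (dlag c i * Num.sqrt (x i)).
  have /(canRL (mulfK _)) -> := opmx_last i n0; first by field; rewrite dn0 gt_eqF// sx0.
  by rewrite gt_eqF// sx0.
rewrite E; have h := sx0 i; have h' := sn0 nn.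
have := sx i; set s := Num.sqrt (x i) in h * => <-.
have := sn nn; set s' := Num.sqrt (nrm x n.-1) in h' * => <-.
by field; rewrite dn0 !gt_eqF.
Qed.

End Weight.

(** In this range of rho, (1 + rho) / (1 - rho) <= (1 + 3/2 rho)^2. *)
Lemma sqrt_ratio_stable (rho u v : R) : 0 <= rho <= 5 / 18 -> 0 <= u -> 0 <= v ->
  v ^+ 2 * (1 - rho) <= (1 + rho) * u ^+ 2 -> v - u <= 3 / 2 * rho * u.
Proof.
move=> /andP[r0 r1] u0 v0 H.
have K : 1 + rho <= (1 - rho) * (1 + 3 / 2 * rho) ^+ 2 by nra.
have r1' : 0 < 1 - rho by lra.
have : v ^+ 2 <= ((1 + 3 / 2 * rho) * u) ^+ 2.
  rewrite -(ler_pM2r r1') (le_trans H)// exprMn mulrAC ler_wpM2r ?sqr_ge0//.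
  by rewrite mulrC.
rewrite ler_pXn2r ?nnegrE//; last by apply: mulr_ge0 => //; lra.
by rewrite mulrDl mul1r => h; lra.
Qed.

Section Stability.
Variables (x y : 'I_n -> R) (rho : R).
Hypotheses (x0 : forall i, 0 < x i) (y0 : forall i, 0 < y i).
Hypothesis rho_le : 0 <= rho <= 5 / 18.
Hypothesis xy : forall i, `|y i - x i| <= rho * x i.

Lemma ip_weight_le f : (1 - rho) * ip x f f <= ip y f f <= (1 + rho) * ip x f f.
Proof.
rewrite /ip !mulr_sumr; apply/andP; split; apply: ler_sum => i _;
  rewrite mulrA ler_wpM2r -?expr2 ?sqr_ge0//; have := xy i; rewrite ler_norml => /andP[*]; lra.
Qed.

(** Both norms are minima over the same monic polynomials, of quadratic forms
that differ by a relative amount rho. *)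
Lemma nrm_stable j : (j <= n)%N ->
  (1 - rho) * nrm x j <= nrm y j <= (1 + rho) * nrm x j.
Proof.
move=> jn; have /andP[r0 r1] := rho_le; apply/andP; split.
  have /andP[h _] := ip_weight_le (monic_op y j); apply: le_trans h.
  rewrite ler_wpM2l ?nrm_min ?monic_op_monic ?size_monic_op//; lra.
have /andP[_ h] := ip_weight_le (monic_op x j); apply: le_trans h.
by rewrite nrm_min ?monic_op_monic ?size_monic_op.
Qed.

Lemma nrm_ratio_stable j : (0 < j < n)%N ->
  offcoef y j ^+ 2 * (1 - rho) <= (1 + rho) * offcoef x j ^+ 2.
Proof.
case: j => // j /= jn; have jn' := ltnW jn.
have xj := nrm_gt0 x0 jn'; have yj := nrm_gt0 y0 jn'.
rewrite /offcoef !sqr_sqrtr ?divr_ge0 ?ip_ge0//=.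
have /andP[h1 _] := nrm_stable (ltnW jn'); have /andP[_ h2] := nrm_stable jn'.
have /andP[r0 r1] := rho_le.
rewrite mulrAC ler_pdivrMr// mulrA mulrAC ler_pdivlMr//.
have xj1 : 0 <= nrm x j.+1 := ip_ge0 x0 _.
have := ip_ge0 x0 (monic_op x j.+1); rewrite -/(nrm x j.+1).
have h3 : nrm y j.+1 * ((1 - rho) * nrm x j) <= (1 + rho) * nrm x j.+1 * nrm y j.
  by rewrite ler_pM ?(ip_ge0 y0)// mulr_ge0// ?(ltW xj)//; lra.
by rewrite mulrA in h3.
Qed.

Lemma first_stable : (0 < n)%N ->
  Num.sqrt (nrm y 0) - Num.sqrt (nrm x 0) <= 3 / 2 * rho * Num.sqrt (nrm x 0).
Proof.
move=> n0; apply: sqrt_ratio_stable; rewrite ?sqrtr_ge0//.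
rewrite !sqr_sqrtr ?ip_ge0//.
have /andP[_ h] := nrm_stable (leq0n n); have /andP[r0 r1] := rho_le.
have := ip_ge0 y0 (monic_op y 0); rewrite -/(nrm y 0); nra.
Qed.

Lemma offcoef_stable j : (0 < j < n)%N -> offcoef y j - offcoef x j <= 3 / 2 * rho * offcoef x j.
Proof.
move=> jn; apply: sqrt_ratio_stable; rewrite ?sqrtr_ge0//.
exact: nrm_ratio_stable.
Qed.

Lemma invsqrt_stable j : (j < n)%N ->
  (Num.sqrt (nrm y j))^-1 - (Num.sqrt (nrm x j))^-1 <= 3 / 2 * rho * (Num.sqrt (nrm x j))^-1.
Proof.
move=> jn; apply: sqrt_ratio_stable; rewrite ?invr_ge0 ?sqrtr_ge0//.
rewrite !exprVn !sqr_sqrtr ?ip_ge0//.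
have xj := nrm_gt0 x0 jn; have yj := nrm_gt0 y0 jn.
rewrite mulrC ler_pdivrMr// mulrAC ler_pdivlMr//.
have /andP[h1 h2] := nrm_stable (ltnW jn); have /andP[r0 r1] := rho_le; nra.
Qed.

Lemma monic_op_coef_step z j : (monic_op z j.+2)`_j.+1 = (monic_op z j.+1)`_j - diagcoef z j.+1.
Proof.
rewrite monic_opSS !(coefB, coefZ, coefXM) /= !monic_op_coef.
by rewrite [(monic_op z j)`_j.+1]nth_default ?size_monic_op// mulr0 mulr1 subr0.
Qed.

Lemma monic_op_coef_first z : (monic_op z 1)`_0 = - diagcoef z 0.
Proof. by rewrite monic_op1 !(coefB, coefZ, coefXM) /= monic_op_coef mulr1 sub0r. Qed.

(** Let del be the change of the second coefficient of pi_(j+1), and pi' the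
polynomial for the weight y.  Then del |pi_j|^2 is the x-inner product of
pi'_(j+1) and pi_j.  Their y-inner product vanishes, so only the difference of
the weights counts, which is at most rho x. *)
Lemma coef_stable j : (forall i, `|c i| <= 1) -> (j < n)%N ->
  `|(monic_op y j.+1)`_j - (monic_op x j.+1)`_j| <= 17 / 12 * rho.
Proof.
move=> c1 jn; set del := _ - _; have /andP[r0 r1] := rho_le.
have Nx := nrm_gt0 x0 jn.
pose g := monic_op y j.+1 - monic_op x j.+1.
have gj : g`_j = del by rewrite coefB.
have sg : (size g <= j.+1)%N.
  apply/leq_sizeP => i; rewrite leq_eqVlt => /predU1P[<-|ji].
    by rewrite coefB !monic_op_coef subrr.
  by rewrite coefB !nth_default ?subr0 ?size_monic_op.
have sg' : (size (g - del *: monic_op x j)%R <= j)%N.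
  apply/leq_sizeP => i; rewrite leq_eqVlt => /predU1P[<-|ji].
    by rewrite coefB coefZ monic_op_coef mulr1 gj subrr.
  rewrite coefB coefZ (nth_default _ (leq_trans sg ji)).
  by rewrite nth_default ?size_monic_op// mulr0 subr0.
have E1 : ip x (monic_op y j.+1) (monic_op x j) = del * nrm x j.
  have -> : monic_op y j.+1 = (g - del *: monic_op x j) + del *: monic_op x j + monic_op x j.+1.
    by rewrite /g !subrK.
  rewrite ipDl (monic_op_orth x0)// addr0 ipDl ipZl (ipC x _ (monic_op x j)).
  by rewrite (monic_op_orth_poly x0 (ltnW jn) sg') add0r.
pose s := \sum_i (x i - y i) * ((monic_op y j.+1).[c i] * (monic_op x j).[c i]).
have E2 : s = del * nrm x j.
  have O : ip y (monic_op y j.+1) (monic_op x j) = 0 by rewrite monic_op_orth_poly// size_monic_op.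
  rewrite -E1 -[RHS]subr0 -O -sumrB; apply: eq_bigr => i _; ring.
have E3 : s ^+ 2 <= (rho * ip x (monic_op y j.+1) (monic_op y j.+1)) * (rho * nrm x j).
  apply: discriminant_le => [|t]; first by rewrite mulr_ge0// ip_ge0.
  rewrite /ip /nrm /s !mulr_sumr -!big_split /=; apply: sumr_ge0 => i _.
  move: (monic_op y j.+1).[c i] (monic_op x j).[c i] => F G.
  have := xy i; rewrite ler_norml => /andP[h1 h2]; have := x0 i => xi.
  have -> : rho * (x i * (F * F)) + 2 * t * ((x i - y i) * (F * G))
      + t ^+ 2 * (rho * (x i * (G * G))) =
    ((rho * x i + (x i - y i)) / 2) * (F + t * G) ^+ 2
     + ((rho * x i - (x i - y i)) / 2) * (F - t * G) ^+ 2 by field.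
  by rewrite addr_ge0// mulr_ge0 ?sqr_ge0//; lra.
have E4 : (1 - rho) * ip x (monic_op y j.+1) (monic_op y j.+1) <= (1 + rho) * nrm x j.
  have /andP[h _] := ip_weight_le (monic_op y j.+1).
  have /andP[_ h'] := nrm_stable jn; have h'' := nrm_le x0 c1 jn.
  rewrite (le_trans h)// (le_trans h')// ler_wpM2l//; lra.
have E5 : del ^+ 2 * (1 - rho) <= rho ^+ 2 * (1 + rho).
  rewrite -(ler_pM2r (exprn_gt0 2 Nx)).
  have -> : del ^+ 2 * (1 - rho) * nrm x j ^+ 2 = (1 - rho) * s ^+ 2 by rewrite E2; ring.
  apply: le_trans (ler_wpM2l _ E3) _; first lra.
  have -> : (1 - rho) * (rho * ip x (monic_op y j.+1) (monic_op y j.+1) * (rho * nrm x j)) =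
     rho ^+ 2 * nrm x j * ((1 - rho) * ip x (monic_op y j.+1) (monic_op y j.+1)) by ring.
  have -> : rho ^+ 2 * (1 + rho) * nrm x j ^+ 2 = rho ^+ 2 * nrm x j * ((1 + rho) * nrm x j) by ring.
  by rewrite ler_wpM2l// mulr_ge0 ?sqr_ge0// ltW.
have h : `|del| - rho <= 3 / 2 * rho * rho.
  apply: sqrt_ratio_stable => //; rewrite real_normK ?num_real//.
  by rewrite (mulrC (1 + rho)).
clear - h r0 r1; nra.
Qed.

(** Diagonal coefficients are differences of consecutive second coefficients. *)
Lemma diagcoef_stable j : (forall i, `|c i| <= 1) -> (j < n)%N ->
  `|diagcoef y j - diagcoef x j| <= 17 / 6 * rho.
Proof.
move=> c1; have /andP[r0 r1] := rho_le; case: j => [|j] jn.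
  have := coef_stable c1 jn; rewrite !monic_op_coef_first.
  by rewrite !ler_norml => /andP[*]; lra.
have := coef_stable c1 jn; have := coef_stable c1 (ltnW jn).
by rewrite !monic_op_coef_step !ler_norml => /andP[? ?] /andP[? ?]; lra.
Qed.

End Stability.
End OrthogonalPolynomials.

Local Open Scope complex_scope.

(** * Critical points of an expanding polynomial *)

Section RealRooted.
Variable R : realFieldType.
Implicit Types (l : seq R) (z : R).

Definition rprod l : {poly R} := \prod_(x <- l) ('X - x%:P).

Lemma rprod_cons x l : rprod (x :: l) = ('X - x%:P) * rprod l.
Proof. by rewrite /rprod big_cons. Qed.

Lemma rprod_neq0 l z : z \notin l -> (rprod l).[z] != 0.
Proof. by move=> zl; rewrite -/(root _ z) root_prod_XsubC. Qed.

Lemma rprod_logderiv l z : z \notin l ->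
  (rprod l)^`().[z] = (rprod l).[z] * \sum_(x <- l) (z - x)^-1.
Proof.
elim: l => [|x l IHl]; first by rewrite /rprod !big_nil derivC horner0 mulr0.
rewrite inE negb_or => /andP[zx zl].
rewrite rprod_cons derivM derivXsubC mul1r big_cons.
rewrite !(hornerXsubC, hornerD, hornerM) IHl//; field.
by rewrite subr_eq0.
Qed.

(** F^2 times - (F' / F)', written as a sum of squares.  It forces F F'' < 0 at a critical
point of F that is not a root. *)
Lemma rprod_concave l z : z \notin l ->
  (rprod l)^`().[z] ^+ 2 - (rprod l).[z] * (rprod l)^`()^`().[z] =
  (rprod l).[z] ^+ 2 * \sum_(x <- l) (z - x)^-1 ^+ 2.
Proof.
elim: l => [|x l IHl].
  by rewrite /rprod !big_nil derivC horner0 deriv0 horner0 !mulr0 expr0n subr0.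
rewrite inE negb_or => /andP[zx zl].
have d1 : (1 : {poly R})^`() = 0 by rewrite -polyC1 derivC.
rewrite rprod_cons !(derivXsubC, derivM, derivD) d1 mul0r add0r !mul1r big_cons.
rewrite !(hornerXsubC, hornerD, hornerM).
have zx0 : z - x != 0 by rewrite subr_eq0.
have -> : (z - x)^-1 ^+ 2 + \sum_(x0 <- l) (z - x0)^-1 ^+ 2 =
   (z - x)^-1 ^+ 2 + (rprod l).[z] ^- 2 * ((rprod l).[z] ^+ 2 * \sum_(x0 <- l) (z - x0)^-1 ^+ 2).
  by rewrite mulKf// expf_neq0// rprod_neq0.
rewrite -IHl//.
have := rprod_neq0 zl.
move: (rprod l).[z] (rprod l)^`().[z] (rprod l)^`()^`().[z] => a b c a0.
by field; rewrite a0 zx0.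
Qed.

Lemma mup_rprod l z : mup z (rprod l) = count_mem z l.
Proof.
elim: l => [|x l IHl].
  by rewrite /rprod big_nil mupNroot// rootC oner_eq0.
rewrite rprod_cons mupM ?polyXsubC_eq0//; last first.
  by rewrite monic_neq0// monic_prod_XsubC.
by rewrite -['X - x%:P]expr1 mup_XsubCX IHl /=; case: eqP.
Qed.

Lemma size_rprod l : size (rprod l) = (size l).+1.
Proof. exact: size_prod_XsubC. Qed.

End RealRooted.

Section Expanding.
Variable R : realType.
Implicit Types (T : {poly R}).

Lemma cpoly_real_roots T : (forall z, root (cpoly T) z -> exists x : R, z = x%:C) ->
  exists l : seq R, T = lead_coef T *: rprod l.
Proof.
move=> H.
have [->|T0] := eqVneq T 0.
  by exists [::]; rewrite lead_coef0 scale0r.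
have [r Er] := closed_field_poly_normal (cpoly T).
have lc : lead_coef (cpoly T) = (lead_coef T)%:C by rewrite lead_coef_map.
have c0 : lead_coef (cpoly T) != 0 by rewrite lead_coef_eq0 map_poly_eq0.
have rr z : z \in r -> z = (complex.Re z)%:C.
  move=> zr; have [|x ->//] := H z.
  by rewrite Er rootZ// root_prod_XsubC.
exists [seq complex.Re z | z <- r].
apply: (map_poly_inj (real_complex R)).
rewrite -/(cpoly T) [LHS]Er lc map_polyZ /rprod; congr (_ *: _).
rewrite rmorph_prod /= big_map !big_seq; apply: eq_bigr => z zr.
by rewrite rmorphB /= map_polyX map_polyC /= -rr.
Qed.

(** The critical points, in an arbitrary order. *)
Definition crit T : seq R :=
  xget [::] [set s | T^`() = lead_coef T^`() *: rprod s /\ uniq s].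

Definition critpt T (i : 'I_(degree T - 1)) : R := nth 0 (crit T) i.

Variable T : {poly R}.
Hypothesis expT : expanding T.

Let a := lead_coef T.
Let d := degree T.
Let n := (d - 1)%N.
Let c := @critpt T.

Lemma deg_ge2 : (2 <= d)%N. Proof. by case: expT => -[]. Qed.
Lemma lead_gt0 : 0 < a. Proof. by case: expT => -[]. Qed.

Let n0 : (0 < n)%N. Proof. by have := deg_ge2; rewrite /n; lia. Qed.

Let dn : d = n.+1.
Proof. by rewrite /n subn1 prednK// (ltn_trans _ deg_ge2). Qed.

Let szT : size T = n.+2.
Proof. by have := deg_ge2; rewrite /n /d /degree; lia. Qed.

Lemma size_dT : size T^`() = d.
Proof.
have T0 : T != 0 by rewrite -size_poly_gt0 szT.
apply/eqP; rewrite eqn_leq dn -ltnS -szT lt_size_deriv//= ltnNge.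
apply/negP => /leq_sizeP/(_ n (leqnn n)) /eqP.
rewrite coef_deriv -mulr_natl mulf_eq0 pnatr_eq0 orFb => /eqP h.
by have := lead_gt0; rewrite /a lead_coefE szT /= h ltxx.
Qed.

Lemma lead_dT : lead_coef T^`() = d%:R * a.
Proof.
rewrite lead_coefE size_dT coef_deriv (prednK (ltnW deg_ge2)).
by rewrite /a lead_coefE mulr_natl.
Qed.

Lemma dT_neq0 : T^`() != 0.
Proof. by rewrite -size_poly_gt0 size_dT; have := deg_ge2; lia. Qed.

(** Over the algebraic closure T' splits; its roots are real by hypothesis, and
distinct because their multiplicities are 1. *)
Lemma critP : T^`() = lead_coef T^`() *: rprod (crit T) /\ uniq (crit T).
Proof.
rewrite /crit; case: xgetP => [s -> []//|H]; exfalso.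
have [_ h2 h3 _ _] := expT.
have [s Es] := cpoly_real_roots h2.
apply: (H s); split => //; apply: count_mem_uniq => x.
have l0 : lead_coef T^`() != 0 by rewrite lead_coef_eq0 dT_neq0.
have rx : root T^`() x = (x \in s) by rewrite Es rootZ// root_prod_XsubC.
have [xs|xs] := boolP (x \in s); last exact/count_memPn.
rewrite -rx in xs; have := h3 x xs.
rewrite Es -mul_polyC mupM ?polyC_eq0//; last by rewrite monic_neq0// monic_prod_XsubC.
by rewrite mupNroot ?rootC// add0n mup_rprod.
Qed.

Lemma size_crit : size (crit T) = n.
Proof.
have := size_dT; rewrite {1}critP.1 size_scale ?lead_coef_eq0 ?dT_neq0// size_rprod.
by move=> h; rewrite /n -h subn1.
Qed.

Lemma critpt_inj : injective c.
Proof.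
move=> i j /eqP; rewrite /c /critpt nth_uniq ?size_crit ?critP.2//.
by move=> /eqP/val_inj.
Qed.

Definition ctau : {poly R} := \prod_i ('X - (c i)%:P).

Lemma rprod_crit : rprod (crit T) = ctau.
Proof.
by rewrite /rprod (big_nth 0) size_crit big_mkord.
Qed.

Lemma dT_tau : T^`() = (d%:R * a) *: ctau.
Proof. by rewrite {1}critP.1 lead_dT rprod_crit. Qed.

Lemma root_critpt i : root T^`() (c i).
Proof.
rewrite dT_tau /root hornerZ /ctau horner_prod (bigD1 i)//= hornerXsubC subrr.
by rewrite mul0r mulr0.
Qed.

Lemma crit_val_gt1 i : 1 < `|T.[c i]|.
Proof. by case: expT => _ _ _ + _; apply; exact: root_critpt. Qed.

(** All complex roots of T - s lie in the preimage of [-1, 1]. *)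
Lemma sub_roots (s : R) : -1 <= s <= 1 ->
  exists l : seq R, [/\ T - s%:P = a *: rprod l, size l = d & forall x, x \in l -> `|x| <= 1].
Proof.
move=> s1; have [_ _ _ _ h] := expT.
have sp : (size (- s%:P : {poly R}) < size T)%N.
  by rewrite size_polyN (leq_ltn_trans (size_polyC_leq1 _))// szT.
have lT : lead_coef (T - s%:P) = a by rewrite lead_coefDl.
have h' z : root (cpoly (T - s%:P)) z -> exists2 x : R, -1 <= x <= 1 & x%:C = z.
  rewrite /root /cpoly rmorphB /= map_polyC hornerD hornerN hornerC subr_eq0 => /eqP E.
  by apply: h; exists s => //; rewrite -E.
have [|l El] := @cpoly_real_roots (T - s%:P).
  by move=> z /h'[x _ <-]; exists x.
rewrite lT in El; exists l; split => //.
  have := congr1 (fun p : {poly R} => size p) El.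
  by rewrite /= size_polyDl// size_scale ?gt_eqF ?lead_gt0// size_rprod szT dn => -[].
move=> x xl; rewrite ler_norml.
have [|y y1 /complexI <-//] := h' x%:C.
rewrite /cpoly El map_polyZ rootZ.
  by rewrite -[x%:C]/(real_complex R x) fmorph_root root_prod_XsubC.
by rewrite fmorph_eq0 gt_eqF// lead_gt0.
Qed.

(** T' / (T - s) is a sum of terms 1 / (z - x) with |x| <= 1. *)
Lemma T_logderiv (s z : R) : -1 <= s <= 1 -> 1 < z ->
  0 < T^`().[z] / (T.[z] - s) /\ T^`().[- z] / (T.[- z] - s) < 0.
Proof.
move=> s1 z1; have [l [El sl hl]] := sub_roots s1.
have H y : 1 < `|y| -> T^`().[y] / (T.[y] - s) = \sum_(x <- l) (y - x)^-1.
  move=> y1; have yl : y \notin l by apply/negP => /hl; lra.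
  have -> : T^`() = (T - s%:P)^`() by rewrite derivB derivC subr0.
  have -> : T.[y] - s = (T - s%:P).[y] by rewrite hornerD hornerN hornerC.
  rewrite El derivZ !hornerZ rprod_logderiv//; field.
  by rewrite (rprod_neq0 yl) gt_eqF ?lead_gt0.
have [x0 [l' ell]] : exists x0 l', l = x0 :: l'.
  by case: (l) sl => [|x0 l'] h; [have := deg_ge2; rewrite -h|exists x0, l'].
have zz : 1 < `|z| by rewrite (lt_le_trans z1)// ler_norm.
split.
  rewrite H// ell big_cons ltr_pwDl//.
    have := hl x0; rewrite ell mem_head => /(_ isT); rewrite ler_norml => /andP[*].
    by rewrite invr_gt0; lra.
  rewrite big_seq; apply: sumr_ge0 => x xl; have := hl x; rewrite ell inE xl orbT => /(_ isT).
  by rewrite ler_norml => /andP[*]; rewrite invr_ge0; lra.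
rewrite H ?normrN// -oppr_gt0 -sumrN ell big_cons ltr_pwDl//.
  have := hl x0; rewrite ell mem_head => /(_ isT); rewrite ler_norml => /andP[*].
  by rewrite -invrN invr_gt0; lra.
rewrite big_seq; apply: sumr_ge0 => x xl; have := hl x; rewrite ell inE xl orbT => /(_ isT).
by rewrite ler_norml => /andP[*]; rewrite -invrN invr_ge0; lra.
Qed.

(** Beyond 1 and below -1 the logarithmic derivative of T has a sign, so T' does
not vanish. *)
Lemma critpt_le1 i : `|c i| <= 1.
Proof.
have r0 : -1 <= 0 :> R by rewrite oppr_le0.
have r1 : 0 <= 1 :> R by [].
have H := T_logderiv (introT andP (conj r0 r1)).
rewrite leNgt; apply/negP => ci.
have := root_critpt i; rewrite /root => /eqP Ti.
have [c0|c0] := leP 0 (c i).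
  rewrite ger0_norm// in ci; have [] := H _ ci.
  by rewrite Ti mul0r ltxx.
rewrite ltr0_norm// in ci; have [_] := H _ ci.
by rewrite opprK Ti mul0r ltxx.
Qed.

Lemma crit_second i : T^`()^`().[c i] = d%:R * a * dlag c i.
Proof.
rewrite dT_tau derivZ hornerZ /ctau (bigD1 i)//= derivM derivXsubC mul1r.
by rewrite hornerD hornerM hornerXsubC subrr mul0r addr0 -/(lagrange_basis c i) horner_lagrange_basis_eq.
Qed.

(** T is real-rooted and T' vanishes at c i, so T T'' < 0 there
([rprod_concave]), and T''(c i) is a positive multiple of dlag c i. *)
Lemma crit_sign i : T.[c i] * dlag c i < 0.
Proof.
have r01 : -1 <= (0 : R) <= 1 by rewrite oppr_le0 ler01.
have [l [El sl hl]] := sub_roots r01; rewrite subr0 in El.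
have Ti := crit_val_gt1 i.
have cl : c i \notin l.
  apply/negP => cl; move: Ti; rewrite El hornerZ.
  have : root (rprod l) (c i) by rewrite root_prod_XsubC.
  by rewrite /root => /eqP ->; rewrite mulr0 normr0 ltr10.
have a0 := lead_gt0.
have d0 : 0 < d%:R :> R by rewrite ltr0n; have := deg_ge2; lia.
have := rprod_concave cl.
have rt : (rprod l)^`().[c i] = 0.
  have := root_critpt i; rewrite /root El derivZ hornerZ mulf_eq0 gt_eqF//=.
  by move=> /eqP.
rewrite rt expr0n sub0r => E.
have S0 : 0 < (rprod l).[c i] ^+ 2 * \sum_(x <- l) (c i - x)^-1 ^+ 2.
  apply: mulr_gt0; first by rewrite exprn_even_gt0//= rprod_neq0.
  case: l sl cl {El hl rt E} => [|x l] sl; first by have := deg_ge2; rewrite -sl.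
  rewrite inE negb_or big_cons => /andP[xc _]; apply: ltr_pwDl.
    by rewrite exprn_even_gt0//= invr_eq0 subr_eq0.
  by apply: sumr_ge0 => y _; exact: sqr_ge0.
rewrite -E oppr_gt0 in S0.
have : T.[c i] * T^`()^`().[c i] < 0.
  rewrite El !derivZ !hornerZ mulrACA pmulr_rlt0//; exact: mulr_gt0.
by rewrite crit_second mulrCA pmulr_rlt0// mulr_gt0.
Qed.

(** The mean of the critical points, which is also the mean of the roots of T. *)
Definition qbar : R := - T`_n / (d%:R * a).

Lemma T_interp : T = a *: (ctau * ('X - qbar%:P)) + \sum_i (T.[c i] / dlag c i) *: lagrange_basis c i.
Proof.
have a0 := lead_gt0; have d0 : 0 < d%:R :> R by rewrite ltr0n; have := deg_ge2; lia.
have st : size ctau = n.+1.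
  by rewrite -rprod_crit size_rprod size_crit.
have mt : ctau \is monic by exact: monic_prod_XsubC.
have tn : ctau`_n = 1 by have := mt; rewrite monicE lead_coefE st => /eqP.
have ctop : T`_n.+1 = a by rewrite /a lead_coefE szT.
have tn1 : a * ctau`_n.-1 = n%:R * T`_n / d%:R.
  have := congr1 (fun p : {poly R} => p`_n.-1) dT_tau.
  rewrite /= coef_deriv coefZ prednK// => h; rewrite [n%:R * _]mulr_natl h; field.
  by rewrite gt_eqF.
set r := \sum_i _.
suff -> : r = T - a *: (ctau * ('X - qbar%:P)) by rewrite addrC subrK.
have sr : (size (T - a *: (ctau * ('X - qbar%:P)))%R <= n)%N.
  apply/leq_sizeP => j; rewrite leq_eqVlt => /predU1P[<-|].
    rewrite coefB coefZ mulrBr coefB coefMX coefMC tn eqn0Ngt n0 /= mul1r.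
    have nd : d%:R = n%:R + 1 :> R by rewrite dn -natr1.
    rewrite mulrBr tn1 /qbar; rewrite nd in d0 *; field.
    by rewrite (gt_eqF a0) gt_eqF.
  rewrite leq_eqVlt => /predU1P[<-|jn].
    rewrite coefB coefZ mulrBr coefB coefMX coefMC /= tn ctop.
    by rewrite nth_default ?st// mul0r subr0 mulr1 subrr.
  rewrite nth_default//; apply: leq_trans jn.
  rewrite (leq_trans (size_polyD _ _))// geq_max szT leqnn size_polyN.
  rewrite (leq_trans (size_scale_leq _ _))// (leq_trans (size_polyMleq _ _))//.
  by rewrite st size_XsubC addn2.
rewrite [RHS](lagrange_interp critpt_inj sr); apply: eq_bigr => i _.
rewrite hornerD hornerN hornerZ hornerM.
have -> : ctau.[c i] = 0.
  by rewrite /ctau horner_prod (bigD1 i)//= hornerXsubC subrr mul0r.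
by rewrite mul0r mulr0 subr0.
Qed.

Lemma one_interp : 1 = \sum_i (dlag c i)^-1 *: lagrange_basis c i.
Proof.
rewrite [LHS](lagrange_interp critpt_inj) ?size_poly1//.
by apply: eq_bigr => i _; rewrite hornerC div1r.
Qed.

(** The number d / |T''(c i)|, by [crit_second]. *)
Definition critwt i : R := `|a * dlag c i|^-1.

Lemma critwt_gt0 i : 0 < critwt i.
Proof. by rewrite invr_gt0 normr_gt0 mulf_neq0 ?dlag_neq0 ?gt_eqF ?lead_gt0//; exact: critpt_inj. Qed.

(** By [crit_sign] the partial fraction coefficient - 1 / (a dlag) has the sign
of t_i. *)
Lemma critwt_sg i : critwt i * Num.sg T.[c i] = - (a * dlag c i)^-1.
Proof.
have s := crit_sign i; have a0 := lead_gt0.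
rewrite /critwt; have [t0|t0|t0] := ltgtP T.[c i] 0.
- have dl : 0 < dlag c i by move: s; rewrite nmulr_rlt0.
  by rewrite ltr0_sg// gtr0_norm ?mulr_gt0// mulrN1.
- have dl : dlag c i < 0 by move: s; rewrite pmulr_rlt0.
  by rewrite gtr0_sg// ltr0_norm ?pmulr_rlt0// mulr1 invrN.
- by move: s; rewrite t0 mul0r ltxx.
Qed.

Lemma T_critwt (s z : R) : (forall i, z != c i) ->
  T.[z] - s = a * ctau.[z] * (z - qbar - \sum_i critwt i * Num.sg T.[c i] * (T.[c i] - s) / (z - c i)).
Proof.
move=> zc; have a0 : a != 0 by rewrite gt_eqF// lead_gt0.
have tz i : ctau.[z] = (z - c i) * (lagrange_basis c i).[z].
  by rewrite /ctau (bigD1 i)//= hornerM hornerXsubC.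
have E1 := congr1 (fun p => p.[z]) T_interp.
have E2 := congr1 (fun p => p.[z]) one_interp.
rewrite /= !(hornerXsubC, hornerD, hornerM, hornerZ, hornerC, horner_sum) in E1 E2.
have Es : s = \sum_i s * ((dlag c i)^-1 *: lagrange_basis c i).[z] by rewrite -mulr_sumr -E2 mulr1.
rewrite {1}E1 {1}Es -addrA -sumrB [RHS]mulrBr -[a * _ * (z - qbar)]mulrA; congr (_ + _).
rewrite mulr_sumr -sumrN; apply: eq_bigr => i _; rewrite !hornerZ critwt_sg (tz i); field.
by rewrite a0 dlag_neq0 ?subr_eq0 ?zc//; exact: critpt_inj.
Qed.

(** In the expansion [T_critwt] at z = r and z = - r, r > 1, the left sides have
known signs by [T_logderiv].  Adding the two inequalities bounds the sum by
r^2. *)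
Lemma critwt_sum_le (s : R) : -1 <= s <= 1 ->
  \sum_i critwt i * `|T.[c i] - s| <= 1.
Proof.
move=> s1.
have Wi i : critwt i * `|T.[c i] - s| = critwt i * Num.sg T.[c i] * (T.[c i] - s).
  rewrite -mulrA; congr (_ * _).
  have := crit_val_gt1 i; case: (ltgtP T.[c i] 0) => t0.
  - by rewrite (ltr0_norm t0) => h; rewrite ltr0_norm ?ltr0_sg ?mulN1r//; lra.
  - by rewrite (gtr0_norm t0) => h; rewrite gtr0_norm ?gtr0_sg ?mul1r//; lra.
  - by rewrite t0 normr0; lra.
pose W i := critwt i * `|T.[c i] - s|.
have W0 i : 0 <= W i by rewrite mulr_ge0// ltW// critwt_gt0.
have a0 := lead_gt0; have d0 : 0 < d%:R :> R by rewrite ltr0n; have := deg_ge2; lia.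
have key z : (forall i, z != c i) -> T^`().[z] != 0 -> T.[z] - s != 0 ->
    z - qbar - \sum_i W i / (z - c i) = d%:R * (T^`().[z] / (T.[z] - s))^-1.
  move=> zc h2 h3.
  have Ez : T.[z] - s = a * ctau.[z] * (z - qbar - \sum_i W i / (z - c i)).
    rewrite (T_critwt s zc); congr (_ * (_ - _)); apply: eq_bigr => i _.
    by rewrite -Wi.
  rewrite Ez dT_tau hornerZ in h2 h3 *.
  move: h2 h3; rewrite !mulf_eq0 !negb_or => /andP[/andP[? ?] h2] /andP[_ h3].
  by field; rewrite h2 h3 !gt_eqF.
have bound r : 1 < r -> \sum_i W i <= r ^+ 2.
  move=> r1; have [h1 h2] := T_logderiv s1 r1.
  have nz y : y / (T.[r] - s) != 0 -> y != 0 /\ T.[r] - s != 0.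
    by rewrite mulf_eq0 negb_or invr_eq0 => /andP.
  have nz' y : y / (T.[- r] - s) != 0 -> y != 0 /\ T.[- r] - s != 0.
    by rewrite mulf_eq0 negb_or invr_eq0 => /andP.
  have [n1 n2] := nz _ (lt0r_neq0 h1); have [n3 n4] := nz' _ (ltr0_neq0 h2).
  have cb i : -1 <= c i <= 1 by rewrite -ler_norml critpt_le1.
  have rc i : 0 < r - c i by have /andP[] := cb i; lra.
  have rc' i : 0 < r + c i by have /andP[] := cb i; lra.
  have k1 : 0 <= r - qbar - \sum_i W i / (r - c i).
    rewrite key//; first by rewrite mulr_ge0 ?invr_ge0 ?ltW.
    by move=> i; rewrite -subr_eq0 gt_eqF.
  have k2 : - r - qbar + \sum_i W i / (r + c i) <= 0.
    have -> : \sum_i W i / (r + c i) = - \sum_i W i / (- r - c i).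
      by rewrite -sumrN; apply: eq_bigr => i _; rewrite -opprD invrN mulrN opprK.
    rewrite key//; first by rewrite nmulr_lle0 ?invr_lt0 ?ltW// pmulr_rle0.
    by move=> i; rewrite -subr_eq0 -opprD oppr_eq0 gt_eqF.
  have k3 : \sum_i W i * (2 / r) <= \sum_i W i / (r - c i) + \sum_i W i / (r + c i).
    rewrite -big_split /=; apply: ler_sum => i _; rewrite -mulrDr ler_wpM2l//.
    have r0 : 0 < r by lra.
    have -> : (r - c i)^-1 + (r + c i)^-1 = 2 * r / ((r - c i) * (r + c i)).
      by field; rewrite !gt_eqF.
    rewrite ler_pdivlMr ?mulr_gt0// mulrAC ler_pdivrMr//.
    have := sqr_ge0 (c i); nra.
  rewrite -mulr_suml in k3.
  have r0 : 0 < r by lra.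
  have : (\sum_i W i) * (2 / r) <= 2 * r by lra.
  rewrite mulrA ler_pdivrMr// expr2; lra.
rewrite leNgt; apply/negP; rewrite -/(W _) => h.
pose S := \sum_i W i.
have S1 : 1 < S := h.
(* a sum S > 1 would contradict the bound at r = 1 + e, since 2 e + e^2 < S - 1 *)
have := bound (1 + (S - 1) / (4 * S)).
rewrite -/S.
have e0 : 0 < (S - 1) / (4 * S) by rewrite divr_gt0//; lra.
have e1 : (S - 1) / (4 * S) * (4 * S) = S - 1 by rewrite divfK// gt_eqF//; lra.
move: e0 e1; set e := _ / _ => e0 e1 /(_ _) b.
have : S <= (1 + e) ^+ 2 by apply: b; lra.
nra.
Qed.

End Expanding.

(** * Summable families over the integers *)

Section SumZ.
Variable R : realType.
Implicit Types f g : int -> R.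

Definition summable_int f := summable setT (fun k => (f k)%:E).

Lemma summable_le f g : (forall k, `|f k| <= g k) ->
  summable_int g -> summable_int f.
Proof.
move=> fg; apply: le_lt_trans; apply: le_esum => k _ /=.
by rewrite lee_fin (le_trans (fg k))// ler_norm.
Qed.

Lemma summable_intD f g :
  summable_int f -> summable_int g -> summable_int (f \+ g).
Proof.
move=> sf sg; rewrite /summable_int.
have -> : (fun k => ((f \+ g) k)%:E) = (EFin \o f) \+ (EFin \o g).
  by apply/funext => k.
exact: summableD.
Qed.

Lemma esum_fin f : (forall k, 0 <= f k) -> summable_int f ->
  \esum_(k in setT) (f k)%:E \is a fin_num.
Proof.
move=> f0; rewrite /summable_int summableE.
by rewrite (eq_esum (b := fun k => (f k)%:E))// => k _ /=; rewrite ger0_norm.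
Qed.

Lemma sumZ_nneg f : (forall k, 0 <= f k) ->
  sumZ f = fine (\esum_(k in setT) (f k)%:E).
Proof.
move=> f0; rewrite /sumZ.
have -> : f^\+ = f by apply/funext => k; rewrite /funrpos max_l.
rewrite [X in _ - fine X]esum1 ?subr0// => k _.
by rewrite /funrneg max_r// oppr_le0.
Qed.

Lemma funr_posneg f k : f k = f^\+ k - f^\- k.
Proof. by rewrite -[in LHS](funrposBneg f). Qed.

Lemma sumZD_nneg f g : (forall k, 0 <= f k) -> (forall k, 0 <= g k) ->
  summable_int f -> summable_int g -> sumZ (f \+ g) = sumZ f + sumZ g.
Proof.
move=> f0 g0 sf sg; rewrite !sumZ_nneg => // [|k]; last exact: addr_ge0.
have -> : \esum_(k in setT) ((f \+ g) k)%:E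
        = (\esum_(k in setT) (f k)%:E + \esum_(k in setT) (g k)%:E)%E.
  by rewrite -esumD// => k _; rewrite lee_fin.
by rewrite fineD// esum_fin.
Qed.

Lemma funrpos_summable f : summable_int f -> summable_int f^\+.
Proof.
move=> sf; apply: (@summable_le _ (fun k => `|f k|)).
  move=> k; rewrite /funrpos ger0_norm ?le_max ?lexx ?orbT//.
  by rewrite ge_max ler_norm normr_ge0.
rewrite /summable_int/summable.
by rewrite (eq_esum (b := fun k => `|(f k)%:E|%E))// => k _ /=; rewrite normr_id.
Qed.

Lemma funrneg_summable f : summable_int f -> summable_int f^\-.
Proof.
move=> sf; apply: (@summable_le _ (fun k => `|f k|)).
  move=> k; rewrite /funrneg ger0_norm ?le_max ?lexx ?orbT//.
  by rewrite ge_max -normrN ler_norm normr_ge0.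
rewrite /summable_int/summable.
by rewrite (eq_esum (b := fun k => `|(f k)%:E|%E))// => k _ /=; rewrite normr_id.
Qed.

Lemma sumZ_posneg f : sumZ f = sumZ f^\+ - sumZ f^\-.
Proof.
rewrite [in RHS]sumZ_nneg; last by move=> k; rewrite /funrpos le_max lexx orbT.
rewrite [in RHS]sumZ_nneg//; by move=> k; rewrite /funrneg le_max lexx orbT.
Qed.

Lemma sumZ_diff f g : (forall k, 0 <= f k) -> (forall k, 0 <= g k) ->
  summable_int f -> summable_int g -> sumZ (f \- g) = sumZ f - sumZ g.
Proof.
move=> f0 g0 sf sg; pose h := f \- g.
have sh : summable_int h.
  apply: (@summable_le _ (f \+ g)); last exact: summable_intD.
  move=> k; rewrite /h /= (le_trans (ler_normB _ _))//.
  by rewrite !ger0_norm.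
have p0 k : 0 <= h^\+ k by rewrite /funrpos le_max lexx orbT.
have n0 k : 0 <= h^\- k by rewrite /funrneg le_max lexx orbT.
have E : sumZ (h^\+ \+ g) = sumZ (h^\- \+ f).
  congr sumZ; apply/funext => k /=.
  have := funr_posneg h k.
  by rewrite {1}/h /= => E; lra.
rewrite !sumZD_nneg// in E; try exact: funrpos_summable; try exact: funrneg_summable.
rewrite -/h sumZ_posneg; lra.
Qed.

Lemma sumZD f g : summable_int f -> summable_int g ->
  sumZ (f \+ g) = sumZ f + sumZ g.
Proof.
move=> sf sg.
have p0 h k : 0 <= h^\+ k :> R by rewrite /funrpos le_max lexx orbT.
have n0 h k : 0 <= h^\- k :> R by rewrite /funrneg le_max lexx orbT.
have pS := funrpos_summable; have nS := funrneg_summable.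
have -> : f \+ g = (f^\+ \+ g^\+) \- (f^\- \+ g^\-).
  apply/funext => k /=.
  by rewrite (funr_posneg f k) (funr_posneg g k); lra.
rewrite sumZ_diff ?sumZD_nneg; last first.
all: try (by move=> k; rewrite /= ?addr_ge0).
all: try (by auto).
all: try (apply: summable_intD; auto).
by rewrite (sumZ_posneg f) (sumZ_posneg g); lra.
Qed.

Lemma sumZ_ge0 f : (forall k, 0 <= f k) -> 0 <= sumZ f.
Proof.
move=> f0; rewrite sumZ_nneg// fine_ge0// esum_ge0// => k _.
by rewrite lee_fin.
Qed.

Lemma summableZ a f : summable_int f -> summable_int (fun k => a * f k).
Proof.
move=> sf; apply: (@summable_le _ (fun k => `|f k| *+ Num.bound `|a|)).
  move=> k; rewrite normrM -[leRHS]mulr_natl ler_wpM2r//.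
  by apply/ltW/archi_boundP.
apply: summable_mulrn.
rewrite /summable_int/summable.
by rewrite (eq_esum (b := fun k => `|(f k)%:E|%E))// => k _ /=; rewrite normr_id.
Qed.

Lemma sumZ0 : sumZ (fun=> 0 : R) = 0.
Proof. by rewrite sumZ_nneg// esum1. Qed.

Lemma sumZN f : summable_int f -> sumZ (fun k => - f k) = - sumZ f.
Proof.
move=> sf; apply/eqP; rewrite -addr_eq0 -sumZD//.
  rewrite (_ : _ \+ _ = fun=> 0) ?sumZ0//.
  by apply/funext => k /=; rewrite addNr.
apply: (@summable_le _ (fun k => `|f k|)) => [k|]; first by rewrite normrN.
rewrite /summable_int/summable.
by rewrite (eq_esum (b := fun k => `|(f k)%:E|%E))// => k _ /=; rewrite normr_id.
Qed.

Lemma sumZ_le f g : summable_int f -> summable_int g ->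
  (forall k, f k <= g k) -> sumZ f <= sumZ g.
Proof.
move=> sf sg fg; rewrite -subr_ge0 -sumZN// -sumZD//.
  by apply: sumZ_ge0 => k /=; rewrite subr_ge0.
apply: (@summable_le _ (fun k => `|f k|)) => [k|]; first by rewrite normrN.
rewrite /summable_int/summable.
by rewrite (eq_esum (b := fun k => `|(f k)%:E|%E))// => k _ /=; rewrite normr_id.
Qed.

Lemma fsum_le_sumZ f (A : set int) : (forall k, 0 <= f k) -> summable_int f ->
  finite_set A -> \sum_(k \in A) f k <= sumZ f.
Proof.
move=> f0 sf fA; rewrite sumZ_nneg// -lee_fin fineK; last exact: esum_fin.
apply: esum_ge; exists A; first by split.
by rewrite fsumEFin.
Qed.

Lemma sumZ_le_fsum f M : (forall k, 0 <= f k) ->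
  (forall A, finite_set A -> \sum_(k \in A) f k <= M) ->
  summable_int f /\ sumZ f <= M.
Proof.
move=> f0 H.
have E : (\esum_(k in setT) (f k)%:E <= M%:E)%E.
  apply: ge_ereal_sup => _ [A [fA _] <-].
  by rewrite fsumEFin// lee_fin H.
split.
  rewrite /summable_int/summable (eq_esum (b := fun k => (f k)%:E)).
    exact: le_lt_trans E (ltry _).
  by move=> k _ /=; rewrite ger0_norm.
rewrite sumZ_nneg// -lee_fin fineK//.
rewrite ge0_fin_numE; first exact: le_lt_trans E (ltry _).
by apply: esum_ge0 => k _; rewrite lee_fin.
Qed.

Lemma sumZZ_pos a f : 0 <= a -> (forall k, 0 <= f k) -> summable_int f ->
  sumZ (fun k => a * f k) = a * sumZ f.
Proof.
have H b g : 0 <= b -> (forall k, 0 <= g k) -> summable_int g ->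
    sumZ (fun k => b * g k) <= b * sumZ g.
  move=> b0 g0 sg; apply: (@sumZ_le_fsum (fun k => b * g k) _ _ _).2 => [k|A fA].
    exact: mulr_ge0.
  by rewrite -mulr_fsumr// ler_wpM2l// fsum_le_sumZ.
move=> a0 f0 sf; apply/eqP; rewrite eq_le H//=.
have [->|an0] := eqVneq a 0.
  by rewrite mul0r; apply: sumZ_ge0 => k; rewrite mul0r.
have {an0}a0' : 0 < a by rewrite lt_def an0.
rewrite -ler_pdivlMl//.
have := H a^-1 (fun k => a * f k); rewrite invr_ge0 a0 => /(_ isT) H'.
rewrite (le_trans _ (H' _ _))//; last exact: summableZ.
  rewrite le_eqVlt; apply/orP; left; apply/eqP; congr sumZ; apply/funext => k.
  by rewrite mulKf// gt_eqF.
by move=> k; rewrite mulr_ge0.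
Qed.

Lemma sumZZ a f : summable_int f -> sumZ (fun k => a * f k) = a * sumZ f.
Proof.
have H b : 0 <= b -> forall g, summable_int g -> sumZ (fun k => b * g k) = b * sumZ g.
  move=> b0 g sg.
  have p0 k : 0 <= g^\+ k :> R by rewrite /funrpos le_max lexx orbT.
  have n0 k : 0 <= g^\- k :> R by rewrite /funrneg le_max lexx orbT.
  have sp := funrpos_summable sg; have sn := funrneg_summable sg.
  rewrite (sumZ_posneg g) mulrBr -!sumZZ_pos// -sumZ_diff; last first.
  all: try exact: summableZ.
  all: try (by move=> k; rewrite mulr_ge0).
  congr sumZ; apply/funext => k /=; rewrite -mulrBr; congr (_ * _).
  exact: funr_posneg.
move=> sf; have [a0|/ltW a0] := leP 0 a; first exact: H.
have -> : (fun k => a * f k) = (fun k => - ((- a) * f k)).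
  by apply/funext => k; rewrite mulNr opprK.
rewrite sumZN; last exact: summableZ.
by rewrite H ?oppr_ge0// mulNr opprK.
Qed.

Lemma sumZ_delta a (j : int) (f := fun k : int => if k == j then a else 0) :
  summable_int f /\ sumZ f = a.
Proof.
have sA b : 0 <= b -> let g := fun k : int => if k == j then b else 0 in
    summable_int g /\ sumZ g = b.
  move=> b0 g.
  have g0 k : 0 <= g k by rewrite /g; case: ifP.
  have Eg : \esum_(k in setT) (g k)%:E = b%:E.
    rewrite (esumID [set j])// ?setTI ?esum_set1 /g ?eqxx ?lee_fin//.
      by rewrite [X in (_ + X)%E]esum1 ?adde0// => k /= /eqP/negbTE ->.
    by move=> k _; rewrite lee_fin; exact: g0.
  split; last by rewrite sumZ_nneg// Eg.
  rewrite /summable_int/summable (eq_esum (b := fun k => (g k)%:E)) ?Eg ?ltry//.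
  by move=> k _ /=; rewrite ger0_norm.
have [a0|/ltW a0] := leP 0 a; first exact: sA.
have [] := sA (- a); rewrite ?oppr_ge0//= => s1 s2.
have E : f = (fun k => -1 * (if k == j then - a else 0)).
  by apply/funext => k; rewrite /f; case: ifP; rewrite ?mulr0// mulN1r opprK.
split; first by rewrite E; exact: summableZ.
by rewrite E sumZZ// s2 mulN1r opprK.
Qed.

(** A family on D that is dominated through an injection of D has the smaller
sum, since the finite sums of the one are bounded by finite sums of the
other. *)
Lemma summable_reindex f g (e : int -> int) (D : set int) :
  set_inj D e -> summable_int g -> (forall k, 0 <= g k) ->
  (forall k, 0 <= f k) ->
  (forall k, D k -> f k <= g (e k)) -> (forall k, ~ D k -> f k = 0) ->
  summable_int f /\ sumZ f <= sumZ g.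
Proof.
move=> einj sg g0 f0 fg fD; apply: sumZ_le_fsum => // A fA.
rewrite (fsbigID D)//= [X in _ + X]fsbig1 ?addr0; last first.
  by move=> k [_ /fD].
have fAD : finite_set (A `&` D) by apply: sub_finite_set fA => k [].
apply: (@le_trans _ _ (\sum_(k \in A `&` D) g (e k))).
  rewrite !fsbig_finite//= !big_seq; apply: ler_sum => k.
  by rewrite in_fset_set// inE => -[_ /fg].
have eI : set_inj (A `&` D) e.
  by move=> x y; rewrite !inE => -[_ Dx] [_ Dy]; apply: einj; rewrite inE.
rewrite -(@fsbig_image _ _ _ _ _ (A `&` D) e g)//.
apply: fsum_le_sumZ => //; exact: finite_image.
Qed.

Lemma sumZ_reindex f (e : int -> int) : injective e -> summable_int f ->
  (forall k, ~ range e k -> f k = 0) ->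
  summable_int (f \o e) /\ sumZ (f \o e) = sumZ f.
Proof.
move=> einj sf fe.
pose e' k := xget 0 (e @^-1` [set k]).
have ee' k : range e k -> e (e' k) = k.
  by rewrite /e'; case: xgetP => [j -> //|H] [j _ jk]; have := H j jk.
have e'e k : e' (e k) = k.
  by rewrite /e'; case: xgetP => [j _ /einj //|H]; have := H k erefl.
have H1 g : (forall k, 0 <= g k) -> summable_int g ->
    (forall k, ~ range e k -> g k = 0) ->
    summable_int (g \o e) /\ sumZ (g \o e) = sumZ g.
  move=> g0 sg ge.
  have [s1 l1] := @summable_reindex (g \o e) g e setT (in2W einj) sg g0
     (fun k => g0 _) (fun k _ => lexx _) (fun k H => False_ind _ (H I)).
  split => //; apply/eqP; rewrite eq_le l1/=.
  have := @summable_reindex g (g \o e) e' (range e).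
  case=> //.
  - move=> x y; rewrite !inE => rx ry E; by rewrite -(ee' x)// -(ee' y)// E.
  - by move=> k; exact: g0.
  - by move=> k rk /=; rewrite ee'.
have p0 k : 0 <= f^\+ k :> R by rewrite /funrpos le_max lexx orbT.
have n0 k : 0 <= f^\- k :> R by rewrite /funrneg le_max lexx orbT.
have sp := funrpos_summable sf; have sn := funrneg_summable sf.
have [|s1 e1] := H1 _ p0 sp.
  by move=> k /fe fk; rewrite /funrpos fk maxxx.
have [|s2 e2] := H1 _ n0 sn.
  by move=> k /fe fk; rewrite /funrneg fk oppr0 maxxx.
have E : f \o e = (f^\+ \o e) \- (f^\- \o e).
  apply/funext => k /=.
  exact: funr_posneg.
have n0' k : 0 <= (f^\- \o e) k by exact: n0.
have p0' k : 0 <= (f^\+ \o e) k by exact: p0.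
split; last by rewrite E sumZ_diff// e1 e2 -sumZ_posneg.
apply: (@summable_le _ ((f^\+ \o e) \+ (f^\- \o e))); last exact: summable_intD.
move=> k; rewrite E /= (le_trans (ler_normB _ _))//.
by rewrite !ger0_norm.
Qed.

End SumZ.

(** * The inner product and the norm *)

Section L2.
Variable R : realType.
Implicit Types (u v w : l2 R) (z : R[i]).

Lemma normc_ge0 z : 0 <= normc z.
Proof. by case: z => x y; exact: sqrtr_ge0. Qed.

Lemma normcC (x : R) : normc x%:C = `|x|.
Proof. by rewrite /= expr0n addr0 sqrtr_sqr. Qed.

Lemma normc_sqr z : normc z ^+ 2 = complex.Re z ^+ 2 + complex.Im z ^+ 2.
Proof. by case: z => x y; rewrite sqr_sqrtr// addr_ge0 ?sqr_ge0. Qed.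

Lemma normc_conj z : normc (conjc z) = normc z.
Proof. by case: z => x y /=; rewrite sqrrN. Qed.

Lemma normc_Re z : `|complex.Re z| <= normc z.
Proof.
by rewrite -(ler_pXn2r (_ : 0 < 2)%N) ?nnegrE ?normc_ge0// normc_sqr real_normK ?num_real// lerDl sqr_ge0.
Qed.

Lemma normc_Im z : `|complex.Im z| <= normc z.
Proof.
by rewrite -(ler_pXn2r (_ : 0 < 2)%N) ?nnegrE ?normc_ge0// normc_sqr real_normK ?num_real// lerDr sqr_ge0.
Qed.

Definition nsq u := sumZ (fun k => normc (u k) ^+ 2).

Lemma l2_summable u : summable_int (fun k => normc (u k) ^+ 2).
Proof. by have := valP u; rewrite inE. Qed.

Lemma l2_memP (f : int -> R[i]) :
  (f : int -> R[i]^o) \in @l2_pred R <-> summable_int (fun k => normc (f k) ^+ 2).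
Proof. by split; rewrite inE. Qed.

Lemma nsq_ge0 u : 0 <= nsq u.
Proof. by apply: sumZ_ge0 => k; exact: sqr_ge0. Qed.

Lemma l2normE u : l2norm u = Num.sqrt (nsq u).
Proof. by rewrite /l2norm /nsq sumZ_nneg// => k; exact: sqr_ge0. Qed.

Lemma l2norm_ge0 u : 0 <= l2norm u.
Proof. exact: sqrtr_ge0. Qed.

Lemma l2norm_sqr u : l2norm u ^+ 2 = nsq u.
Proof. by rewrite l2normE sqr_sqrtr// nsq_ge0. Qed.

Lemma l2norm_le u v M : 0 <= M -> nsq u <= M ^+ 2 * nsq v -> l2norm u <= M * l2norm v.
Proof.
move=> M0 H; rewrite -(ler_pXn2r (_ : 0 < 2)%N) ?nnegrE ?mulr_ge0 ?l2norm_ge0//.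
by rewrite exprMn !l2norm_sqr.
Qed.

Lemma l2P u v : (forall k, u k = v k) -> u = v.
Proof. by move=> H; apply/val_inj/funext. Qed.

Lemma l2D u v k : (u + v) k = u k + v k. Proof. by []. Qed.
Lemma l2N u k : (- u) k = - u k. Proof. by []. Qed.
Lemma l2B u v k : (u - v) k = u k - v k. Proof. by []. Qed.
Lemma l2Z a u k : (a *: u) k = a * u k. Proof. by []. Qed.
Lemma l2sum (I : Type) (r : seq I) (P : pred I) (F : I -> l2 R) k :
  (\sum_(i <- r | P i) F i) k = \sum_(i <- r | P i) F i k.
Proof. by elim/big_ind2: _ => // x y a b <- <-. Qed.

Lemma ketE (j k : int) : ket R j k = (k == j)%:R. Proof. by []. Qed.

(** Diagonal operators, shifts, interlacing and decimation are all weighted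
partial injections of the index set, so this one estimate proves that they map
square summable families to such and bounds their norms. *)
Lemma l2_dom (f : int -> R[i]) u (e : int -> int) (D : set int) M :
  set_inj D e -> 0 <= M ->
  (forall k, D k -> normc (f k) <= M * normc (u (e k))) ->
  (forall k, ~ D k -> f k = 0) ->
  summable_int (fun k => normc (f k) ^+ 2) /\
  sumZ (fun k => normc (f k) ^+ 2) <= M ^+ 2 * nsq u.
Proof.
move=> einj M0 fu f0; rewrite -sumZZ; last exact: l2_summable.
apply: (@summable_reindex _ _ _ e D) => //.
- exact/summableZ/l2_summable.
- by move=> k; rewrite mulr_ge0// sqr_ge0.
- by move=> k; exact: sqr_ge0.
- move=> k Dk; rewrite -exprMn lerXn2r ?nnegrE ?mulr_ge0 ?normc_ge0//; exact: fu.
- by move=> k /f0 ->; rewrite normc0 expr0n.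
Qed.

(** Total, with value 0 on families that are not square summable, so that an
operator can be defined before it is known to be bounded. *)
Definition mkl2 (f : int -> R[i]) : l2 R := insubd (0 : l2 R) (f : int -> R[i]^o).

Lemma mkl2E f : summable_int (fun k => normc (f k) ^+ 2) -> forall k, mkl2 f k = f k.
Proof. by move=> /l2_memP fl k; rewrite /mkl2 -[l2_val _]/(val _) insubdK. Qed.

(** Real part of conj z1 * z2, in coordinates: inner products then reduce to sums
of real families and polynomial identities. *)
Definition cre z1 z2 : R :=
  complex.Re z1 * complex.Re z2 + complex.Im z1 * complex.Im z2.

Definition cim z1 z2 : R :=
  complex.Re z1 * complex.Im z2 - complex.Im z1 * complex.Re z2.

Lemma cre_conj z1 z2 : complex.Re (conjc z1 * z2) = cre z1 z2.
Proof. by case: z1 z2 => a b [c d]; rewrite /cre /=; ring. Qed.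

Lemma cim_conj z1 z2 : complex.Im (conjc z1 * z2) = cim z1 z2.
Proof. by case: z1 z2 => a b [c d]; rewrite /cim /=; ring. Qed.

Lemma dotpE u v : dotp u v =
  sumZ (fun k => cre (u k) (v k)) +i* sumZ (fun k => cim (u k) (v k)).
Proof.
by congr (sumZ _ +i* sumZ _); apply/funext => k; rewrite -?cre_conj -?cim_conj.
Qed.

Lemma dot_summable u v : summable_int (fun k => cre (u k) (v k)) /\
  summable_int (fun k => cim (u k) (v k)).
Proof.
have H : summable_int (fun k => normc (u k) ^+ 2 + normc (v k) ^+ 2).
  by apply: (summable_intD (l2_summable u) (l2_summable v)).
have E k : normc (conjc (u k) * v k) <= normc (u k) ^+ 2 + normc (v k) ^+ 2.
  rewrite normcM normc_conj; set a := normc _; set b := normc _.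
  have := sqr_ge0 (a - b); have := sqr_ge0 a; have := sqr_ge0 b; nra.
split; apply: summable_le H => k; apply: le_trans (E k).
  by rewrite -cre_conj normc_Re.
by rewrite -cim_conj normc_Im.
Qed.

Lemma dotpDr u v w : dotp u (v + w) = dotp u v + dotp u w.
Proof.
have [s1 s2] := dot_summable u v; have [s3 s4] := dot_summable u w.
have Er k : cre (u k) ((v + w) k) = cre (u k) (v k) + cre (u k) (w k).
  by rewrite l2D /cre; case: (v k) (w k) => ? ? [? ?] /=; ring.
have Ei k : cim (u k) ((v + w) k) = cim (u k) (v k) + cim (u k) (w k).
  by rewrite l2D /cim; case: (v k) (w k) => ? ? [? ?] /=; ring.
rewrite !dotpE (funext Er) (funext Ei).
by apply/eqP; rewrite eq_complex /= !(sumZD s1 s3, sumZD s2 s4) !eqxx.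
Qed.

Lemma dotpC u v : dotp v u = conjc (dotp u v).
Proof.
have [s1 s2] := dot_summable u v.
rewrite !dotpE; apply/eqP; rewrite eq_complex /= -sumZN//.
by apply/andP; split; apply/eqP; congr sumZ; apply/funext => k; rewrite /cre /cim; ring.
Qed.

Lemma dotpDl u v w : dotp (u + v) w = dotp u w + dotp v w.
Proof. by rewrite dotpC dotpDr (dotpC w u) (dotpC w v) rmorphD. Qed.

Lemma dotpZr a u v : dotp u (a *: v) = a * dotp u v.
Proof.
have [s1 s2] := dot_summable u v.
case: a => a b; rewrite !dotpE.
have s c f : summable_int f -> summable_int (fun k => c * f k) := @summableZ R c f.
have Er k : cre (u k) (((a +i* b) *: v) k)
    = a * cre (u k) (v k) + (- b) * cim (u k) (v k).
  by rewrite l2Z /cre /cim; case: (v k) => ? ? /=; ring.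
have Ei k : cim (u k) (((a +i* b) *: v) k)
    = a * cim (u k) (v k) + b * cre (u k) (v k).
  by rewrite l2Z /cre /cim; case: (v k) => ? ? /=; ring.
rewrite (funext Er) (funext Ei) !(sumZD (s _ _ _) (s _ _ _))// !sumZZ//.
by rewrite /= mulNr.
Qed.

Lemma dotpZl a u v : dotp (a *: u) v = conjc a * dotp u v.
Proof. by rewrite dotpC dotpZr (dotpC v u) rmorphM. Qed.

Lemma dotpNr u v : dotp u (- v) = - dotp u v.
Proof. by rewrite -scaleN1r dotpZr mulN1r. Qed.

Lemma dotpNl u v : dotp (- u) v = - dotp u v.
Proof. by rewrite dotpC dotpNr (dotpC v u) rmorphN. Qed.

Lemma dotp0r u : dotp u 0 = 0.
Proof. by rewrite -(scale0r 0) dotpZr mul0r. Qed.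

Lemma dotp0l u : dotp 0 u = 0.
Proof. by rewrite dotpC dotp0r conjc0. Qed.

Lemma dotpBr u v w : dotp u (v - w) = dotp u v - dotp u w.
Proof. by rewrite dotpDr dotpNr. Qed.

Lemma dotpBl u v w : dotp (u - v) w = dotp u w - dotp v w.
Proof. by rewrite dotpDl dotpNl. Qed.

Lemma dotp_self u : dotp u u = (nsq u)%:C.
Proof.
rewrite dotpE; apply/eqP; rewrite eq_complex /=; apply/andP; split; apply/eqP.
  by congr sumZ; apply/funext => k; rewrite normc_sqr /cre; ring.
by rewrite -[RHS](@sumZ0 R); congr sumZ; apply/funext => k; rewrite /cim; ring.
Qed.

Lemma dotp_ket k u : dotp (ket R k) u = u k.
Proof.
rewrite dotpE; apply/eqP; rewrite eq_complex /=; apply/andP; split; apply/eqP.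
  rewrite -[RHS](sumZ_delta _ k).2; congr sumZ; apply/funext => j.
  by rewrite /cre -[(_ == _)%:R]/((j == k)%:R : R[i]); case: eqP => [->|_] /=; ring.
rewrite -[RHS](sumZ_delta _ k).2; congr sumZ; apply/funext => j.
by rewrite /cim -[(_ == _)%:R]/((j == k)%:R : R[i]); case: eqP => [->|_] /=; ring.
Qed.

Lemma dotp_ketr k u : dotp u (ket R k) = conjc (u k).
Proof. by rewrite dotpC dotp_ket. Qed.

Definition rdot u v := complex.Re (dotp u v).

Lemma rdotC u v : rdot u v = rdot v u.
Proof. by rewrite /rdot dotpC; case: (dotp _ _). Qed.

Lemma ReD z z' : complex.Re (z + z') = complex.Re z + complex.Re z'.
Proof. by case: z; case: z'. Qed.

Lemma ReN z : complex.Re (- z) = - complex.Re z.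
Proof. by case: z. Qed.

Lemma ReZ (a : R) z : complex.Re (a%:C * z) = a * complex.Re z.
Proof. by case: z => x y /=; rewrite mul0r subr0. Qed.

Lemma rdotDr u v w : rdot u (v + w) = rdot u v + rdot u w.
Proof. by rewrite /rdot dotpDr ReD. Qed.

Lemma rdotDl u v w : rdot (u + v) w = rdot u w + rdot v w.
Proof. by rewrite /rdot dotpDl ReD. Qed.

Lemma rdotZr (a : R) u v : rdot u (a%:C *: v) = a * rdot u v.
Proof. by rewrite /rdot dotpZr ReZ. Qed.

Lemma rdotZl (a : R) u v : rdot (a%:C *: u) v = a * rdot u v.
Proof. by rewrite rdotC rdotZr rdotC. Qed.

Lemma rdotNr u v : rdot u (- v) = - rdot u v.
Proof. by rewrite /rdot dotpNr ReN. Qed.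

Lemma rdotNl u v : rdot (- u) v = - rdot u v.
Proof. by rewrite /rdot dotpNl ReN. Qed.

Lemma rdot_self u : rdot u u = nsq u.
Proof. by rewrite /rdot dotp_self. Qed.

Lemma nsqD u v : nsq (u + v) = nsq u + 2 * rdot u v + nsq v.
Proof.
by rewrite -!rdot_self rdotDl !rdotDr (rdotC v u); ring.
Qed.

Lemma nsqZ a u : nsq (a *: u) = normc a ^+ 2 * nsq u.
Proof.
rewrite /nsq -sumZZ; last exact: l2_summable.
by congr sumZ; apply/funext => k; rewrite l2Z normcM exprMn.
Qed.

Lemma l2normZ a u : l2norm (a *: u) = normc a * l2norm u.
Proof.
by rewrite !l2normE nsqZ sqrtrM ?sqr_ge0// sqrtr_sqr ger0_norm// normc_ge0.
Qed.

Lemma rdot_sqr_le u v : rdot u v ^+ 2 <= nsq u * nsq v.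
Proof.
apply: discriminant_le => [|t]; first exact: nsq_ge0.
have := nsq_ge0 (u + t%:C *: v).
rewrite nsqD nsqZ normcC real_normK ?num_real// rdotZr.
by rewrite mulrA.
Qed.

Lemma rdot_le u v : rdot u v <= l2norm u * l2norm v.
Proof.
apply: le_trans (ler_norm _) _.
rewrite -(ler_pXn2r (_ : 0 < 2)%N) ?nnegrE ?mulr_ge0 ?l2norm_ge0//.
by rewrite exprMn !l2norm_sqr real_normK ?num_real// rdot_sqr_le.
Qed.

Lemma l2normD u v : l2norm (u + v) <= l2norm u + l2norm v.
Proof.
rewrite -(ler_pXn2r (_ : 0 < 2)%N) ?nnegrE ?addr_ge0 ?l2norm_ge0//.
rewrite l2norm_sqr nsqD -!l2norm_sqr; have := rdot_le u v; nra.
Qed.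

Lemma l2norm0 : l2norm (0 : l2 R) = 0.
Proof. by rewrite -(scale0r 0) l2normZ normc0 mul0r. Qed.

Lemma normc_le_l2norm u k : normc (u k) <= l2norm u.
Proof.
rewrite -(ler_pXn2r (_ : 0 < 2)%N) ?nnegrE ?normc_ge0 ?l2norm_ge0// l2norm_sqr.
rewrite -[leLHS](sumZ_delta _ k).2; apply: sumZ_le.
- exact: (sumZ_delta _ k).1.
- exact: l2_summable.
- by move=> j; case: eqP => [->//|_]; exact: sqr_ge0.
Qed.

Lemma nsq_ket k : nsq (ket R k) = 1.
Proof. by rewrite -rdot_self /rdot dotp_ket ketE eqxx. Qed.

Lemma l2norm_ket k : l2norm (ket R k) = 1.
Proof. by rewrite l2normE nsq_ket sqrtr1. Qed.

Lemma l2norm_eq0 u : l2norm u = 0 -> u = 0.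
Proof.
move=> u0; apply: l2P => k; apply: eq0_normc; apply/eqP.
by rewrite eq_le normc_ge0 -u0 normc_le_l2norm.
Qed.

Lemma dotp_le u v : normc (dotp u v) <= l2norm u * l2norm v.
Proof.
set z := dotp u v.
have [z0|z0] := eqVneq (normc z) 0; first by rewrite z0 mulr_ge0// l2norm_ge0.
have zp : 0 < normc z by rewrite lt_def z0 normc_ge0.
have := rdot_le u (conjc z *: v).
rewrite /rdot dotpZr -/z l2normZ normc_conj.
have -> : complex.Re (conjc z * z) = normc z ^+ 2.
  by rewrite normc_sqr; case: (z) => a b /=; ring.
by rewrite expr2 mulrCA ler_pM2l.
Qed.

End L2.

(** * Bounded, diagonal and tridiagonal operators *)

Section BoundedOperators.
Variable R : realType.
Implicit Types (A B C : l2 R -> l2 R) (u v w : l2 R) (z : R[i]).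

Lemma linD A : linear A -> forall u v, A (u + v) = A u + A v.
Proof. by move=> lA u v; have := lA 1 u v; rewrite !scale1r. Qed.

Lemma lin0 A : linear A -> A 0 = 0.
Proof. by move=> lA; have := linD lA 0 0; rewrite addr0 => /eqP; rewrite -subr_eq subrr eq_sym => /eqP. Qed.

Lemma linZ A : linear A -> forall z u, A (z *: u) = z *: A u.
Proof. by move=> lA z u; rewrite -[z *: u]addr0 lA (lin0 lA) addr0. Qed.

Lemma linN A : linear A -> forall u, A (- u) = - A u.
Proof. by move=> lA u; rewrite -scaleN1r linZ// scaleN1r. Qed.

Lemma linB A : linear A -> forall u v, A (u - v) = A u - A v.
Proof. by move=> lA u v; rewrite linD// linN. Qed.

Lemma lin_sum A (I : Type) (r : seq I) (P : pred I) (F : I -> l2 R) : linear A ->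
  A (\sum_(i <- r | P i) F i) = \sum_(i <- r | P i) A (F i).
Proof.
move=> lA; elim/big_rec2: _ => [|i u v _ <-]; first exact: lin0.
by rewrite linD.
Qed.

Lemma bounded_opP A : bounded_op A ->
  linear A /\ exists M, 0 <= M /\ forall u, l2norm (A u) <= M * l2norm u.
Proof.
case=> lA [M AM]; split => //; exists `|M|; split => // u.
by rewrite (le_trans (AM u))// ler_wpM2r ?l2norm_ge0// ler_norm.
Qed.

Lemma bounded_id : bounded_op (fun u => u).
Proof. by split => // ; exists 1 => u; rewrite mul1r. Qed.

Lemma bounded0 : bounded_op (fun _ : l2 R => 0).
Proof.
split => [z u v|]; first by rewrite scaler0 addr0.
by exists 0 => u; rewrite l2norm0 mul0r.
Qed.

Lemma boundedD A B : bounded_op A -> bounded_op B -> bounded_op (fun u => A u + B u).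
Proof.
move=> [lA [M AM]] [lB [N BN]]; split => [z u v|].
  by rewrite lA lB scalerDr addrACA.
by exists (M + N) => u; rewrite (le_trans (l2normD _ _))// mulrDl lerD.
Qed.

Lemma bounded_comp A B : bounded_op A -> bounded_op B -> bounded_op (fun u => A (B u)).
Proof.
move=> /bounded_opP[lA [M [M0 AM]]] [lB [N BN]]; split => [z u v|].
  by rewrite lB lA.
by exists (M * N) => u; rewrite (le_trans (AM _))// -mulrA ler_wpM2l.
Qed.

Lemma boundedZ z A : bounded_op A -> bounded_op (fun u => z *: A u).
Proof.
move=> [lA [M AM]]; split => [y u v|].
  by rewrite lA scalerDr !scalerA mulrC.
by exists (normc z * M) => u; rewrite l2normZ -mulrA ler_wpM2l// normc_ge0.
Qed.

Lemma boundedN A : bounded_op A -> bounded_op (fun u => - A u).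
Proof.
move=> bA; have := boundedZ (-1) bA.
by under eq_fun do rewrite scaleN1r.
Qed.

Lemma boundedB A B : bounded_op A -> bounded_op B -> bounded_op (fun u => A u - B u).
Proof. by move=> bA bB; apply: boundedD => //; exact: boundedN. Qed.

Lemma bounded_sum (I : Type) (r : seq I) (P : pred I) (F : I -> l2 R -> l2 R) :
  (forall i, bounded_op (F i)) -> bounded_op (fun u => \sum_(i <- r | P i) F i u).
Proof.
move=> bF; elim: r => [|i r IHr].
  by under eq_fun do rewrite big_nil; exact: bounded0.
under eq_fun do rewrite big_cons.
by case: (P i) => //; exact: boundedD.
Qed.

Lemma bounded_scal_sub z A : bounded_op A -> bounded_op (scal_sub z A).
Proof. by move=> bA; apply: boundedB => //; apply: boundedZ; exact: bounded_id. Qed.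

Lemma adjointE A B : bounded_op B -> is_adjoint A B -> adjoint A = B.
Proof.
move=> bB aB; apply: xget_unique => // C [bC aC].
apply/funext => u; apply: l2P => k; rewrite -!dotp_ket.
by have := aB (ket R k) u; rewrite (aC (ket R k) u).
Qed.

Lemma is_adjointD A A' B B' : is_adjoint A B -> is_adjoint A' B' ->
  is_adjoint (fun u => A u + A' u) (fun u => B u + B' u).
Proof. by move=> h h' u v; rewrite dotpDl dotpDr h h'. Qed.

Lemma is_adjoint_comp A A' B B' : is_adjoint A B -> is_adjoint A' B' ->
  is_adjoint (fun u => A (A' u)) (fun u => B' (B u)).
Proof. by move=> h h' u v; rewrite h h'. Qed.

Lemma is_inverse_uniq A B C : is_inverse A B -> is_inverse A C -> B = C.
Proof.
move=> [_ AB BA] [_ AC CA]; apply/funext => u.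
by rewrite -[in LHS](CA u) AB.
Qed.

Lemma resolventE z A B : is_inverse (scal_sub z A) B -> resolvent z A = B.
Proof.
by move=> h; apply: xget_unique => // C hC; exact: is_inverse_uniq hC h.
Qed.

Lemma resolventP z A : ~ spectrum A z -> is_inverse (scal_sub z A) (resolvent z A).
Proof.
move=> /contrapT[B hB]; by rewrite (resolventE hB).
Qed.

Lemma opnorm_le A M : 0 <= M -> (forall u, l2norm (A u) <= M * l2norm u) -> opnorm A <= M.
Proof.
move=> M0 AM; apply: ge_sup.
  by exists (l2norm (A 0)), 0 => //=; rewrite l2norm0.
move=> _ [u /= u1 <-]; rewrite (le_trans (AM u))//.
by rewrite -[leRHS]mulr1 ler_wpM2l.
Qed.

Lemma le_opnorm A u : bounded_op A -> l2norm u <= 1 -> l2norm (A u) <= opnorm A.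
Proof.
move=> /bounded_opP[lA [M [M0 AM]]] u1; apply: ub_le_sup; last by exists u.
exists M => _ [v /= v1 <-]; rewrite (le_trans (AM v))//.
by rewrite -[leRHS]mulr1 ler_wpM2l.
Qed.

Lemma normc_le_opnorm A j k : bounded_op A -> normc (A (ket R k) j) <= opnorm A.
Proof.
move=> bA; rewrite (le_trans (normc_le_l2norm _ _))// le_opnorm// l2norm_ket//.
Qed.

Definition diag (a : int -> R) u := mkl2 (fun k => (a k)%:C * u k).
Definition shift (m : int) u := mkl2 (fun k => u (k + m)).
(** The adjoint of [interlace]. *)
Definition decimate (d eps : nat) u := mkl2 (fun k : int => u (eps%:Z + d%:Z * k)).

Definition bounded_seq (a : int -> R) := exists M, forall k, `|a k| <= M.

Lemma nsq_eq v (f : int -> R[i]) : (forall k, v k = f k) ->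
  nsq v = sumZ (fun k => normc (f k) ^+ 2).
Proof. by move=> vf; congr sumZ; apply/funext => k; rewrite vf. Qed.

Lemma diag_dom (a : int -> R) (M : R) u : 0 <= M -> (forall k, `|a k| <= M) ->
  summable_int (fun k => normc ((a k)%:C * u k) ^+ 2) /\
  sumZ (fun k => normc ((a k)%:C * u k) ^+ 2) <= M ^+ 2 * nsq u.
Proof.
move=> M0 aM; apply: (@l2_dom _ _ u id setT) => //; last by move=> k H; case: H.
by move=> k _; rewrite normcM normcC ler_wpM2r ?normc_ge0.
Qed.

Lemma diagE a u k : bounded_seq a -> diag a u k = (a k)%:C * u k.
Proof.
move=> [M aM]; rewrite mkl2E//.
apply: (diag_dom u (_ : 0 <= M) aM).1.
exact: le_trans (normr_ge0 _) (aM 0).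
Qed.

Lemma diag_le (a : int -> R) (M : R) u : 0 <= M -> (forall k, `|a k| <= M) -> l2norm (diag a u) <= M * l2norm u.
Proof.
move=> M0 aM; apply: l2norm_le => //; rewrite (nsq_eq (fun k => diagE u k _)); last by exists M.
exact: (diag_dom u M0 aM).2.
Qed.

Lemma bounded_diag a : bounded_seq a -> bounded_op (diag a).
Proof.
move=> ba; split => [z u v|].
  by apply: l2P => k; rewrite !(l2D, l2Z, diagE)//; ring.
case: ba => M aM; exists M => u; apply: diag_le => //.
exact: le_trans (normr_ge0 _) (aM 0).
Qed.

Lemma diag_adjoint a : bounded_seq a -> is_adjoint (diag a) (diag a).
Proof.
move=> ba u v; rewrite !dotpE; congr (sumZ _ +i* sumZ _); apply/funext => k;
  rewrite !diagE// /cre /cim; case: (u k) (v k) => ? ? [? ?] /=; ring.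
Qed.

Lemma shift_dom m u : summable_int (fun k => normc (u (k + m)) ^+ 2) /\
  sumZ (fun k => normc (u (k + m)) ^+ 2) <= 1 ^+ 2 * nsq u.
Proof.
apply: (@l2_dom _ _ u (fun k => k + m) setT) => //; last by move=> k H; case: H.
  by move=> k l _ _ /addIr.
by move=> k _; rewrite mul1r.
Qed.

Lemma shiftE m u k : shift m u k = u (k + m).
Proof. by rewrite mkl2E//; exact: (shift_dom m u).1. Qed.

Lemma shift_le m u : l2norm (shift m u) <= l2norm u.
Proof.
rewrite -[leRHS]mul1r; apply: l2norm_le => //; rewrite (nsq_eq (fun k => shiftE m u k)).
exact: (shift_dom m u).2.
Qed.

Lemma bounded_shift m : bounded_op (shift m).
Proof.
split => [z u v|]; last by exists 1 => u; rewrite mul1r shift_le.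
by apply: l2P => k; rewrite !(l2D, l2Z, shiftE).
Qed.

Lemma shift_adjoint m : is_adjoint (shift m) (shift (- m)).
Proof.
have H (c : R[i] -> R[i] -> R) u v : summable_int (fun k => c (shift m u k) (v k)) ->
    sumZ (fun k => c (shift m u k) (v k)) = sumZ (fun k => c (u k) (shift (- m) v k)).
  move=> s; have [|k H|_ <-] := @sumZ_reindex _ _ (fun k => k - m) _ s.
  - exact: addIr.
  - by exfalso; apply: H; exists (k + m) => //; rewrite addrK.
  - by congr sumZ; apply/funext => k /=; rewrite !shiftE subrK.
move=> u v; have [s1 s2] := dot_summable (shift m u) v.
by rewrite !dotpE !H.
Qed.

Lemma decimate_dom d eps u : (0 < d)%N ->
  summable_int (fun k : int => normc (u (eps%:Z + d%:Z * k)) ^+ 2) /\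
  sumZ (fun k : int => normc (u (eps%:Z + d%:Z * k)) ^+ 2) <= 1 ^+ 2 * nsq u.
Proof.
move=> d0; apply: (@l2_dom _ _ u (fun k => eps%:Z + d%:Z * k) setT) => //; last by move=> k H; case: H.
  by move=> k l _ _ /addrI/mulfI; apply; rewrite eqz_nat -lt0n.
by move=> k _; rewrite mul1r.
Qed.

Lemma decimateE d eps u k : (0 < d)%N -> decimate d eps u k = u (eps%:Z + d%:Z * k).
Proof. by move=> d0; rewrite mkl2E//; exact: (decimate_dom eps u d0).1. Qed.

Lemma bounded_decimate d eps : (0 < d)%N -> bounded_op (decimate d eps).
Proof.
move=> d0; split => [z u v|].
  by apply: l2P => k; rewrite !(l2D, l2Z, decimateE).
exists 1 => u; apply: l2norm_le => //; rewrite (nsq_eq (fun k => decimateE eps u k d0)).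
exact: (decimate_dom eps u d0).2.
Qed.

Lemma interlaceE d eps u (j : int) : interlace d eps u j =
  if (d %| j - eps%:Z)%Z then u ((j - eps%:Z) %/ d)%Z else 0.
Proof. by []. Qed.

Lemma interlace_at d eps u k : (0 < d)%N -> interlace d eps u (eps%:Z + d%:Z * k) = u k.
Proof.
move=> d0; rewrite interlaceE addrAC subrr add0r dvdz_mulr// mulKz//.
by rewrite eqz_nat -lt0n.
Qed.

Lemma bounded_interlace d eps : (0 < d)%N -> bounded_op (interlace (R := R) d eps).
Proof.
move=> d0; split => [z u v|].
  apply: l2P => k; rewrite !(l2D, l2Z, interlaceE); case: ifP => //= _.
  by rewrite mulr0 addr0.
exists 1 => u; apply: l2norm_le => //.
apply: (@l2_dom _ _ u (fun k => (k - eps%:Z) %/ d)%Z [set k | (d %| k - eps%:Z)%Z] 1 _ _ _ _).2 => //.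
- move=> i j; rewrite !inE /= => di dj eij.
  by apply: (addIr (- eps%:Z)); rewrite -(divzK di) -(divzK dj) eij.
- by move=> k /= dk; rewrite mul1r /= dk.
- by move=> k /= /negP/negbTE ->.
Qed.

Lemma interlace_adjoint d eps : (0 < d)%N ->
  is_adjoint (interlace (R := R) d eps) (decimate d eps).
Proof.
move=> d0.
have H (c : R[i] -> R[i] -> R) u v : (forall z, c 0 z = 0) ->
    summable_int (fun k => c (interlace d eps u k) (v k)) ->
    sumZ (fun k => c (interlace d eps u k) (v k)) =
    sumZ (fun k => c (u k) (decimate d eps v k)).
  move=> c0 s; have [|k H|_ <-] := @sumZ_reindex _ _ (fun k => eps%:Z + d%:Z * k) _ s.
  - by move=> k l /addrI/mulfI; apply; rewrite eqz_nat -lt0n.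
  - rewrite interlaceE; case: ifP => // dk; exfalso; apply: H.
    by exists ((k - eps%:Z) %/ d)%Z => //; rewrite mulrC divzK// addrC subrK.
  - congr sumZ; apply/funext => k; rewrite decimateE//.
    by rewrite -[LHS]/(c (interlace d eps u (eps%:Z + d%:Z * k)) _) interlace_at.
move=> u v; have [s1 s2] := dot_summable (interlace d eps u) v.
by rewrite !dotpE !H// => z; rewrite /cre /cim /= !mul0r ?addr0 ?subr0.
Qed.

Lemma adjoint_interlace d eps : (0 < d)%N ->
  adjoint (interlace (R := R) d eps) = decimate d eps.
Proof.
by move=> d0; apply: adjointE; [exact: bounded_decimate|exact: interlace_adjoint].
Qed.

(** Written as a sum of weighted shifts, so that boundedness, adjoint and norm
are inherited from the summands. *)
Definition tridiag (p q : int -> R) u :=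
  diag p (shift (-1) u) + diag q u + shift 1 (diag p u).

Lemma tridiagE p q u k : bounded_seq p -> bounded_seq q ->
  tridiag p q u k = (p k)%:C * u (k - 1) + (q k)%:C * u k + (p (k + 1))%:C * u (k + 1).
Proof. by move=> bp bq; rewrite !l2D !(diagE, shiftE). Qed.

Lemma bounded_tridiag p q : bounded_seq p -> bounded_seq q -> bounded_op (tridiag p q).
Proof.
move=> bp bq; apply: boundedD; first apply: boundedD.
- by apply: bounded_comp; [exact: bounded_diag|exact: bounded_shift].
- exact: bounded_diag.
- by apply: bounded_comp; [exact: bounded_shift|exact: bounded_diag].
Qed.

Lemma tridiag_adjoint p q : bounded_seq p -> bounded_seq q ->
  is_adjoint (tridiag p q) (tridiag p q).
Proof.
move=> bp bq u v; rewrite !(dotpDl, dotpDr).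
rewrite (diag_adjoint bp) (shift_adjoint (-1)) opprK (diag_adjoint bq).
by rewrite (shift_adjoint 1) (diag_adjoint bp); ring.
Qed.

Lemma tridiag_le (p q : int -> R) (P Q : R) u : 0 <= P -> 0 <= Q ->
  (forall k, `|p k| <= P) -> (forall k, `|q k| <= Q) ->
  l2norm (tridiag p q u) <= (Q + 2 * P) * l2norm u.
Proof.
move=> P0 Q0 pP qQ.
have h1 := diag_le (shift (-1) u) P0 pP; have h2 := diag_le u Q0 qQ.
have h3 := shift_le 1 (diag p u); have h4 := diag_le u P0 pP.
have h5 := ler_wpM2l P0 (shift_le (-1) u).
have h6 := l2normD (diag p (shift (-1) u) + diag q u) (shift 1 (diag p u)).
have h7 := l2normD (diag p (shift (-1) u)) (diag q u).
rewrite /tridiag mulrDl; lra.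
Qed.

Lemma jacobi_tridiag (p q : int -> R) : bounded_seq p -> bounded_seq q -> (forall k, 0 <= p k) ->
  jacobi (tridiag p q).
Proof.
move=> bp bq p0; split; [exact: bounded_tridiag|exact: tridiag_adjoint|].
exists p, q => k; split => //; apply: l2P => j.
rewrite tridiagE// !(l2D, l2Z, ketE).
have [->|j1] := eqVneq j k.
  have -> : (k - 1 == k) = false by lia.
  have -> : (k + 1 == k) = false by lia.
  have -> : (k == k - 1) = false by lia.
  by have -> : (k == k + 1) = false by lia.
have [->|j2] := eqVneq j (k - 1).
  have -> : (k - 1 - 1 == k) = false by lia.
  have -> : (k - 1 + 1 == k) = true by lia.
  have -> : (k - 1 == k + 1) = false by lia.
  by rewrite subrK ?eqxx /=; ring.
have [->|j3] := eqVneq j (k + 1).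
  have -> : (k + 1 - 1 == k) = true by lia.
  have -> : (k + 1 + 1 == k) = false by lia.
  by rewrite ?eqxx /=; ring.
have -> : (j - 1 == k) = false by lia.
have -> : (j + 1 == k) = false by lia.
by rewrite /=; ring.
Qed.

Definition offd A (k : int) : R := complex.Re (A (ket R k) (k - 1)).
Definition diagonal A (k : int) : R := complex.Re (A (ket R k) k).

Lemma jacobi_ket A k : jacobi A -> 0 <= offd A k /\
  A (ket R k) = (offd A k)%:C *: ket R (k - 1) + (diagonal A k)%:C *: ket R k
                   + (offd A (k + 1))%:C *: ket R (k + 1).
Proof.
move=> [_ _ [p [q H]]].
have Ep j : offd A j = p j.
  rewrite /offd (H j).2 !(l2D, l2Z, ketE) eqxx.
  have -> : (j - 1 == j) = false by lia.
  have -> : (j - 1 == j + 1) = false by lia.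
  by rewrite !mulr0 !addr0 mulr1.
have Eq j : diagonal A j = q j.
  rewrite /diagonal (H j).2 !(l2D, l2Z, ketE) eqxx.
  have -> : (j == j - 1) = false by lia.
  have -> : (j == j + 1) = false by lia.
  by rewrite !mulr0 addr0 add0r mulr1.
by rewrite !Ep Eq; exact: H.
Qed.

(** Self-adjointness gives (A u) k as the inner product of A |k> with u, which
turns the action on basis vectors into the action on all vectors. *)
Lemma jacobiE A u k : jacobi A -> A u k =
  (offd A k)%:C * u (k - 1) + (diagonal A k)%:C * u k + (offd A (k + 1))%:C * u (k + 1).
Proof.
move=> jA; have [_ sA _] := jA.
rewrite -dotp_ket -sA (jacobi_ket k jA).2 !dotpDl !dotpZl !dotp_ket.
by rewrite !conjc_real.
Qed.

End BoundedOperators.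

(** * Numerical range of a self-adjoint operator *)

Section NumericalRange.
Variable R : realType.
Implicit Types (A B C : l2 R -> l2 R) (u v w : l2 R) (z : R[i]).

Lemma psd_cauchy C u v : linear C -> is_adjoint C C ->
  (forall w, 0 <= rdot (C w) w) ->
  rdot (C u) v ^+ 2 <= rdot (C u) u * rdot (C v) v.
Proof.
move=> lC sC C0; apply: discriminant_le => // t.
have := C0 (u + t%:C *: v).
rewrite linD// linZ// !(rdotDl, rdotDr, rdotZl, rdotZr).
have -> : rdot (C v) u = rdot (C u) v by rewrite /rdot sC -/(rdot _ _) rdotC.
move=> H; have -> : rdot (C u) u + 2 * t * rdot (C u) v + t ^+ 2 * rdot (C v) v =
   rdot (C u) u + t * rdot (C u) v + t * (rdot (C u) v + t * rdot (C v) v) by ring.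
by rewrite -addrA -mulrDr addrA in H *; lra.
Qed.

(** Cauchy-Schwarz for the form of C, applied to u and C u. *)
Lemma psd_image_le C K u : linear C -> is_adjoint C C ->
  (forall w, 0 <= rdot (C w) w) -> (forall w, l2norm (C w) <= K * l2norm w) ->
  nsq (C u) <= K * rdot (C u) u.
Proof.
move=> lC sC C0 CK.
have h := psd_cauchy u (C u) lC sC C0.
have hK : rdot (C (C u)) (C u) <= K * nsq (C u).
  rewrite (le_trans (rdot_le _ _))// -l2norm_sqr expr2 mulrA.
  by rewrite ler_wpM2r ?l2norm_ge0.
rewrite rdot_self in h.
have [n0|n0] := eqVneq (nsq (C u)) 0.
  rewrite n0.
  have c0 : C u = 0.
    by apply: l2norm_eq0; rewrite l2normE n0 sqrtr0.
  by rewrite c0 /rdot dotp0l mulr0.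
have np : 0 < nsq (C u) by rewrite lt_def n0 nsq_ge0.
rewrite -(ler_pM2r np) -expr2 (le_trans h)// mulrAC [leRHS]mulrC ler_wpM2l//.
Qed.

(** Let m be the supremum of s <A u, u> over unit vectors, and suppose m > 1.
Then s m is a regular point, and C = s (s m - A) = m - s A is nonnegative with
|u|^2 <= const |C u|^2 <= const <C u, u> by [psd_image_le]; so m is not the
supremum. *)
Lemma numerical_range A (s : R) : bounded_op A -> is_adjoint A A ->
  spectrum A `<=` segment (R := R) -> `|s| = 1 ->
  forall u, s * rdot (A u) u <= nsq u.
Proof.
move=> bA sA specA s1.
have [lA [M [M0 AM]]] := bounded_opP bA.
pose S := [set s * rdot (A u) u | u in [set u | nsq u = 1]].
have S0 : S !=set0 by exists (s * rdot (A (ket R 0)) (ket R 0)), (ket R 0) => //=; rewrite nsq_ket.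
have bnd u : s * rdot (A u) u <= M * nsq u.
  have -> : s * rdot (A u) u = rdot (A (s%:C *: u)) u by rewrite linZ// rdotZl.
  rewrite (le_trans (rdot_le _ _))// -l2norm_sqr expr2 mulrA ler_wpM2r ?l2norm_ge0//.
  by rewrite (le_trans (AM _))// l2normZ normcC s1 mul1r.
have hS : has_sup S.
  by split => //; exists M => _ [u /= u1 <-]; rewrite (le_trans (bnd u))// u1 mulr1.
pose m := sup S.
have H u : s * rdot (A u) u <= m * nsq u.
  have [u0|u0] := eqVneq (l2norm u) 0.
    by rewrite (l2norm_eq0 u0) /rdot dotp0r mulr0 -l2norm_sqr l2norm0 expr0n mulr0.
  have up : 0 < l2norm u by rewrite lt_def u0 l2norm_ge0.
  have : s * rdot (A ((l2norm u)^-1%:C *: u)) ((l2norm u)^-1%:C *: u) <= m.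
    apply: ub_le_sup; first exact: hS.2.
    exists ((l2norm u)^-1%:C *: u) => //=.
    rewrite nsqZ normcC ger0_norm ?invr_ge0 ?l2norm_ge0// -l2norm_sqr.
    by rewrite -exprMn mulVf// expr1n.
  rewrite linZ// rdotZl rdotZr -l2norm_sqr => h.
  have -> : s * rdot (A u) u = s * ((l2norm u)^-1 * ((l2norm u)^-1 * rdot (A u) u)) * l2norm u ^+ 2.
    by field.
  by rewrite ler_wpM2r// sqr_ge0.
suff m1 : m <= 1.
  by move=> u; rewrite (le_trans (H u))// -[leRHS]mul1r ler_wpM2r// nsq_ge0.
rewrite leNgt; apply/negP => m1.
have [B [bB BK _]] : exists B, is_inverse (scal_sub (s * m)%:C A) B.
  apply: contrapT => h; have [x /= x1 /complexI xE] := specA (s * m)%:C h.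
  have : `|x| <= 1 by rewrite ler_norml.
  by rewrite xE normrM s1 mul1r ger0_norm; lra.
have [lB [N [N0 BN]]] := bounded_opP bB.
pose C u := s%:C *: scal_sub (s * m)%:C A u.
have bC : bounded_op C by apply: boundedZ; exact: bounded_scal_sub.
have [lC [K [K0 CK]]] := bounded_opP bC.
have sC : is_adjoint C C.
  by move=> u v; rewrite !(dotpZl, dotpZr, dotpBl, dotpBr) !conjc_real sA.
have ss : s * s = 1 by rewrite -expr2 -real_normK ?num_real// s1 expr1n.
have CE u : rdot (C u) u = m * nsq u - s * rdot (A u) u.
  rewrite rdotZl rdotDl rdotNl rdotZl rdot_self mulrBr; congr (_ - _).
  by rewrite !mulrA ss mul1r.
have C0 u : 0 <= rdot (C u) u by rewrite CE subr_ge0.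
have E u : nsq u <= N ^+ 2 * K * rdot (C u) u.
  rewrite -[u in leLHS](BK u).
  have h1 : nsq (B (scal_sub (s * m)%:C A u)) <= N ^+ 2 * nsq (C u).
    rewrite nsqZ normcC s1 expr1n mul1r -!l2norm_sqr -exprMn lerXn2r ?nnegrE ?mulr_ge0 ?l2norm_ge0//.
  apply: le_trans h1 _; rewrite -mulrA ler_wpM2l ?sqr_ge0//.
  exact: psd_image_le.
pose L := N ^+ 2 * K.
have L0 : 0 < L.
  have := E (ket R 0); rewrite nsq_ket -/L => h.
  have LL : 0 <= L by rewrite mulr_ge0 ?sqr_ge0.
  rewrite lt_def LL andbT; apply/eqP => L0; move: h; rewrite L0 mul0r; lra.
have : m <= m - L^-1.
  apply: ge_sup => // _ [u /= u1 <-].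
  have := E u; rewrite -/L CE u1 mulr1 => h.
  have : L^-1 <= m - s * rdot (A u) u by rewrite -[L^-1]mulr1 ler_pdivrMl.
  lra.
have : 0 < L^-1 by rewrite invr_gt0.
lra.
Qed.

End NumericalRange.

(** * Continued fractions for the pivots *)

Section ContinuedFraction.
Variable R : realType.
Implicit Types (a b : int -> R) (k : int) (n : nat).

(** The pivot at k when the matrix with diagonal a and off-diagonal entries b is
eliminated from site k - n rightwards. *)
Fixpoint cfrac a b n k : R :=
  if n is m.+1 then a k - b k ^+ 2 / cfrac a b m (k - 1) else a k.

(** The limit of the pivots as n grows.  It is an infimum, because each pivot is
the minimum of a quadratic form over vectors on [k - n, k] with last entry 1,
and so decreases with n. *)
Definition cflim a b k : R := inf [set cfrac a b n k | n in setT].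

Section Limit.
Variables (a b : int -> R) (delta : R).
Hypothesis delta_gt0 : 0 < delta.
Hypothesis cfrac_ge_delta : forall n k, delta <= cfrac a b n k.

Lemma cfrac_gt0 n k : 0 < cfrac a b n k.
Proof. exact: lt_le_trans (cfrac_ge_delta n k). Qed.

Let inf_ok k : has_inf [set cfrac a b n k | n in setT].
Proof.
split; first by exists (cfrac a b 0 k), 0%N.
by exists delta => _ [n _ <-]; exact: cfrac_ge_delta.
Qed.

Lemma cflim_le n k : cflim a b k <= cfrac a b n k.
Proof. by apply: ge_inf; [exact: (inf_ok k).2|exists n]. Qed.

Lemma le_cflim k (M : R) : (forall n, M <= cfrac a b n k) -> M <= cflim a b k.
Proof.
move=> H; apply: lb_le_inf; first exact: (inf_ok k).1.
by move=> _ [n _ <-].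
Qed.

Lemma cflim_ge k : delta <= cflim a b k.
Proof. exact: le_cflim. Qed.

Lemma cflim_gt0 k : 0 < cflim a b k.
Proof. exact: lt_le_trans (cflim_ge k). Qed.

Lemma cflim_approx k (e : R) : 0 < e -> exists n, cfrac a b n k <= cflim a b k + e.
Proof.
move=> e0; apply: contrapT => H.
have : cflim a b k + e <= cflim a b k.
  apply: le_cflim => n; rewrite leNgt; apply/negP => h; apply: H.
  by exists n; exact: ltW.
lra.
Qed.

Lemma cflimE k : cflim a b k = a k - b k ^+ 2 / cflim a b (k - 1).
Proof.
have x0 := cflim_gt0 (k - 1).
apply/eqP; rewrite eq_le; apply/andP; split; last first.
  apply: le_cflim => -[|n] /=.
    by rewrite lerBlDr lerDl divr_ge0 ?sqr_ge0// ltW.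
  rewrite lerD2l lerN2 ler_wpM2l ?sqr_ge0// lef_pV2 ?posrE ?cfrac_gt0//.
  exact: cflim_le.
rewrite lerBrDr addrC -lerBrDr ler_pdivrMr//.
set c := a k - _.
have c0 : 0 <= c by rewrite subr_ge0; exact: (cflim_le 0).
have H n : b k ^+ 2 <= c * cfrac a b n (k - 1).
  rewrite -ler_pdivrMr ?cfrac_gt0//.
  by have := cflim_le n.+1 k; rewrite /= /c; lra.
have [c00|cn0] := eqVneq c 0.
  by have := H 0%N; rewrite c00 !mul0r.
have cp : 0 < c by rewrite lt_def cn0.
rewrite mulrC -ler_pdivrMr//; apply: le_cflim => n.
by rewrite ler_pdivrMr// mulrC.
Qed.

End Limit.

(** One step of the recursion turns an error e into at most
del + 2/9 del + e/81, and 5/4 del reproduces itself under this map. *)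
Lemma cfrac_stable a b a' b' (del : R) :
  0 <= del ->
  (forall n k, 9 <= cfrac a b n k) -> (forall n k, 9 <= cfrac a' b' n k) ->
  (forall k, 0 <= b k <= 1) -> (forall k, 0 <= b' k <= 1) ->
  (forall k, `|a k - a' k| <= del) -> (forall k, `|b k - b' k| <= del) ->
  forall n k, `|cfrac a b n k - cfrac a' b' n k| <= 5 / 4 * del.
Proof.
move=> d0 c9 c9' b1 b1' da db; elim=> [|n IHn] k /=.
  by have := da k; lra.
have := IHn (k - 1); have := c9 n (k - 1); have := c9' n (k - 1).
move: (cfrac a b n _) (cfrac a' b' n _) => x y y9 x9 xy.
have x0 : 0 < x by lra.
have y0 : 0 < y by lra.
pose u := x^-1; pose v := y^-1.
have ux : u * x = 1 by rewrite mulVf// gt_eqF.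
have vy : v * y = 1 by rewrite mulVf// gt_eqF.
have u0 : 0 <= u by rewrite invr_ge0 ltW.
have v0 : 0 <= v by rewrite invr_ge0 ltW.
have u9 : u <= 1 / 9 by nra.
have v9 : v <= 1 / 9 by nra.
have uv : `|u - v| <= 5 / 4 * del / 81.
  have -> : u - v = u * v * (y - x).
    by rewrite /u /v; field; rewrite !gt_eqF.
  rewrite normrM ger0_norm ?mulr_ge0// distrC.
  have : u * v <= 1 / 81 by nra.
  have := mulr_ge0 u0 v0; have := normr_ge0 (x - y); nra.
rewrite -/u -/v.
have -> : a k - b k ^+ 2 * u - (a' k - b' k ^+ 2 * v) =
  (a k - a' k) - ((b k - b' k) * ((b k + b' k) * u) + b' k ^+ 2 * (u - v)) by ring.
have /andP[b0 bl] := b1 k; have /andP[b0' bl'] := b1' k.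
rewrite (le_trans (ler_normB _ _))//.
have h1 : `|(b k - b' k) * ((b k + b' k) * u)| <= del * (2 / 9).
  rewrite normrM ler_pM// ger0_norm; last by rewrite mulr_ge0// addr_ge0.
  by nra.
have h2 : `|b' k ^+ 2 * (u - v)| <= 5 / 4 * del / 81.
  rewrite normrM ger0_norm ?sqr_ge0//.
  have : b' k ^+ 2 <= 1 by nra.
  have := sqr_ge0 (b' k); have := normr_ge0 (u - v); nra.
have := ler_normD ((b k - b' k) * ((b k + b' k) * u)) (b' k ^+ 2 * (u - v)).
by have := da k; lra.
Qed.

Lemma cflim_stable a b a' b' (del : R) :
  0 <= del ->
  (forall n k, 9 <= cfrac a b n k) -> (forall n k, 9 <= cfrac a' b' n k) ->
  (forall k, 0 <= b k <= 1) -> (forall k, 0 <= b' k <= 1) ->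
  (forall k, `|a k - a' k| <= del) -> (forall k, `|b k - b' k| <= del) ->
  forall k, `|cflim a b k - cflim a' b' k| <= 5 / 4 * del.
Proof.
move=> d0 c9 c9' b1 b1' da db k.
have H := cfrac_stable d0 c9 c9' b1 b1' da db.
have l9 : 0 < 9 :> R by [].
rewrite ler_norml; apply/andP; split.
  suff : cflim a' b' k - 5 / 4 * del <= cflim a b k by lra.
  apply: (le_cflim c9) => n.
  have := H n k; have := cflim_le c9' n k; rewrite ler_norml => h /andP[*]; lra.
suff : cflim a b k - 5 / 4 * del <= cflim a' b' k by lra.
apply: (le_cflim c9') => n.
have := H n k; have := cflim_le c9 n k; rewrite ler_norml => h /andP[*]; lra.
Qed.

End ContinuedFraction.

(** * Bidiagonal factorization of a positive Jacobi matrix *)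

Section Cholesky.
Variable R : realType.
Implicit Types (u v h : l2 R).

Definition bidiag (al be : int -> R) u := diag al u + diag be (shift 1 u).
Definition bidiag_adj (al be : int -> R) u := diag al u + shift (-1) (diag be u).

Section Basics.
Variables (al be : int -> R).
Hypotheses (bal : bounded_seq al) (bbe : bounded_seq be).

Lemma bidiagE u k : bidiag al be u k = (al k)%:C * u k + (be k)%:C * u (k + 1).
Proof. by rewrite /bidiag l2D (diagE u k bal) (diagE (shift 1 u) k bbe) shiftE. Qed.

Lemma bidiag_adjE u k :
  bidiag_adj al be u k = (al k)%:C * u k + (be (k - 1))%:C * u (k - 1).
Proof. by rewrite /bidiag_adj l2D shiftE (diagE u k bal) (diagE u (k - 1) bbe). Qed.

Lemma bounded_bidiag : bounded_op (bidiag al be).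
Proof.
apply: boundedD; first exact: bounded_diag.
by apply: bounded_comp; [exact: bounded_diag|exact: bounded_shift].
Qed.

Lemma bounded_bidiag_adj : bounded_op (bidiag_adj al be).
Proof.
apply: boundedD; first exact: bounded_diag.
by apply: bounded_comp; [exact: bounded_shift|exact: bounded_diag].
Qed.

Lemma bidiag_adjoint : is_adjoint (bidiag al be) (bidiag_adj al be).
Proof.
apply: is_adjointD; first exact: diag_adjoint.
by apply: is_adjoint_comp; [exact: diag_adjoint|exact: shift_adjoint].
Qed.

End Basics.

Variables (D : l2 R -> l2 R) (a b : int -> R) (delta : R).
Hypothesis lin_D : linear D.
Hypothesis adjD : is_adjoint D D.
Hypothesis DE : forall u k,
  D u k = (a k)%:C * u k - (b k)%:C * u (k - 1) - (b (k + 1))%:C * u (k + 1).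
Hypothesis delta_gt0 : 0 < delta.
Hypothesis D_ge : forall u, delta * nsq u <= rdot (D u) u.

(** The minimizer of <D u, u> among vectors supported on [k - n, k] with u k = s. *)
Fixpoint minvec n k (s : R) : l2 R :=
  if n is m.+1
  then s%:C *: ket R k + minvec m (k - 1) (b k / cfrac a b m (k - 1) * s)
  else s%:C *: ket R k.

Lemma minvec0 k s : minvec 0 k s = s%:C *: ket R k.
Proof. by []. Qed.

Lemma minvecS n k s : minvec n.+1 k s =
  s%:C *: ket R k + minvec n (k - 1) (b k / cfrac a b n (k - 1) * s).
Proof. by []. Qed.

Lemma minvec_supp n k s j : k < j -> minvec n k s j = 0.
Proof.
elim: n k s => [|n IHn] k s kj; rewrite ?minvec0 ?minvecS ?l2D l2Z ketE (gt_eqF kj) mulr0//.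
by rewrite add0r IHn//; lia.
Qed.

Lemma minvec_top n k s : minvec n k s k = s%:C.
Proof.
case: n => [|n]; rewrite ?minvec0 ?minvecS ?l2D l2Z ketE eqxx mulr1//.
by rewrite minvec_supp ?addr0//; lia.
Qed.

Lemma rdot_D_ket s k : rdot (D (s%:C *: ket R k)) (s%:C *: ket R k) = a k * s ^+ 2.
Proof.
rewrite linZ// rdotZl rdotZr /rdot dotp_ketr DE !ketE eqxx.
have -> : (k - 1 == k) = false by lia.
have -> : (k + 1 == k) = false by lia.
by rewrite /=; ring.
Qed.

Lemma cfrac_step n : (forall k, 0 < cfrac a b n k) ->
  (forall k s, rdot (D (minvec n k s)) (minvec n k s) = cfrac a b n k * s ^+ 2) ->
  forall k s, rdot (D (minvec n.+1 k s)) (minvec n.+1 k s) = cfrac a b n.+1 k * s ^+ 2.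
Proof.
move=> c0 IH k s; rewrite minvecS /=; set c := cfrac _ _ _ _; set t := b k / c * s.
have cn0 : c != 0 by rewrite gt_eqF// c0.
set w := minvec n (k - 1) t.
rewrite linD// !(rdotDl, rdotDr) rdot_D_ket IH -/c.
have -> : rdot (D (s%:C *: ket R k)) w = rdot (D w) (s%:C *: ket R k).
  by rewrite /rdot adjD -/(rdot _ _) rdotC.
rewrite rdotZr /rdot dotp_ketr DE minvec_top.
rewrite !minvec_supp; try lia.
rewrite /= /t; field; exact: cn0.
Qed.

(** The pivot is the minimum of the quadratic form, so it inherits the lower
bound of the form. *)
Lemma cfrac_form n : (forall k, delta <= cfrac a b n k) /\
  (forall k s, rdot (D (minvec n k s)) (minvec n k s) = cfrac a b n k * s ^+ 2).
Proof.
have H m : (forall k s, rdot (D (minvec m k s)) (minvec m k s) = cfrac a b m k * s ^+ 2) ->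
    forall k, delta <= cfrac a b m k.
  move=> E k; have := E k 1; rewrite expr1n mulr1 => <-.
  apply: le_trans (D_ge _); rewrite -[leLHS]mulr1 ler_wpM2l//; first exact: ltW.
  have := normc_le_l2norm (minvec m k 1) k.
  rewrite minvec_top normcC normr1 -l2norm_sqr => h.
  by rewrite exprn_ege1.
elim: n => [|n [IHn1 IHn2]].
  have E k s : rdot (D (minvec 0 k s)) (minvec 0 k s) = cfrac a b 0 k * s ^+ 2.
    exact: rdot_D_ket.
  by split => //; exact: H.
have E := @cfrac_step n (fun k => lt_le_trans delta_gt0 (IHn1 k)) IHn2.
by split => //; exact: H.
Qed.

Lemma cfrac_ge n k : delta <= cfrac a b n k.
Proof. exact: (cfrac_form n).1. Qed.

Variables (w : R) (al be : int -> R).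
Hypothesis w_gt0 : 0 < w.
Hypotheses (bal : bounded_seq al) (bbe : bounded_seq be).
Hypothesis al_gt0 : forall k, 0 < al k.
Hypothesis al_sqr : forall k, al k ^+ 2 = w * cflim a b k.
Hypothesis albe : forall k, al k * be k = - (w * b (k + 1)).

(** The recursion of the continued fraction is the equation for the diagonal of
the Gram matrix. *)
Lemma be_sqr k : be (k - 1) ^+ 2 = w * (a k - cflim a b k).
Proof.
have x0 := cflim_gt0 delta_gt0 cfrac_ge (k - 1).
have h := albe (k - 1); rewrite subrK in h.
have -> : be (k - 1) = - (w * b k) / al (k - 1).
  by rewrite -h mulrC mulKf// gt_eqF.
rewrite expr_div_n al_sqr (cflimE delta_gt0 cfrac_ge k); field.
by rewrite !gt_eqF.
Qed.

Lemma bidiag_gram u : bidiag_adj al be (bidiag al be u) = w%:C *: D u.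
Proof.
apply: l2P => k; rewrite l2Z bidiag_adjE// !bidiagE// subrK DE.
have h1 := albe k; have h2 := albe (k - 1); rewrite subrK in h2.
transitivity ((al k ^+ 2 + be (k - 1) ^+ 2)%:C * u k + (al k * be k)%:C * u (k + 1)
   + (al (k - 1) * be (k - 1))%:C * u (k - 1)).
  by rewrite !(rmorphM, rmorphD, rmorphXn) /=; ring.
rewrite al_sqr be_sqr h1 h2 !(rmorphM, rmorphD, rmorphN, rmorphB) /=; ring.
Qed.

(** L maps the minimizer on [k - n, k] to alpha_k |k> + r, where |r|^2 is the
excess w (cfrac - cflim) of the truncated pivot, which tends to 0.  So |k> lies
in the closure of the range of L, and L^* h = 0 implies h k = 0.  Other
solutions of the pivot recursion need not have this property. *)
Lemma bidiag_adj_inj h : bidiag_adj al be h = 0 -> h = 0.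
Proof.
move=> h0; apply: l2P => k; apply: eq0_normc.
pose H := l2norm h.
suff S (e : R) : 0 < e -> al k * normc (h k) <= H * Num.sqrt (w * e).
  apply/eqP; rewrite eq_le normc_ge0 andbT leNgt; apply/negP => hk.
  pose y := al k * normc (h k).
  have y0 : 0 < y by rewrite mulr_gt0.
  have H0 : 0 < H by rewrite (lt_le_trans hk)// normc_le_l2norm.
  have e0 : 0 < (y / H / 2) ^+ 2 / w.
    by rewrite divr_gt0// exprn_gt0// divr_gt0// divr_gt0.
  have wE : w * ((y / H / 2) ^+ 2 / w) = (y / H / 2) ^+ 2 by field; rewrite !gt_eqF.
  have := S _ e0; rewrite wE sqrtr_sqr ger0_norm; last first.
    by rewrite ltW// divr_gt0// divr_gt0.
  have -> : H * (y / H / 2) = y / 2 by field; rewrite gt_eqF.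
  by rewrite -/y leNgt ltr_pdivrMr// ltr_pMr// ltr1n.
move=> e0.
have [n hn] := cflim_approx cfrac_ge k e0.
pose u := minvec n k 1.
pose r := bidiag al be u - (al k)%:C *: ket R k.
have Lk : bidiag al be u k = (al k)%:C.
  by rewrite bidiagE// minvec_top minvec_supp ?mulr0 ?addr0 ?mulr1//; lia.
have nr : nsq r <= w * e.
  have E1 : nsq (bidiag al be u) = w * cfrac a b n k.
    rewrite -rdot_self /rdot bidiag_adjoint// bidiag_gram// dotpZr ReZ.
    by rewrite -/(rdot _ _) rdotC (cfrac_form n).2 expr1n mulr1.
  have E2 : rdot (bidiag al be u) (ket R k) = al k.
    by rewrite /rdot dotp_ketr Lk.
  have E3 : nsq (bidiag al be u) + 2 * (- (al k * al k)) + al k ^+ 2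
      = w * (cfrac a b n k - cflim a b k).
    by rewrite E1 mulrBr -al_sqr; ring.
  rewrite /r nsqD rdotNr rdotZr E2 -scaleN1r nsqZ nsqZ nsq_ket normcN normc1.
  rewrite expr1n mul1r mulr1 normcC real_normK ?num_real// E3.
  by rewrite ler_wpM2l ?(ltW w_gt0)// lerBlDl.
have : dotp h (bidiag al be u) = 0.
  rewrite dotpC bidiag_adjoint// h0 dotp0r conjc0//.
have -> : bidiag al be u = (al k)%:C *: ket R k + r by rewrite /r addrC subrK.
rewrite dotpDr dotpZr dotp_ketr => /eqP; rewrite addr_eq0 => /eqP E.
have := congr1 (@normc R) E; rewrite normcN normcM normc_conj normcC ger0_norm ?(ltW (al_gt0 k))// => ->.
rewrite (le_trans (dotp_le _ _))// ler_wpM2l ?l2norm_ge0// l2normE.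
by rewrite ler_sqrt// mulr_ge0 ?(ltW w_gt0) ?(ltW e0).
Qed.

(** L^* kills w h - L E L^* h, by [bidiag_gram]. *)
Lemma bidiag_inverse E h : linear E -> cancel E D ->
  bidiag al be (E (bidiag_adj al be h)) = w%:C *: h.
Proof.
move=> lE ED.
have [lA _] := bounded_bidiag_adj bal bbe.
apply/eqP; rewrite eq_sym -subr_eq0; apply/eqP/bidiag_adj_inj.
by rewrite linB// linZ// bidiag_gram ED subrr.
Qed.

End Cholesky.

(** * Resolvent of an arrow operator *)

Section Arrow.
Variables (R : realType) (n : nat).
Notation H := (l2 R).
Variables (J V Vs : H -> H) (F Fs L Li D E : 'I_n -> H -> H).
Variables (q : R[i]) (c : 'I_n -> R[i]).
Hypotheses (bJ : bounded_op J) (bV : bounded_op V) (bVs : bounded_op Vs).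
Hypotheses (bF : forall i, bounded_op (F i)) (bFs : forall i, bounded_op (Fs i)).
Hypotheses (bL : forall i, bounded_op (L i)) (bLi : forall i, bounded_op (Li i)).
Hypotheses (bD : forall i, bounded_op (D i)) (bE : forall i, bounded_op (E i)).
Hypothesis VsV : forall u, Vs (V u) = u.
Hypothesis VsF : forall i u, Vs (F i u) = 0.
Hypothesis FsV : forall i u, Fs i (V u) = 0.
Hypothesis FsF : forall i l u, Fs i (F l u) = if i == l then u else 0.
Hypothesis VF_total : forall g, g = V (Vs g) + \sum_i F i (Fs i g).
Hypothesis LLi : forall i u, L i (Li i u) = u.
Hypothesis LiL : forall i u, Li i (L i u) = u.
Hypothesis DE : forall i u, D i (E i u) = u.
Hypothesis ED : forall i u, E i (D i u) = u.
Hypothesis JV : forall u, J (V u) = q *: V u + \sum_i F i (L i u).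
Hypothesis JF : forall i u, J (F i (L i u)) = c i *: F i (L i u) + V (D i u).

Let lJ := bJ.1. Let lV := bV.1. Let lVs := bVs.1.
Let lF i := (bF i).1. Let lFs i := (bFs i).1. Let lL i := (bL i).1.
Let lLi i := (bLi i).1. Let lD i := (bD i).1. Let lE i := (bE i).1.

(** Coordinates u0, u_i on the whole space.  In them J is the matrix with entries
q and c_i on the diagonal, D_i in row 0 and 1 in column 0 ([J_assemble]). *)
Definition assemble (u0 : H) (u : 'I_n -> H) := V u0 + \sum_i F i (L i (u i)).

Lemma assemble_split g : g = assemble (Vs g) (fun i => Li i (Fs i g)).
Proof.
rewrite {1}(VF_total g); congr (_ + _); apply: eq_bigr => i _.
by rewrite LLi.
Qed.

Lemma assemble0 u0 u : assemble u0 u = 0 -> u0 = 0 /\ forall i, u i = 0.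
Proof.
move=> H0; split.
  have := congr1 Vs H0; rewrite linD// VsV lin_sum// big1 ?addr0 => [|i _].
    by rewrite lin0.
  by rewrite VsF.
move=> i; have := congr1 (Fs i) H0; rewrite linD// FsV add0r lin_sum//.
rewrite (bigD1 i)//= FsF eqxx big1 ?addr0 => [|l li]; last first.
  by rewrite FsF eq_sym (negbTE li).
by rewrite lin0// => /(congr1 (Li i)); rewrite LiL lin0.
Qed.

Lemma J_assemble z u0 u : scal_sub z J (assemble u0 u) =
  assemble ((z - q) *: u0 - \sum_i D i (u i)) (fun i => (z - c i) *: u i - u0).
Proof.
rewrite /scal_sub /assemble (linD lJ) JV (lin_sum _ _ _ lJ).
under [X in _ - (_ + X)]eq_bigr do rewrite JF.
rewrite big_split /= (linB lV) (linZ lV) (lin_sum _ _ _ lV) scalerBl.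
under [in RHS]eq_bigr do rewrite (linB (@lL _)) (linZ (@lL _)) (linB (@lF _)) (linZ (@lF _)) scalerBl.
rewrite !sumrB scalerDr scaler_sumr.
set x1 := V u0; set s1 := \sum_i z *: _; set s2 := \sum_i F _ (L _ u0).
set s3 := \sum_i c _ *: _; set s4 := \sum_i V _.
by apply: l2P => k; rewrite !(l2D, l2N, l2Z); ring.
Qed.

Section Solver.
Variables (z : R[i]) (G0 : H -> H) (G : 'I_n -> H -> H).
Hypotheses (bG0 : bounded_op G0) (bG : forall i, bounded_op (G i)).
Hypothesis G_0 : forall g, (z - q) *: G0 g - \sum_i D i (G i g) = Vs g.
Hypothesis G_i : forall i g, (z - c i) *: G i g - G0 g = Li i (Fs i g).
Hypothesis uniq_sol : forall u0 u, (z - q) *: u0 - \sum_i D i (u i) = 0 ->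
  (forall i, (z - c i) *: u i - u0 = 0) -> u0 = 0 /\ forall i, u i = 0.

(** A bounded solution of the arrow system in coordinates is a right inverse of
z - J; uniqueness makes it two-sided. *)
Lemma solver_inverse : is_inverse (scal_sub z J) (fun g => assemble (G0 g) (G ^~ g)).
Proof.
have bS : bounded_op (fun g => assemble (G0 g) (G^~ g)).
  apply: boundedD; first exact: bounded_comp.
  apply: bounded_sum => i; apply: bounded_comp => //; exact: bounded_comp.
have K g : scal_sub z J (assemble (G0 g) (G^~ g)) = g.
  rewrite J_assemble G_0 [in RHS](assemble_split g) /assemble.
  by congr (_ + _); apply: eq_bigr => i _; rewrite G_i.
have [lS _] := bounded_scal_sub z bJ.
have inj h : scal_sub z J h = 0 -> h = 0.
  rewrite {1}(assemble_split h) J_assemble => /assemble0[h1 h2].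
  have [e0 e] := uniq_sol h1 h2.
  rewrite (assemble_split h) /assemble e0 (lin0 lV) big1 ?addr0// => i _.
  by rewrite e (lin0 (lL i)) (lin0 (lF i)).
split => // g; apply/eqP; rewrite -subr_eq0; apply/eqP/inj.
by rewrite (linB lS) K subrr.
Qed.

Lemma solver_renorm u : Vs (assemble (G0 (V u)) (G^~ (V u))) = G0 (V u).
Proof.
by rewrite /assemble (linD lVs) VsV (lin_sum _ _ _ lVs) big1 ?addr0.
Qed.

End Solver.

Variables (A : H -> H).
Hypothesis bA : bounded_op A.

(** Row i gives u_i = (u0 + w_i) / (z - c_i); inserted in row 0, this leaves
kappa (y - A) u0 on the left, which is solved by Ry. *)
Lemma regular_inverse z y kappa Ry : (forall i, z != c i) -> kappa != 0 ->
  is_inverse (scal_sub y A) Ry ->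
  (forall v, (z - q) *: v - \sum_i (z - c i)^-1 *: D i v = kappa *: scal_sub y A v) ->
  exists2 B, is_inverse (scal_sub z J) B & forall u, Vs (B (V u)) = kappa^-1 *: Ry u.
Proof.
move=> zc k0 [bR AR RA] key.
have zc0 i : z - c i != 0 by rewrite subr_eq0.
pose w i g := Li i (Fs i g).
pose G0 g := kappa^-1 *: Ry (Vs g + \sum_i (z - c i)^-1 *: D i (w i g)).
pose G i g := (z - c i)^-1 *: (G0 g + w i g).
have bw i : bounded_op (w i) by apply: bounded_comp.
have bG0 : bounded_op G0.
  apply: boundedZ; apply: bounded_comp => //; apply: boundedD => //.
  by apply: bounded_sum => i; apply: boundedZ; apply: bounded_comp.
have bG i : bounded_op (G i) by apply: boundedZ; apply: boundedD.
have [lA _] := bounded_scal_sub y bA.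
have h0 g : (z - q) *: G0 g - \sum_i D i (G i g) = Vs g.
  have -> : \sum_i D i (G i g) = \sum_i (z - c i)^-1 *: D i (G0 g) +
     \sum_i (z - c i)^-1 *: D i (w i g).
    rewrite -big_split; apply: eq_bigr => i _.
    by rewrite /G (linZ (lD i)) (linD (lD i)) scalerDr.
  rewrite opprD addrA key {1}/G0 (linZ lA) scalerA mulfV// scale1r RA.
  by rewrite addrK.
have hi i g : (z - c i) *: G i g - G0 g = Li i (Fs i g).
  by rewrite /G scalerA mulfV// scale1r addrAC subrr add0r.
exists (fun g => assemble (G0 g) (G ^~ g)).
  apply: solver_inverse => // u0 u e0 e.
  have ui i : u i = (z - c i)^-1 *: u0.
    have /eqP := e i; rewrite subr_eq0 => /eqP <-.
    by rewrite scalerA mulVf// scale1r.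
  have u00 : u0 = 0.
    have := key u0.
    have -> : \sum_i (z - c i)^-1 *: D i u0 = \sum_i D i (u i).
      by apply: eq_bigr => i _; rewrite ui (linZ (lD i)).
    rewrite e0 => /esym/eqP; rewrite scaler_eq0 (negbTE k0) /= => /eqP S0.
    by rewrite -(AR u0) S0 (lin0 bR.1).
  by split => // i; rewrite ui u00 scaler0.
move=> u; rewrite solver_renorm /G0 VsV big1 ?addr0// => i _.
by rewrite /w FsV (lin0 (lLi i)) (lin0 (lD i)) scaler0.
Qed.

(** Row m reads - u0 = w_m, and u_m is then found from row 0, through the inverse
of D_m.  For vectors in the range of V, w_m = 0; hence u0 = 0, and the
compression of the resolvent vanishes. *)
Lemma critical_inverse m : injective c ->
  exists2 B, is_inverse (scal_sub (c m) J) B & forall u, Vs (B (V u)) = 0.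
Proof.
move=> cinj; pose z := c m.
have zc0 i : i != m -> z - c i != 0.
  by move=> im; rewrite subr_eq0; apply: contra im => /eqP/cinj ->.
pose w i g := Li i (Fs i g).
pose G0 g := - w m g.
pose G' i g := (z - c i)^-1 *: (G0 g + w i g).
pose Gm g := E m ((z - q) *: G0 g - \sum_(i | i != m) D i (G' i g) - Vs g).
pose G i g := if i == m then Gm g else G' i g.
have bw i : bounded_op (w i) by apply: bounded_comp.
have bG0 : bounded_op G0 by apply: boundedN.
have bG' i : bounded_op (G' i) by apply: boundedZ; apply: boundedD.
have bG i : bounded_op (G i).
  rewrite /G; case: eqP => // _; apply: (bounded_comp (bE m)).
  apply: (boundedB _ bVs); apply: boundedB; first exact: boundedZ.
  by apply: bounded_sum => l; apply: (bounded_comp (bD l)).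
have h0 g : (z - q) *: G0 g - \sum_i D i (G i g) = Vs g.
  rewrite (bigD1 m)//= /G eqxx DE.
  under eq_bigr => i /negbTE -> do [].
  set s := \sum_(i | _) _; set x := _ *: _.
  by apply: l2P => k; rewrite !(l2D, l2N); ring.
have hi i g : (z - c i) *: G i g - G0 g = Li i (Fs i g).
  rewrite /G; case: eqP => [->|/eqP im]; first by rewrite subrr scale0r sub0r opprK.
  by rewrite /G' scalerA mulfV ?zc0// scale1r addrAC subrr add0r.
exists (fun g => assemble (G0 g) (G ^~ g)).
  apply: solver_inverse => // u0 u e0 e.
  have u00 : u0 = 0.
    by have := e m; rewrite subrr scale0r sub0r => /eqP; rewrite oppr_eq0 => /eqP.
  have ui i : i != m -> u i = 0.
    move=> im; have := e i; rewrite u00 subr0 => /eqP.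
    by rewrite scaler_eq0 (negbTE (zc0 i im)) => /eqP.
  split => // i; have [->|] := eqVneq i m; last exact: ui.
  move: e0; rewrite (bigD1 m)//= big1 => [|l lm]; last by rewrite ui ?(lin0 (lD l)).
  rewrite u00 scaler0 sub0r addr0 => /eqP; rewrite oppr_eq0 => /eqP h.
  by rewrite -(ED m (u m)) h (lin0 (lE m)).
move=> u; rewrite solver_renorm /G0 /w FsV (lin0 (lLi m)) oppr0//.
Qed.

End Arrow.

(** * The renormalized Jacobi matrix *)

Section JacobiBounds.
Variable R : realType.
Variables (A : l2 R -> l2 R).
Hypotheses (jA : jacobi A) (specA : spectrum A `<=` segment (R := R)).

Let NR (s : R) : `|s| = 1 -> forall u, s * rdot (A u) u <= nsq u.
Proof. by case: jA => bA sA _; exact: numerical_range. Qed.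

Lemma offd_ge0 k : 0 <= offd A k.
Proof. exact: (jacobi_ket k jA).1. Qed.

Lemma rdot_ket_ket j k : rdot (A (ket R j)) (ket R k) = complex.Re (A (ket R j) k).
Proof. by rewrite /rdot dotp_ketr; case: (A _ _). Qed.

Lemma diagonal_le1 k : `|diagonal A k| <= 1.
Proof.
have n1 : `|-1 : R| = 1 by rewrite normrN normr1.
have := NR n1 (ket R k); have := NR (normr1 R) (ket R k).
rewrite rdot_ket_ket nsq_ket -/(diagonal A k) => h1 h2.
by rewrite ler_norml; lra.
Qed.

(** Numerical range on |k> + |k-1> and on |k> - |k-1>, with opposite signs. *)
Lemma offd_le1 k : offd A k <= 1.
Proof.
have n1 : `|-1 : R| = 1 by rewrite normrN normr1.
have [bA sA _] := jA; have lA := bA.1.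
have h1 := NR (normr1 R) (ket R k + ket R (k - 1)).
have h2 := NR n1 (ket R k - ket R (k - 1)).
have E1 : rdot (A (ket R k)) (ket R (k - 1)) = offd A k by rewrite rdot_ket_ket.
have E2 : rdot (A (ket R (k - 1))) (ket R k) = offd A k.
  by rewrite /rdot sA -/(rdot _ _) rdotC.
have E3 : rdot (ket R k) (ket R (k - 1)) = 0.
  rewrite /rdot dotp_ket ketE; have -> : (k == k - 1) = false by lia.
  by [].
move: h1 h2; rewrite (linD lA) (linB lA) !nsqD !(rdotDl, rdotDr, rdotNl, rdotNr).
rewrite E1 E2 E3 -scaleN1r nsqZ !nsq_ket normcN normc1.
lra.
Qed.

End JacobiBounds.

Lemma eq_cflim (R : realType) (a b b' : int -> R) : (forall k, b k ^+ 2 = b' k ^+ 2) ->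
  cfrac a b = cfrac a b' /\ cflim a b = cflim a b'.
Proof.
move=> bb'.
have E n k : cfrac a b n k = cfrac a b' n k.
  by elim: n k => //= n IHn k; rewrite bb' IHn.
have E' : cfrac a b = cfrac a b' by apply/funext => n; apply/funext => k.
by split => //; rewrite /cflim E'.
Qed.

Lemma le_1D_of_sqr_le (R : realDomainType) (e S : R) : 0 <= S -> e ^+ 2 <= S -> e <= 1 + S.
Proof. by move=> S0 eS; have := sqr_ge0 (e - 1); nra. Qed.

Lemma realC_mulA (R : realType) (x y : R) (w : R[i]) : (x * y)%:C * w = x%:C * (y%:C * w).
Proof. by rewrite mulrA; congr (_ * _); rewrite rmorphM. Qed.

Section Definition_of_J.
Variables (R : realType) (T : {poly R}) (eps : nat) (Jt : l2 R -> l2 R).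
Notation n := (degree T - 1)%N.

(** Diagonal entries of sgn(t_i) (t_i - Jt); the off-diagonal ones are, up to sign,
those of Jt. *)
Definition cfcoef (i : 'I_n) k : R :=
  `|T.[critpt i]| - Num.sg T.[critpt i] * diagonal Jt k.
Definition cfval (i : 'I_n) : int -> R := cflim (cfcoef i) (offd Jt).
Definition weight k (i : 'I_n) : R := critwt i * cfval i k.

Definition pfirst k : R := Num.sqrt (nrm (@critpt _ T) (weight k) 0).
(** The coupling of the last site of block k to the next cut, dictated by the
off-diagonal entries of the Gram matrix ([alpha_beta]). *)
Definition plast k : R :=
  offd Jt (k + 1) * (lead_coef T)^-1 / Num.sqrt (nrm (@critpt _ T) (weight k) n.-1).
(** Entry between sites j - 1 and j of block k, the cut being site 0; the case
j = 0 is the link from the last site of block k - 1. *)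
Definition offblock k j : R :=
  match j with
  | 0 => plast (k - 1)
  | 1 => pfirst k
  | j'.+1 => offcoef (@critpt _ T) (weight k) j'
  end.
Definition diagblock k j : R :=
  if j is j'.+1 then diagcoef (@critpt _ T) (weight k) j' else qbar T.

(** Site eps + d k + j carries f k j. *)
Definition blocks (f : int -> nat -> R) (m : int) : R :=
  f ((m - eps%:Z) %/ degree T)%Z `|((m - eps%:Z) %% degree T)%Z|%N.

Definition renormJ : l2 R -> l2 R := tridiag (blocks offblock) (blocks diagblock).

Hypothesis expT : expanding T.
Hypotheses (jJ : jacobi Jt) (specJ : spectrum Jt `<=` segment (R := R)).

Local Notation d := (degree T).
Local Notation t i := T.[@critpt R T i].
Local Notation c := (@critpt R T).

Let dn : d = n.+1.
Proof. by have := deg_ge2 expT; lia. Qed.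
Let d0 : (0 < d)%N.
Proof. by rewrite dn. Qed.
Let n0 : (0 < n)%N.
Proof. by have := deg_ge2 expT; lia. Qed.

Let Sd j : (j < n)%N -> (j.+1 < d)%N.
Proof. by move=> jn; rewrite dn. Qed.

Definition site (k : int) (j : nat) : int := (eps + j)%N%:Z + d%:Z * k.

Lemma siteP m : exists k j, (j < d)%N /\ m = site k j.
Proof.
exists ((m - eps%:Z) %/ d)%Z, `|((m - eps%:Z) %% d)%Z|%N.
have dz : d%:Z != 0 by rewrite eqz_nat -lt0n.
have h := divz_eq (m - eps%:Z) d; have h0 := modz_ge0 (m - eps%:Z) dz.
have h1 := ltz_pmod (m - eps%:Z) (d0 : 0 < d%:Z).
split; first by rewrite -ltz_nat gez0_abs.
rewrite /site PoszD gez0_abs// -addrA [_ + d%:Z * _]addrC (mulrC d%:Z) -h.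
by rewrite addrC subrK.
Qed.

Lemma blocksE f k j : (j < d)%N -> blocks f (site k j) = f k j.
Proof.
move=> jd; rewrite /blocks /site.
have -> : (eps + j)%N%:Z + d%:Z * k - eps%:Z = k * d + j%:Z by rewrite PoszD; ring.
have dz : d%:Z != 0 by rewrite eqz_nat -lt0n.
rewrite divzMDl// divz_small ?addr0; last by rewrite ltz_nat jd.
by rewrite modzMDl modz_small//.
Qed.

Lemma interlace_site (u : l2 R) k j l : (j < d)%N -> (l < d)%N ->
  interlace d (eps + l) u (site k j) = if j == l then u k else 0.
Proof.
move=> jd ld; case: eqP => [->|jl]; first by rewrite interlace_at.
rewrite interlaceE; case: ifP => // /dvdzP[m]; rewrite /site.
move=> h; exfalso; apply: jl.
have {}h : j%:Z - l%:Z = (m - k) * d%:Z.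
  by rewrite mulrBl -h !PoszD; ring.
have [mk|mk|mk] := ltgtP (m - k) 0; first nia; first nia.
by move: h; rewrite mk mul0r; lia.
Qed.

Lemma site_succ k j : (j.+1 < d)%N -> site k j + 1 = site k j.+1.
Proof. by move=> _; rewrite /site addnS -addn1 PoszD; ring. Qed.

Lemma site_last k : site k n + 1 = site (k + 1) 0.
Proof.
rewrite /site addn0 mulrDr mulr1 PoszD.
have -> : d%:Z = n%:Z + 1 by rewrite {1}dn -addn1 PoszD.
ring.
Qed.

Lemma sg_norm i : `|Num.sg (t i)| = 1.
Proof.
have := crit_val_gt1 expT i; rewrite normr_sg.
by case: eqP => // ->; rewrite normr0 ltr10.
Qed.

Lemma sg_sqr i : Num.sg (t i) * Num.sg (t i) = 1.
Proof. by rewrite -expr2 -real_normK ?num_real// sg_norm expr1n. Qed.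

(** The sign is that of t_i - Jt as a quadratic form, since the spectrum of Jt
lies in [-1, 1] and |t_i| > 1; hence positive definite, see [posform_ge]. *)
Definition posform i u : l2 R := (Num.sg (t i))%:C *: scal_sub (t i)%:C Jt u.

Let bJt : bounded_op Jt. Proof. by case: jJ. Qed.

Lemma bounded_posform i : bounded_op (posform i).
Proof. by apply: boundedZ; exact: bounded_scal_sub. Qed.

Lemma posform_adjoint i : is_adjoint (posform i) (posform i).
Proof.
case: jJ => _ sJ _ u v.
by rewrite !(dotpZl, dotpZr, dotpBl, dotpBr) !conjc_real sJ.
Qed.

Definition signed_off i k := Num.sg (t i) * offd Jt k.

Lemma posformE i u k : posform i u k = (cfcoef i k)%:C * u k
  - (signed_off i k)%:C * u (k - 1) - (signed_off i (k + 1))%:C * u (k + 1).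
Proof.
rewrite l2Z l2B l2Z (jacobiE u k jJ) /cfcoef /signed_off normrEsg !(rmorphB, rmorphM) /=; ring.
Qed.

Lemma posform_ge i u : (`|t i| - 1) * nsq u <= rdot (posform i u) u.
Proof.
have [bA sA _] := jJ.
have := numerical_range bA sA specJ (sg_norm i) u.
rewrite /posform rdotZl /scal_sub rdotDl rdotNl rdotZl rdot_self normrEsg => h.
have -> : Num.sg (t i) * (t i * nsq u - rdot (Jt u) u) =
  Num.sg (t i) * t i * nsq u - Num.sg (t i) * rdot (Jt u) u by ring.
by rewrite mulrBl mul1r lerD2l lerN2.
Qed.

Let delta_gt0 i : 0 < `|t i| - 1.
Proof. by rewrite subr_gt0 crit_val_gt1. Qed.

Lemma signed_sqr i k : signed_off i k ^+ 2 = offd Jt k ^+ 2.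
Proof. by rewrite exprMn [_ ^+ 2]expr2 sg_sqr mul1r. Qed.

Lemma cfrac_coef_ge i m k : `|t i| - 1 <= cfrac (cfcoef i) (offd Jt) m k.
Proof.
rewrite -(eq_cflim (cfcoef i) (signed_sqr i)).1.
apply: (@cfrac_ge _ (posform i)) => //; first exact: (bounded_posform i).1.
- exact: posform_adjoint.
- exact: posformE.
- exact: posform_ge.
Qed.

Lemma cfval_ge i k : `|t i| - 1 <= cfval i k.
Proof. exact: (cflim_ge (cfrac_coef_ge i)). Qed.

Lemma cfval_gt0 i k : 0 < cfval i k.
Proof. exact: lt_le_trans (cfval_ge i k). Qed.

Lemma cfcoefE i k : cfcoef i k = `|t i - diagonal Jt k|.
Proof.
have := diagonal_le1 jJ specJ k; have := crit_val_gt1 expT i; rewrite /cfcoef ler_norml.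
case: (ltgtP (t i) 0) => t0.
- rewrite ltr0_sg// ltr0_norm// => h /andP[*]; rewrite ltr0_norm; lra.
- rewrite gtr0_sg// gtr0_norm// => h /andP[*]; rewrite gtr0_norm; lra.
- by rewrite t0 normr0 ltr10.
Qed.

Lemma cfval_le i k : cfval i k <= `|t i - diagonal Jt k|.
Proof. by rewrite -cfcoefE; exact: (cflim_le (cfrac_coef_ge i) 0 k). Qed.

Lemma weight_gt0 k i : 0 < weight k i.
Proof. by rewrite mulr_gt0 ?critwt_gt0 ?cfval_gt0. Qed.

(** The pivot is at most |t_i - q| with q a diagonal entry of Jt, so this is
[critwt_sum_le] at s = q. *)
Lemma weight_sum k : \sum_i weight k i <= 1.
Proof.
have q1 : -1 <= diagonal Jt k <= 1 by rewrite -ler_norml diagonal_le1.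
apply: le_trans (critwt_sum_le expT q1); apply: ler_sum => i _.
by rewrite ler_wpM2l ?(ltW (critwt_gt0 expT i))// cfval_le.
Qed.

Let cinj : injective c := critpt_inj expT.

Lemma pfirst_ge0 k : 0 <= pfirst k. Proof. exact: sqrtr_ge0. Qed.

Lemma pfirst_le1 k : pfirst k <= 1.
Proof. by rewrite /pfirst nrm0E -sqrtr1 ler_sqrt ?weight_sum. Qed.

Lemma plast_ge0 k : 0 <= plast k.
Proof.
by rewrite mulr_ge0 ?invr_ge0 ?sqrtr_ge0// mulr_ge0 ?offd_ge0// invr_ge0 ltW// lead_gt0.
Qed.

(** [nrm_lastV] for the weights critwt i * cfval i k. *)
Lemma last_coupling_sqr k : ((lead_coef T)^-1 / Num.sqrt (nrm c (weight k) n.-1)) ^+ 2 =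
  \sum_i critwt i / cfval i k.
Proof.
have a0 := lead_gt0 expT; have x0 := weight_gt0 k.
rewrite exprMn [(Num.sqrt _)^-1 ^+ 2]exprVn sqr_sqrtr ?ip_ge0// (nrm_lastV cinj x0 n0).
rewrite mulr_sumr; apply: eq_bigr => i _.
have X0 := cfval_gt0 i k; have w0 := critwt_gt0 expT i.
have dl := dlag_neq0 cinj i.
have E : critwt i ^+ 2 = (lead_coef T * dlag c i) ^- 2.
  by rewrite /critwt exprVn real_normK ?num_real.
rewrite /weight.
have -> : ((lead_coef T)^-1) ^+ 2 / (dlag c i ^+ 2 * (critwt i * cfval i k)) =
   (lead_coef T * dlag c i) ^- 2 / (critwt i * cfval i k).
  by field; rewrite dl !gt_eqF.
rewrite -E; field; rewrite !gt_eqF//.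
Qed.

Lemma last_coupling_le (m : R) k : 0 < m -> (forall i, m <= cfval i k) ->
  (lead_coef T)^-1 / Num.sqrt (nrm c (weight k) n.-1) <= m^-1.
Proof.
move=> m0 mX; have a0 := lead_gt0 expT.
rewrite -(ler_pXn2r (_ : 0 < 2)%N) ?nnegrE ?mulr_ge0 ?invr_ge0 ?sqrtr_ge0 ?(ltW a0) ?(ltW m0)//.
rewrite last_coupling_sqr exprVn -[leRHS]mul1r ler_pdivlMr ?exprn_gt0// mulr_suml.
apply: le_trans (weight_sum k); apply: ler_sum => i _.
have X0 := cfval_gt0 i k; have w0 := critwt_gt0 expT i.
rewrite /weight -mulrA ler_wpM2l ?(ltW w0)// mulrC ler_pdivrMr// -expr2.
by rewrite lerXn2r ?nnegrE ?(ltW m0) ?(ltW X0).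
Qed.

Lemma plast_bound : exists M, forall k, plast k <= M.
Proof.
pose S : R := \sum_i critwt i / (`|t i| - 1).
have S0 : 0 <= S.
  apply: sumr_ge0 => i _; rewrite divr_ge0 ?(ltW (critwt_gt0 expT i))//.
  exact: ltW (delta_gt0 i).
exists (1 + S) => k.
pose e := (lead_coef T)^-1 / Num.sqrt (nrm c (weight k) n.-1).
have e0 : 0 <= e by rewrite divr_ge0 ?sqrtr_ge0// invr_ge0 ltW// lead_gt0.
have eS : e ^+ 2 <= S.
  rewrite last_coupling_sqr; apply: ler_sum => i _; rewrite ler_wpM2l ?(ltW (critwt_gt0 expT i))//.
  by rewrite lef_pV2 ?posrE ?cfval_gt0 ?cfval_ge.
have le : e <= 1 + S := le_1D_of_sqr_le S0 eS.
rewrite /plast -mulrA -/e (le_trans _ le)// ler_piMl// offd_le1//.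
Qed.

Lemma offblock_ge0 k j : 0 <= offblock k j.
Proof. by case: j => [|[|j]]; rewrite /= ?plast_ge0 ?sqrtr_ge0. Qed.

Lemma offcoef_weight k j : (0 < j < n)%N -> offcoef c (weight k) j <= 1.
Proof.
move=> jn; have [//|_ ->//] := andP (offcoef_le1 cinj (weight_gt0 k) _ jn).
exact: critpt_le1.
Qed.

Lemma offblock_bound : exists M, forall k j, (j < d)%N -> `|offblock k j| <= M.
Proof.
have [M HM] := plast_bound; exists (1 + `|M|) => k j jd.
rewrite ger0_norm ?offblock_ge0//.
have M0 := normr_ge0 M; have MM := ler_norm M.
case: j jd => [|[|j]] jd /=.
- by have := HM (k - 1); lra.
- by have := pfirst_le1 k; lra.
- have jn : (j.+1 < n)%N by rewrite dn in jd.
  by have := @offcoef_weight k j.+1 jn; lra.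
Qed.

Lemma diagcoef_weight k j : (j < n)%N -> `|diagcoef c (weight k) j| <= 1.
Proof. by move=> jn; apply: diagcoef_le1 => //; [exact: weight_gt0|exact: critpt_le1]. Qed.

Lemma diagblock_bound k j : (j < d)%N -> `|diagblock k j| <= 1 + `|qbar T|.
Proof.
case: j => [|j] jd /=; first by rewrite lerDr.
by rewrite dn in jd; have := diagcoef_weight k jd; have := normr_ge0 (qbar T); lra.
Qed.

Lemma bounded_blocks f (M : R) : (forall k j, (j < d)%N -> `|f k j| <= M) ->
  forall m, `|blocks f m| <= M.
Proof.
by move=> fM m; have [k [j [jd ->]]] := siteP m; rewrite blocksE// fM.
Qed.

Let boff : bounded_seq (blocks offblock).
Proof. by have [M HM] := offblock_bound; exists M; exact: bounded_blocks. Qed.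

Let bdiag : bounded_seq (blocks diagblock).
Proof. by exists (1 + `|qbar T|); apply: bounded_blocks; exact: diagblock_bound. Qed.

Lemma renormJ_bounded : bounded_seq (blocks offblock) /\ bounded_seq (blocks diagblock).
Proof. exact: (conj boff bdiag). Qed.

Lemma jacobi_renormJ : jacobi renormJ.
Proof.
apply: jacobi_tridiag => // m; have [k [j [jd ->]]] := siteP m.
by rewrite blocksE// offblock_ge0.
Qed.

Lemma site_ext (u v : l2 R) :
  (forall k, u (site k 0) = v (site k 0)) ->
  (forall k j, (j < n)%N -> u (site k j.+1) = v (site k j.+1)) -> u = v.
Proof.
move=> h0 hS; apply: l2P => m; have [k [[|j] [jd ->]]] := siteP m; first exact: h0.
by apply: hS; rewrite dn in jd.
Qed.

Lemma renormJ_site0 u k : renormJ u (site k 0) =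
  (plast (k - 1))%:C * u (site (k - 1) n) + (qbar T)%:C * u (site k 0)
  + (pfirst k)%:C * u (site k 1).
Proof.
have d1 : (1 < d)%N by exact: deg_ge2.
rewrite tridiagE// site_succ// !blocksE//=.
by have := site_last (k - 1); rewrite subrK => <-; rewrite addrK.
Qed.

Lemma renormJ_siteS u k j : (j < n)%N -> renormJ u (site k j.+1) =
  (offblock k j.+1)%:C * u (site k j) + (diagcoef c (weight k) j)%:C * u (site k j.+1)
  + (if (j.+1 < n)%N then (offblock k j.+2)%:C * u (site k j.+2)
     else (plast k)%:C * u (site (k + 1) 0)).
Proof.
move=> jn; have jd : (j.+1 < d)%N by rewrite dn.
rewrite tridiagE// (blocksE _ _ jd) (blocksE _ _ jd) -(site_succ k jd) addrK.
congr (_ + _); case: ifP => jn1.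
  have jd2 : (j.+2 < d)%N by rewrite dn.
  by rewrite (site_succ k jd) (site_succ k jd2) blocksE.
have -> : site k j + 1 = site k n.
  rewrite (site_succ k jd); congr (site k _).
  by apply/eqP; rewrite eqn_leq jn leqNgt jn1.
by rewrite site_last blocksE//= addrK.
Qed.

Notation U k j i := (opmx c (weight k) j i).

Lemma U_bound (j : 'I_n) i : bounded_seq (fun k => U k j i).
Proof.
exists 1 => k.
have h : \sum_l U k j l * U k j l = 1.
  by rewrite (opmx_row cinj (weight_gt0 k) (ltn_ord j) (ltn_ord j)) eqxx.
have : U k j i ^+ 2 <= 1.
  rewrite -h (bigD1 i)//= expr2 lerDl; apply: sumr_ge0 => l _; rewrite -expr2; exact: sqr_ge0.
rewrite -[leRHS](expr1n R 2) -real_normK ?num_real// ler_pXn2r ?nnegrE//.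
Qed.

Definition Vop : l2 R -> l2 R := interlace d eps.
(** F_i |k> is the normalized eigenvector of eigenvalue c_i of block k. *)
Definition Fop i u : l2 R :=
  \sum_(j < n) interlace d (eps + j.+1) (diag (fun k => U k j i) u).
Definition Fadj i u : l2 R :=
  \sum_(j < n) diag (fun k => U k j i) (decimate d (eps + j.+1) u).

Lemma bounded_Fop i : bounded_op (Fop i).
Proof.
apply: bounded_sum => j; apply: bounded_comp; first exact: bounded_interlace.
exact/bounded_diag/U_bound.
Qed.

Lemma bounded_Fadj i : bounded_op (Fadj i).
Proof.
apply: bounded_sum => j; apply: bounded_comp; first exact/bounded_diag/U_bound.
exact: bounded_decimate.
Qed.

Lemma Vop_site0 u k : Vop u (site k 0) = u k.
Proof. by rewrite /site addn0 /Vop interlace_at. Qed.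

Lemma Vop_siteS u k j : (j < n)%N -> Vop u (site k j.+1) = 0.
Proof.
move=> jn; rewrite /Vop -{1}(addn0 eps) interlace_site//.
by rewrite dn.
Qed.

Lemma Vop_site_n u k : Vop u (site k n) = 0.
Proof. by have := @Vop_siteS u k n.-1; rewrite prednK// => ->. Qed.

Lemma Fop_site0 i u k : Fop i u (site k 0) = 0.
Proof.
by rewrite l2sum big1// => j _; rewrite interlace_site// Sd.
Qed.

Lemma Fop_siteS i u k j : (j < n)%N -> Fop i u (site k j.+1) = (U k j i)%:C * u k.
Proof.
move=> jn; rewrite l2sum (bigD1 (Ordinal jn))// big1 ?addr0 => [|l lj].
  by rewrite interlace_site ?Sd// eqxx diagE /= ?addr0//; exact: (U_bound (Ordinal jn)).
rewrite interlace_site ?Sd//.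
by case: eqP => // -[jl]; move: lj; rewrite -val_eqE /= jl eqxx.
Qed.

Lemma Fop_site_n i u k : Fop i u (site k n) = (U k n.-1 i)%:C * u k.
Proof. by rewrite -{1}(prednK n0) Fop_siteS// prednK. Qed.

Lemma FadjE i u k : Fadj i u k = \sum_(j < n) (U k j i)%:C * u (site k j.+1).
Proof.
rewrite l2sum; apply: eq_bigr => j _.
by rewrite diagE ?decimateE//; exact: U_bound.
Qed.

Lemma decimate_Vop u : decimate d eps (Vop u) = u.
Proof. by apply: l2P => k; rewrite decimateE// -{1}(addn0 eps) -/(site k 0) Vop_site0. Qed.

Lemma decimate_Fop i u : decimate d eps (Fop i u) = 0.
Proof. by apply: l2P => k; rewrite decimateE// -(addn0 eps) -/(site k 0) Fop_site0. Qed.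

Lemma Fadj_Vop i u : Fadj i (Vop u) = 0.
Proof. by apply: l2P => k; rewrite FadjE big1// => j _; rewrite Vop_siteS// mulr0. Qed.

Lemma Fadj_Fop i l u : Fadj i (Fop l u) = if i == l then u else 0.
Proof.
apply: l2P => k; rewrite FadjE.
under eq_bigr do rewrite Fop_siteS// mulrA -rmorphM.
rewrite -mulr_suml -rmorph_sum (opmx_col cinj (weight_gt0 k)).
by case: eqP => _; rewrite ?mul1r ?mul0r.
Qed.

(** In each block the eigenvectors form an orthonormal basis. *)
Lemma block_resolution g : g = Vop (decimate d eps g) + \sum_i Fop i (Fadj i g).
Proof.
apply: site_ext => [k|k j jn]; rewrite [RHS]l2D l2sum.
  rewrite Vop_site0 decimateE// big1 ?addr0 => [|i _]; last exact: Fop_site0.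
  by rewrite /site addn0.
rewrite Vop_siteS// add0r.
under eq_bigr do rewrite Fop_siteS// FadjE mulr_sumr.
rewrite exchange_big (bigD1 (Ordinal jn))//= [X in _ + X]big1 ?addr0 => [|l lj].
  under eq_bigr do rewrite mulrA -rmorphM.
  by rewrite -mulr_suml -rmorph_sum (opmx_row cinj (weight_gt0 k))// eqxx mul1r.
under eq_bigr do rewrite mulrA -rmorphM.
rewrite -mulr_suml -rmorph_sum (opmx_row cinj (weight_gt0 k))//.
by move: lj; rewrite -val_eqE /= eq_sym => /negbTE ->; rewrite mul0r.
Qed.

Definition alpha i k := Num.sqrt (weight k i).
Definition beta i k := plast k * U k n.-1 i.

Lemma alphaE i k : alpha i k = pfirst k * U k 0 i.
Proof. by rewrite /alpha -(opmx_first cinj (weight_gt0 k)). Qed.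

Lemma bounded_alpha i : bounded_seq (alpha i).
Proof.
exists 1 => k; rewrite ger0_norm ?sqrtr_ge0// -sqrtr1 ler_sqrt//.
apply: le_trans (weight_sum k); rewrite (bigD1 i)//= lerDl.
by apply: sumr_ge0 => l _; rewrite ltW// weight_gt0.
Qed.

Lemma bounded_beta i : bounded_seq (beta i).
Proof.
have nn : (n.-1 < n)%N by rewrite prednK.
have [M HM] := plast_bound; have [N HN] := U_bound (Ordinal nn) i.
exists (M * N) => k; rewrite normrM ler_pM//.
by rewrite ger0_norm ?plast_ge0.
Qed.

Lemma alpha_gt0 i k : 0 < alpha i k.
Proof. by rewrite sqrtr_gt0 weight_gt0. Qed.

Lemma alpha_sqr i k : alpha i k ^+ 2 = critwt i * cflim (cfcoef i) (signed_off i) k.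
Proof.
rewrite sqr_sqrtr ?(ltW (weight_gt0 k i))// /weight /cfval.
by rewrite (eq_cflim (cfcoef i) (signed_sqr i)).2.
Qed.

(** The dependence on the weights cancels, by [opmx_last]. *)
Lemma alpha_beta i k : alpha i k * beta i k = - (critwt i * signed_off i (k + 1)).
Proof.
have nn : (n.-1 < n)%N by rewrite prednK.
have a0 := lead_gt0 expT; have dl := dlag_neq0 cinj i.
have s0 : 0 < Num.sqrt (nrm c (weight k) n.-1).
  by rewrite sqrtr_gt0 (nrm_gt0 cinj (weight_gt0 k)).
rewrite /signed_off [critwt i * _]mulrA critwt_sg// mulNr opprK.
rewrite /beta mulrCA [alpha i k * _]mulrC /alpha (opmx_last cinj (weight_gt0 k) i n0).
by rewrite /plast; field; rewrite dl !gt_eqF.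
Qed.

Definition Lop i := bidiag (alpha i) (beta i).
Definition Ladj i := bidiag_adj (alpha i) (beta i).
Definition Dop i u : l2 R := (critwt i)%:C *: posform i u.
Definition Einv i u : l2 R := (Num.sg (t i))%:C *: resolvent (t i)%:C Jt u.
Definition Eop i u : l2 R := ((critwt i)^-1)%:C *: Einv i u.
Definition Linv i u : l2 R := Eop i (Ladj i u).

Lemma critval_regular i : is_inverse (scal_sub (t i)%:C Jt) (resolvent (t i)%:C Jt).
Proof.
apply: resolventP => /specJ [x /= x1 /complexI xt].
have := crit_val_gt1 expT i; rewrite -xt.
by rewrite ltNge ler_norml x1.
Qed.

Lemma bounded_Einv i : bounded_op (Einv i).
Proof. by apply: boundedZ; case: (critval_regular i). Qed.

Lemma bounded_Eop i : bounded_op (Eop i).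
Proof. exact/boundedZ/bounded_Einv. Qed.

Lemma bounded_Dop i : bounded_op (Dop i).
Proof. exact/boundedZ/bounded_posform. Qed.

Lemma EinvK i : cancel (Einv i) (posform i).
Proof.
move=> u; have [_ _ RA] := critval_regular i; rewrite /posform /Einv.
have lS := (bounded_scal_sub (t i)%:C bJt).1.
by rewrite (linZ lS) RA scalerA -rmorphM sg_sqr scale1r.
Qed.

Lemma posformK i : cancel (posform i) (Einv i).
Proof.
move=> u; have [bR AR _] := critval_regular i; rewrite /posform /Einv.
by rewrite (linZ bR.1) AR scalerA -rmorphM sg_sqr scale1r.
Qed.

Let critwt_neq0 (i : 'I_n) : critwt i != 0. Proof. by rewrite gt_eqF// critwt_gt0. Qed.

Lemma EopK i u : Dop i (Eop i u) = u.
Proof.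
rewrite /Dop /Eop (linZ (bounded_posform i).1) EinvK scalerA -rmorphM mulfV//.
by rewrite scale1r.
Qed.

Lemma DopK i u : Eop i (Dop i u) = u.
Proof.
rewrite /Dop /Eop (linZ (bounded_Einv i).1) posformK scalerA -rmorphM mulVf//.
by rewrite scale1r.
Qed.

Lemma L_gram i u : Ladj i (Lop i u) = Dop i u.
Proof.
apply: (@bidiag_gram _ (posform i) (cfcoef i) (signed_off i) (`|t i| - 1)) => //.
- exact: (bounded_posform i).1.
- exact: posform_adjoint.
- exact: posformE.
- exact: posform_ge.
- exact: critwt_gt0.
- exact: bounded_alpha.
- exact: bounded_beta.
- exact: alpha_gt0.
- exact: alpha_sqr.
- exact: alpha_beta.
Qed.

Lemma bounded_Lop i : bounded_op (Lop i).
Proof. by apply: bounded_bidiag; [exact: bounded_alpha|exact: bounded_beta]. Qed.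

Lemma bounded_Linv i : bounded_op (Linv i).
Proof.
apply: (bounded_comp (bounded_Eop i)).
by apply: bounded_bidiag_adj; [exact: bounded_alpha|exact: bounded_beta].
Qed.

Lemma LopK i u : Linv i (Lop i u) = u.
Proof. by rewrite /Linv L_gram DopK. Qed.

Lemma LinvK i u : Lop i (Linv i u) = u.
Proof.
rewrite /Linv /Eop (linZ (bounded_Lop i).1).
have := @bidiag_inverse _ (posform i) (cfcoef i) (signed_off i) (`|t i| - 1)
  (bounded_posform i).1 (posform_adjoint i) (posformE i) (delta_gt0 i) (posform_ge i)
  (critwt i) (alpha i) (beta i) (critwt_gt0 expT i) (bounded_alpha i) (bounded_beta i)
  (alpha_gt0 i) (alpha_sqr i) (alpha_beta i) (Einv i) u (bounded_Einv i).1 (EinvK i).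
by rewrite -/(Lop i) -/(Ladj i) => ->; rewrite scalerA -rmorphM mulVf// scale1r.
Qed.

Lemma renormJ_Vop u : renormJ (Vop u) = (qbar T)%:C *: Vop u + \sum_i Fop i (Lop i u).
Proof.
apply: site_ext => [k|k j jn]; rewrite [RHS]l2D [in RHS]l2Z l2sum.
  rewrite renormJ_site0 Vop_site_n Vop_siteS// Vop_site0 !mulr0 add0r addr0.
  by rewrite big1 ?addr0// => i _; exact: Fop_site0.
rewrite renormJ_siteS// (Vop_siteS u k jn) !mulr0 add0r addr0.
have nn : (n.-1 < n)%N by rewrite prednK.
have -> : \sum_i Fop i (Lop i u) (site k j.+1) =
    (pfirst k * \sum_i U k j i * U k 0 i)%:C * u k
    + (plast k * \sum_i U k j i * U k n.-1 i)%:C * u (k + 1).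
  rewrite !mulr_sumr !rmorph_sum !mulr_suml -big_split; apply: eq_bigr => i _.
  rewrite Fop_siteS// /Lop bidiagE; [|exact: bounded_alpha|exact: bounded_beta].
  by rewrite alphaE /beta !rmorphM /=; ring.
rewrite !(opmx_row cinj (weight_gt0 k))//.
have -> : (offblock k j.+1)%:C * Vop u (site k j) = (pfirst k * (j == 0)%:R)%:C * u k.
  case: j jn => [|j] jn; first by rewrite Vop_site0 /= mulr1.
  by rewrite Vop_siteS ?(ltnW jn)// !mulr0 mul0r.
congr (_ + _); case: ifP => jn1.
  rewrite Vop_siteS// mulr0.
  have -> : (j == n.-1) = false by lia.
  by rewrite mulr0 mul0r.
have -> : (j == n.-1) = true by lia.
by rewrite mulr1 Vop_site0.
Qed.

(** Inside a block this is the three-term recurrence; its two boundary terms are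
the couplings to the cuts. *)
Lemma renormJ_Fop i v : renormJ (Fop i v) = (c i)%:C *: Fop i v + Vop (Ladj i v).
Proof.
have x0 := weight_gt0.
have nn : (n.-1 < n)%N by rewrite prednK.
apply: site_ext => [k|k j jn]; rewrite [RHS]l2D [in RHS]l2Z.
  rewrite renormJ_site0 Fop_site0 Vop_site0 !mulr0 addr0 add0r Fop_site_n Fop_siteS//.
  rewrite /Ladj bidiag_adjE; [|exact: bounded_alpha|exact: bounded_beta].
  by rewrite alphaE /beta !rmorphM /=; ring.
rewrite renormJ_siteS// Vop_siteS// addr0 (Fop_siteS i v k jn).
have -> : (if (j.+1 < n)%N then (offblock k j.+2)%:C * Fop i v (site k j.+2)
           else (plast k)%:C * Fop i v (site (k + 1) 0))
    = (offcoef c (weight k) j.+1 * U k j.+1 i)%:C * v k.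
  case: ifP => jn1; first by rewrite Fop_siteS// [in RHS]rmorphM -mulrA.
  have -> : j.+1 = n by lia.
  by rewrite Fop_site0 mulr0 (opmx_n cinj (x0 k)) mulr0 mul0r.
case: j jn => [|j] jn.
  have -> : (c i)%:C * ((U k 0 i)%:C * v k) = (c i * U k 0 i)%:C * v k.
    by rewrite realC_mulA.
  by rewrite (opmx_rec0 cinj (x0 k) i n0) Fop_site0 !(rmorphD, rmorphM) /=; ring.
have -> : (c i)%:C * ((U k j.+1 i)%:C * v k) = (c i * U k j.+1 i)%:C * v k.
  by rewrite realC_mulA.
rewrite (opmx_rec cinj (x0 k) i jn) Fop_siteS ?(ltnW jn)// /offblock.
by rewrite !(rmorphD, rmorphM) /=; ring.
Qed.

Lemma renormJ_Fop_Lop i u : renormJ (Fop i (Lop i u)) = (c i)%:C *: Fop i (Lop i u) + Vop (Dop i u).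
Proof. by rewrite renormJ_Fop L_gram. Qed.

Lemma ctau_neq0 z : (forall i, z != (c i)%:C) -> (cpoly (ctau T)).[z] != 0.
Proof.
move=> zc; rewrite /ctau /cpoly rmorph_prod horner_prod; apply/prodf_neq0 => i _.
by rewrite rmorphB /= map_polyX map_polyC /= hornerXsubC subr_eq0.
Qed.

Lemma dT_ctau z : (cpoly T^`()).[z] =
  (degree T)%:R * (lead_coef T)%:C * (cpoly (ctau T)).[z].
Proof. by rewrite {1}dT_tau// /cpoly map_polyZ hornerZ /= rmorphM /= rmorph_nat. Qed.

Lemma lead_neq0 : (lead_coef T)%:C != 0 :> R[i].
Proof. by rewrite -[0]/(0%:C) (inj_eq (@complexI R)) gt_eqF// lead_gt0. Qed.

Lemma Dop_at i v k : Dop i v k = (critwt i * Num.sg (t i))%:C * ((t i)%:C * v k - Jt v k).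
Proof. by rewrite /Dop /posform /scal_sub l2Z l2Z l2D l2N l2Z realC_mulA. Qed.

(** [T_critwt] at a complex point, with Jt in place of s. *)
Lemma spectral_identity z v : (forall i, z != (c i)%:C) ->
  (z - (qbar T)%:C) *: v - \sum_i (z - (c i)%:C)^-1 *: Dop i v =
  (degree T)%:R / (cpoly T^`()).[z] *: scal_sub (cpoly T).[z] Jt v.
Proof.
move=> zc.
pose a := (lead_coef T)%:C.
have an0 : a != 0 := lead_neq0.
have dl i : (dlag c i)%:C != 0.
  by rewrite -[0]/(0%:C) (inj_eq (@complexI R)) dlag_neq0.
have zc0 i : z - (c i)%:C != 0 by rewrite subr_eq0.
pose tau := (cpoly (ctau T)).[z].
pose la i := (cpoly (lagrange_basis c i)).[z].
have tE i : tau = (z - (c i)%:C) * la i.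
  rewrite /tau /ctau (bigD1 i)//= /cpoly rmorphM /= hornerM rmorphB /= map_polyX map_polyC /=.
  by rewrite hornerXsubC.
have tau0 : tau != 0 := ctau_neq0 zc.
have E1 : (cpoly T).[z] = a * (tau * (z - (qbar T)%:C)) + \sum_i (t i)%:C / (dlag c i)%:C * la i.
  rewrite {1}(T_interp expT) /cpoly rmorphD /= hornerD map_polyZ hornerZ rmorphM /= hornerM.
  rewrite rmorphB /= map_polyX map_polyC /= hornerXsubC; congr (_ + _).
  rewrite rmorph_sum horner_sum; apply: eq_bigr => i _.
  by rewrite /= map_polyZ hornerZ /= fmorph_div.
have E2 : 1 = \sum_i ((dlag c i)%:C)^-1 * la i.
  have := congr1 (fun p => (cpoly p).[z]) (one_interp expT).
  rewrite /= {1}/cpoly rmorph1 hornerC => ->.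
  rewrite /cpoly rmorph_sum horner_sum; apply: eq_bigr => i _.
  by rewrite /= map_polyZ hornerZ /= fmorphV.
have E3 : (cpoly T^`()).[z] = (degree T)%:R * a * tau := dT_ctau z.
have dd : (degree T)%:R != 0 :> R[i] by rewrite pnatr_eq0 -lt0n.
have Ew i : (critwt i * Num.sg (t i))%:C = - (a * (dlag c i)%:C)^-1.
  by rewrite critwt_sg// rmorphN fmorphV rmorphM.
apply: l2P => k; rewrite !(l2D, l2N, l2Z) l2sum.
have -> : \sum_i ((z - (c i)%:C)^-1 *: Dop i v) k =
   - ((\sum_i (t i)%:C / (dlag c i)%:C * la i) * v k
      - (\sum_i ((dlag c i)%:C)^-1 * la i) * Jt v k) / (a * tau).
  rewrite !mulr_suml -sumrB -sumrN mulr_suml; apply: eq_bigr => i _.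
  have la0 : la i != 0 by move: tau0; rewrite (tE i) mulf_eq0 negb_or => /andP[].
  rewrite l2Z Dop_at Ew (tE i).
  by field; rewrite an0 dl zc0 la0.
rewrite -E2 E3 E1; field.
by rewrite dd an0 tau0.
Qed.

Lemma renorm_solution : spectrum renormJ `<=` preimage_segment T /\
  renormalization_equation T eps Jt renormJ.
Proof.
have bJ : bounded_op renormJ by case: jacobi_renormJ.
have bV : bounded_op Vop := bounded_interlace R eps d0.
have bVs : bounded_op (decimate (R := R) d eps) := bounded_decimate R eps d0.
have cCinj : injective (fun i => (c i)%:C).
  by move=> i l /complexI/cinj.
have main z : ~ preimage_segment T z ->
    exists2 B, is_inverse (scal_sub z renormJ) B &
      forall u, decimate d eps (B (Vop u)) =
        ((cpoly T^`()).[z] / (degree T)%:R) *: resolvent (cpoly T).[z] Jt u.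
  move=> zT.
  have [[m zm]|zc] := pselect (exists m, z = (c m)%:C).
    have [B hB BV] := critical_inverse bJ bV bVs bounded_Fop
      bounded_Fadj bounded_Lop bounded_Linv bounded_Dop bounded_Eop decimate_Vop decimate_Fop Fadj_Vop Fadj_Fop
      block_resolution LinvK LopK EopK DopK renormJ_Vop renormJ_Fop_Lop m cCinj.
    exists B; first by rewrite zm.
    move=> u; rewrite BV zm.
    have -> : (cpoly T^`()).[(c m)%:C] = 0.
      have := root_critpt expT m; rewrite /root => /eqP h.
      by rewrite /cpoly horner_map /= h.
    by rewrite mul0r scale0r.
  have zc' i : z != (c i)%:C by apply/eqP => zi; apply: zc; exists i.
  have hR : is_inverse (scal_sub (cpoly T).[z] Jt) (resolvent (cpoly T).[z] Jt).
    by apply: resolventP => /specJ.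
  have dT0 : (cpoly T^`()).[z] != 0.
    by rewrite dT_ctau !mulf_neq0 ?ctau_neq0 ?lead_neq0// pnatr_eq0 -lt0n.
  have k0 : (degree T)%:R / (cpoly T^`()).[z] != 0.
    by rewrite mulf_neq0 ?invr_eq0// pnatr_eq0 -lt0n.
  have [B hB BV] := regular_inverse bJ bV bVs bounded_Fop
      bounded_Fadj bounded_Lop bounded_Linv bounded_Dop decimate_Vop decimate_Fop Fadj_Vop Fadj_Fop
      block_resolution LinvK LopK renormJ_Vop renormJ_Fop_Lop bJt zc' k0 hR
      (fun v => spectral_identity v zc').
  by exists B => // u; rewrite BV invf_div.
split.
  by move=> z sz; apply: contrapT => zT; have [B hB _] := main z zT; apply: sz; exists B.
move=> z zT u; have [B hB BV] := main z zT.
by rewrite adjoint_interlace// (resolventE hB) -BV.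
Qed.

End Definition_of_J.

(** * Contraction *)

Lemma entries_le_opnorm (R : realType) (A B : l2 R -> l2 R) k : jacobi A -> jacobi B ->
  `|diagonal A k - diagonal B k| <= opnorm (A \- B) /\
  `|offd A k - offd B k| <= opnorm (A \- B).
Proof.
move=> [bA _ _] [bB _ _]; have bAB : bounded_op (A \- B) := boundedB bA bB.
have h j : `|complex.Re (A (ket R k) j) - complex.Re (B (ket R k) j)| <= opnorm (A \- B).
  apply: le_trans (normc_le_opnorm j k bAB).
  by rewrite -ReN -ReD; exact: normc_Re.
by split; exact: h.
Qed.

Section Contraction.
Variables (R : realType) (T : {poly R}) (J1 J2 : l2 R -> l2 R) (del : R).
Hypotheses (expT : expanding T) (T10 : forall t, root T^`() t -> 10 <= `|T.[t]|).
Hypotheses (jJ1 : jacobi J1) (specJ1 : spectrum J1 `<=` segment (R := R)).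
Hypotheses (jJ2 : jacobi J2) (specJ2 : spectrum J2 `<=` segment (R := R)).
Hypothesis del_le : 0 <= del <= 2.
Hypothesis diag_le : forall k, `|diagonal J1 k - diagonal J2 k| <= del.
Hypothesis off_le : forall k, `|offd J1 k - offd J2 k| <= del.

Notation n := (degree T - 1)%N.
Local Notation t i := T.[@critpt R T i].
Local Notation c := (@critpt R T).
Notation rho := (5 / 36 * del).

Let t9 i : 9 <= `|t i| - 1.
Proof. by have := T10 (root_critpt expT i); lra. Qed.

Let n0 : (0 < n)%N.
Proof. by have := deg_ge2 expT; lia. Qed.

Let rho_le : 0 <= rho <= 5 / 18.
Proof. by case/andP: del_le => *; apply/andP; split; lra. Qed.

Let X1_ge (i : 'I_n) m k : 9 <= cfrac (cfcoef J1 i) (offd J1) m k.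
Proof. exact: le_trans (t9 i) (cfrac_coef_ge expT jJ1 specJ1 i m k). Qed.

Let X2_ge (i : 'I_n) m k : 9 <= cfrac (cfcoef J2 i) (offd J2) m k.
Proof. exact: le_trans (t9 i) (cfrac_coef_ge expT jJ2 specJ2 i m k). Qed.

Let cfval1_ge (i : 'I_n) k : 9 <= cfval J1 i k.
Proof. exact: le_trans (t9 i) (cfval_ge expT jJ1 specJ1 i k). Qed.

Let cfval2_ge (i : 'I_n) k : 9 <= cfval J2 i k.
Proof. exact: le_trans (t9 i) (cfval_ge expT jJ2 specJ2 i k). Qed.

Lemma cfval_stable (i : 'I_n) k : `|cfval J1 i k - cfval J2 i k| <= 5 / 4 * del.
Proof.
have /andP[d0 _] := del_le.
apply: (cflim_stable d0 (X1_ge i) (X2_ge i)) => // m.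
- by rewrite offd_ge0//= offd_le1.
- by rewrite offd_ge0//= offd_le1.
have -> : cfcoef J1 i m - cfcoef J2 i m
  = - (Num.sg (t i) * (diagonal J1 m - diagonal J2 m)) by rewrite /cfcoef; ring.
by rewrite normrN normrM sg_norm// mul1r.
Qed.

(** The absolute error 5/4 del on pivots that are at least 9 is the relative error
5/36 del. *)
Lemma weight_stable k (i : 'I_n) :
  `|weight J2 k i - weight J1 k i| <= rho * weight J1 k i /\
  `|weight J1 k i - weight J2 k i| <= rho * weight J2 k i.
Proof.
have w0 := critwt_gt0 expT i; have /andP[d0 _] := del_le.
have h := cfval_stable i k; have h1 := cfval1_ge i k; have h2 := cfval2_ge i k.
have E (x : R) : rho * (critwt i * x) = critwt i * (rho * x) by ring.
split; rewrite /weight -mulrBr normrM (ger0_norm (ltW w0)) E ler_wpM2l ?(ltW w0)//;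
  [rewrite distrC|]; nra.
Qed.

Let x1 k := weight_gt0 expT jJ1 specJ1 k.
Let x2 k := weight_gt0 expT jJ2 specJ2 k.
Let cinj : injective c := critpt_inj expT.
Let w12 k i := (weight_stable k i).1.
Let w21 k i := (weight_stable k i).2.

Lemma dist_le (e e' : R) : 0 <= e <= 1 -> 0 <= e' <= 1 ->
  e' - e <= 3 / 2 * rho * e -> e - e' <= 3 / 2 * rho * e' -> `|e - e'| <= 3 / 2 * rho.
Proof.
move=> /andP[e0 e1] /andP[e0' e1'] h h'; have /andP[r0 _] := rho_le.
rewrite ler_norml; apply/andP; split; nra.
Qed.

(** The factor of the off-diagonal entry of Jt is at most 1/9, which damps the
direct dependence on that entry. *)
Lemma plast_stable k : `|plast T J1 k - plast T J2 k| <= 3 / 2 * rho.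
Proof.
have nn : (n.-1 < n)%N by rewrite prednK.
pose a := (lead_coef T)^-1.
have a0 : 0 <= a by rewrite invr_ge0 ltW// lead_gt0.
pose s1 := (Num.sqrt (nrm c (weight J1 k) n.-1))^-1.
pose s2 := (Num.sqrt (nrm c (weight J2 k) n.-1))^-1.
have h12 : s2 - s1 <= 3 / 2 * rho * s1.
  exact: (invsqrt_stable cinj (x1 k) (x2 k) rho_le (w12 k) nn).
have h21 : s1 - s2 <= 3 / 2 * rho * s2.
  exact: (invsqrt_stable cinj (x2 k) (x1 k) rho_le (w21 k) nn).
have b1 : a * s1 <= 9^-1 by apply: (last_coupling_le expT jJ1 specJ1) => // i; exact: cfval1_ge.
have b2 : a * s2 <= 9^-1 by apply: (last_coupling_le expT jJ2 specJ2) => // i; exact: cfval2_ge.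
have s10 : 0 <= s1 by rewrite invr_ge0 sqrtr_ge0.
have s20 : 0 <= s2 by rewrite invr_ge0 sqrtr_ge0.
have e10 : 0 <= a * s1 by rewrite mulr_ge0.
have e20 : 0 <= a * s2 by rewrite mulr_ge0.
have {}h12 : a * s2 - a * s1 <= 3 / 2 * rho * (a * s1).
  by rewrite -mulrBr mulrCA ler_wpM2l.
have {}h21 : a * s1 - a * s2 <= 3 / 2 * rho * (a * s2).
  by rewrite -mulrBr mulrCA ler_wpM2l.
have p1 := offd_ge0 jJ1 (k + 1); have p1' := offd_le1 jJ1 specJ1 (k + 1).
have p2 := offd_ge0 jJ2 (k + 1); have p2' := offd_le1 jJ2 specJ2 (k + 1).
have dp := off_le (k + 1); have /andP[d0 d2] := del_le.
rewrite /plast -!mulrA -/a -/s1 -/s2.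
move: (offd J1 _) (offd J2 _) (a * s1) (a * s2) p1 p1' p2 p2' dp b1 b2 e10 e20 h12 h21.
move=> p p' e e' p0 p1 p0' p1' dp b1 b2 e0 e0' h h'.
have -> : p * e - p' * e' = (p - p') * e + p' * (e - e') by ring.
rewrite (le_trans (ler_normD _ _))// !normrM (ger0_norm e0) (ger0_norm p0').
have he : `|e - e'| <= 3 / 2 * rho * 9^-1 by rewrite ler_norml; apply/andP; split; nra.
have g1 : `|p - p'| * e <= del * 9^-1 by rewrite ler_pM.
have g2 : p' * `|e - e'| <= 3 / 2 * rho * 9^-1.
  by rewrite -[leRHS]mul1r ler_pM.
lra.
Qed.

Lemma offblock_stable k j : (j <= n)%N ->
  `|offblock T J1 k j - offblock T J2 k j| <= 3 / 2 * rho.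
Proof.
case: j => [|[|j]] jn /=; first exact: plast_stable.
  apply: dist_le.
  - by rewrite pfirst_ge0 pfirst_le1.
  - by rewrite pfirst_ge0 pfirst_le1.
  - exact: (first_stable cinj (x1 k) (x2 k) rho_le (w12 k)).
  - exact: (first_stable cinj (x2 k) (x1 k) rho_le (w21 k)).
have c1 := critpt_le1 expT.
apply: dist_le.
- exact: (offcoef_le1 cinj (x1 k) c1).
- exact: (offcoef_le1 cinj (x2 k) c1).
- exact: (offcoef_stable cinj (x1 k) (x2 k) rho_le (w12 k)).
- exact: (offcoef_stable cinj (x2 k) (x1 k) rho_le (w21 k)).
Qed.

Lemma diagblock_stable k j : (j <= n)%N ->
  `|diagblock T J1 k j - diagblock T J2 k j| <= 17 / 6 * rho.
Proof.
have /andP[r0 _] := rho_le.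
case: j => [|j] jn /=; first by rewrite subrr normr0; lra.
rewrite distrC.
exact: (diagcoef_stable cinj (x1 k) (x2 k) rho_le (w12 k) (critpt_le1 expT)).
Qed.

(** (17/6 + 2 * 3/2) * 5/36 = 175/216. *)
Lemma renormJ_contraction eps :
  opnorm (renormJ T eps J1 \- renormJ T eps J2) <= 175 / 216 * del.
Proof.
have /andP[r0 _] := rho_le; have /andP[d0 _] := del_le.
have dn : degree T = n.+1 by have := deg_ge2 expT; lia.
pose dp m := blocks T eps (offblock T J1) m - blocks T eps (offblock T J2) m.
pose dq m := blocks T eps (diagblock T J1) m - blocks T eps (diagblock T J2) m.
have dpE m : `|dp m| <= 3 / 2 * rho.
  have [k [j [jd ->]]] := siteP eps expT m; rewrite /dp !blocksE//.
  by apply: offblock_stable; rewrite dn in jd.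
have dqE m : `|dq m| <= 17 / 6 * rho.
  have [k [j [jd ->]]] := siteP eps expT m; rewrite /dq !blocksE//.
  by apply: diagblock_stable; rewrite dn in jd.
have bdp : bounded_seq dp by exists (3 / 2 * rho).
have bdq : bounded_seq dq by exists (17 / 6 * rho).
have [o1 g1] := renormJ_bounded eps expT jJ1 specJ1.
have [o2 g2] := renormJ_bounded eps expT jJ2 specJ2.
apply: opnorm_le => [|u]; first lra.
have -> : (renormJ T eps J1 \- renormJ T eps J2) u = tridiag dp dq u.
  apply: l2P => m.
  apply: etrans (congr2 (fun x y => x - y) (tridiagE u m o1 g1) (tridiagE u m o2 g2)) _.
  apply: etrans _ (esym (tridiagE u m bdp bdq)).
  by rewrite /dp /dq !rmorphB /=; ring.
apply: le_trans (tridiag_le u _ _ dpE dqE) _; try lra.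
Qed.

End Contraction.

Theorem theorem1p1 (R : realType) :
  exists J : {poly R} -> nat -> (l2 R -> l2 R) -> (l2 R -> l2 R),
    (forall (T : {poly R}) (eps : nat) (Jt : l2 R -> l2 R),
       expanding T -> (eps <= degree T - 1)%N ->
       jacobi Jt -> spectrum Jt `<=` segment (R := R) ->
       [/\ jacobi (J T eps Jt),
           spectrum (J T eps Jt) `<=` preimage_segment T &
           renormalization_equation T eps Jt (J T eps Jt)]) /\
    (exists c : R, c < 1 /\
       forall T : {poly R}, expanding T ->
         (forall t : R, root T^`() t -> 10 <= `|T.[t]|) ->
         forall (eps : nat) (J1 J2 : l2 R -> l2 R),
           (eps <= degree T - 1)%N ->
           jacobi J1 -> spectrum J1 `<=` segment (R := R) ->
           jacobi J2 -> spectrum J2 `<=` segment (R := R) ->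
           opnorm (J T eps J1 \- J T eps J2) <= c * opnorm (J1 \- J2)).
Proof.
exists (@renormJ R); split.
  move=> T eps Jt expT _ jJ specJ.
  have [h1 h2] := renorm_solution eps expT jJ specJ.
  by split => //; exact: jacobi_renormJ.
exists (175 / 216); split; first lra.
move=> T expT T10 eps J1 J2 _ jJ1 specJ1 jJ2 specJ2.
have E k := entries_le_opnorm k jJ1 jJ2.
have O0 : 0 <= opnorm (J1 \- J2) := le_trans (normr_ge0 _) (E 0).1.
(* the entries lie in [-1, 1], so 2 bounds their differences anyway; the cap gives rho <= 5/18 *)
pose del := Num.min (opnorm (J1 \- J2)) 2.
have del_le : 0 <= del <= 2 by rewrite le_min O0 ler0n ge_min lexx orbT.
have bound (x y : R) : `|x - y| <= opnorm (J1 \- J2) -> `|x| + `|y| <= 2 -> `|x - y| <= del.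
  by move=> h1 h2; rewrite le_min h1 /= (le_trans (ler_normB _ _) h2).
apply: le_trans (renormJ_contraction expT T10 jJ1 specJ1 jJ2 specJ2 del_le _ _ eps) _.
- move=> k; apply: bound; first exact: (E k).1.
  by have := diagonal_le1 jJ1 specJ1 k; have := diagonal_le1 jJ2 specJ2 k; lra.
- move=> k; apply: bound; first exact: (E k).2.
  rewrite !ger0_norm ?offd_ge0//.
  by have := offd_le1 jJ1 specJ1 k; have := offd_le1 jJ2 specJ2 k; lra.
- by rewrite ler_wpM2l ?ge_min ?lexx//; lra.
Qed.
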